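(* Let $X$ be a diffusion as in the context, let $h:\mathbb{R}_+\to\mathbb{R}_+$ be Borel measurable with $\int_0^\infty h(x)\,dx=1$, and let $\mathbf{Q}^h$ be the probability measure defined in the context. Then under $\mathbf{Q}^h$ the random variable $L_\infty:=\lim_{t\to\infty}L_t$ is finite a.s. and $$\mathbf{Q}^h(L_\infty\in d\ell)=h(\ell)\,d\ell .$$
   Context: Setting. $X$ is a linear regular recurrent diffusion taking values in $\mathbb{R}_+=[0,\infty)$, with $0$ an instantaneously reflecting boundary and $+\infty$ a natural boundary. $\mathbf{P}_x$ and $\mathbf{E}_x$ are the probability measure and expectation when $X$ starts from $x\ge 0$. $X$ is the coordinate process on the canonical space $C$ of continuous functions $\omega:\mathbb{R}_+\to\mathbb{R}_+$; $\mathcal{C}_t:=\sigma\{\omega(s):s\le t\}$ and $\mathcal{C}$ is the smallest $\sigma$-algebra containing all $\mathcal{C}_t$, $t\ge0$. $m$ is the speed measure and $S$ the scale function of $X$ (generator $\frac{d}{dm}\frac{d}{dS}$); $S$ is normalized by $S(0)=0$, $S(+\infty)=+\infty$ by recurrence, and $m$ has no atoms. $p(t;x,y)$ is the jointly continuous symmetric transition density of $X$ with respect to $m$, and $R_\lambda(x,y)=\int_0^\infty e^{-\lambda t}p(t;x,y)\,dt$ for $\lambda>0$. Local time. $L_t$ is the local time of $X$ at $0$, normalized by $L_t=\lim_{\delta\downarrow0}\frac{1}{m((0,\delta))}\int_0^t \mathbf{1}_{[0,\delta)}(X_s)\,ds$. Its right-continuous inverse $\tau_\ell:=\inf\{s:L_s>\ell\}$,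 $\ell\ge0$, is a subordinator under $\mathbf{P}_0$ (without drift), with Lévy measure $\nu$ given by $\mathbf{E}_0(e^{-\lambda\tau_\ell})=\exp(-\ell/R_\lambda(0,0))=\exp(-\ell\int_0^\infty(1-e^{-\lambda v})\,\nu(dv))$. Standing assumption (A). The probability distribution function $x\mapsto \nu((1,x])/\nu((1,+\infty))$, $x>1$ (equal to $0$ for $x\le1$), is subexponential, where a distribution function $F$ on $(0,\infty)$ with $F(0+)=0$, $F(x)<1$ for all $x>0$, $\lim_{x\to\infty}F(x)=1$ is subexponential if $\lim_{x\to\infty}\overline{F*F}(x)/\overline F(x)=2$, with $\overline F=1-F$ and $*$ convolution. Penalized measure. For $h$ as in the claim put $H(x):=\int_0^x h(y)\,dy$ and $M^h_t:=S(X_t)h(L_t)+1-H(L_t)$. It is known that $\{M^h_t:t\ge0\}$ is a martingale under $\mathbf{P}_0$ with $\mathbf{E}_0(M^h_t)=1$ and $\lim_{t\to\infty}M^h_t=0$. The probability measure $\mathbf{Q}^h$ on $(C,\mathcal{C})$ is determined by $\mathbf{Q}^h(\Lambda_u):=\mathbf{E}_0(\mathbf{1}_{\Lambda_u}M^h_u)$ for all $u\ge0$ and $\Lambda_u\in\mathcal{C}_u$. *)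

(* Defs.v *)
From HB Require Import structures.
From mathcomp Require Import all_boot all_order all_algebra.
From mathcomp Require Import all_classical all_reals all_analysis.
From mathcomp Require Import measurable_realfun.

Set Implicit Arguments.
Unset Strict Implicit.
Unset Printing Implicit Defensive.

Import Order.TTheory GRing.Theory Num.Theory.
Import numFieldNormedType.Exports.

Local Open Scope classical_set_scope.
Local Open Scope ring_scope.

(* A continuous function R_+ -> R_+ is encoded as a continuous function R -> R
   with nonnegative values that is constant on ]-oo, 0], so that Leibniz
   equality of paths is equality on R_+ (with extensionality). *)
Record cpath (R : realType) := CPath {
  path_fun :> R -> R ;
  path_continuous : continuous path_fun ;
  path_ge0 : forall t, 0 <= path_fun t ;
  path_const : forall t, t <= 0 -> path_fun t = path_fun 0 }.

HB.instance Definition _ (R : realType) := gen_eqMixin (cpath R).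
HB.instance Definition _ (R : realType) := gen_choiceMixin (cpath R).

Definition path0 (R : realType) : cpath R :=
  @CPath R (fun=> 0) (fun=> cvg_cst 0) (fun=> lexx 0) (fun _ _ => erefl).

HB.instance Definition _ (R : realType) := isPointed.Build (cpath R) (path0 R).

Definition cylinders (R : realType) (I : set R) : set (set (cpath R)) :=
  [set A | exists2 s, I s &
           exists2 B : set R, measurable B & A = [set w : cpath R | B (w s)]].

HB.instance Definition _ (R : realType) := Measurable.copy (cpath R)
  (g_sigma_algebraType (@cylinders R [set s | 0 <= s])).

Section canonical_space.
Variable R : realType.
Implicit Types (t s x y lambda : R) (w : cpath R) (T : cpath R -> \bar R).

Definition path_filtration t : set (set (cpath R)) :=
  <<s @cylinders R [set s | 0 <= s <= t] >>.

Lemma shift_continuous s w : continuous (fun t => w (s + Num.max t 0)).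
Proof.
move=> t; apply: (@continuous_comp _ _ _ (fun t => s + Num.max t 0) w).
  apply: cvgD; first exact: cvg_cst.
  by apply: continuous_max; [exact: cvg_id | exact: cvg_cst].
exact: path_continuous.
Qed.

Lemma shift_const s w t :
  t <= 0 -> w (s + Num.max t 0) = w (s + Num.max 0 0).
Proof. by move=> t0; rewrite (max_idPr t0) maxxx. Qed.

(* Restricted to t >= 0 this is t |-> w (s + t), for s >= 0. *)
Definition path_shift s w : cpath R :=
  CPath (@shift_continuous s w) (fun t => path_ge0 w (s + Num.max t 0))
        (@shift_const s w).

Definition hitting_time y w : \bar R :=
  ereal_inf [set t%:E | t in [set t : R | 0 <= t /\ w t = y]].

(* Markov times T and their sigma-fields in the sense of Ito-McKean, i.e.
   relative to the right-continuous regularization of the filtration. *)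
Definition markov_time T :=
  (forall w, (0 <= T w)%E) /\
  (forall t, 0 <= t -> path_filtration t [set w | (T w < t%:E)%E]).

Definition markov_time_events T : set (set (cpath R)) :=
  [set A | measurable A /\
    forall t, 0 <= t -> path_filtration t (A `&` [set w | (T w < t%:E)%E])].

End canonical_space.

Section diffusions.
Variable R : realType.
Variables (P : R -> probability (cpath R) R) (S : cumulative R R)
  (m : {measure set R -> \bar R}).
Implicit Types (f g : R -> R) (x y t lambda ell : R) (w : cpath R).

Definition bounded_continuous f :=
  {within `[0, +oo[, continuous f} /\
  exists K : R, forall x, 0 <= x -> `|f x| <= K.

Definition semigroup t f x : R := \int[P x]_w f (w t).

(* (f, g) is in the graph of the infinitesimal generator of P on
   C_b([0, +oo[), for bounded pointwise convergence. *)
Definition generator f g :=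
  [/\ bounded_continuous f, bounded_continuous g,
      (exists K : R, forall t x, 0 < t -> 0 <= x ->
         `|(semigroup t f x - f x) / t| <= K) &
      forall x, 0 <= x -> (semigroup t f x - f x) / t @[t --> 0^'+] --> g x].

(* g = d/dm (df/dS) on [0, +oo[, where fS = df/dS satisfies the boundary
   condition fS 0 = 0 of a reflecting barrier. *)
Definition dm_dS_reflecting f g := exists fS : R -> R,
  [/\ forall x, 0 < x -> (f y - f x) / (S y - S x) @[y --> x^'] --> fS x,
      (f y - f 0) / (S y - S 0) @[y --> 0^'+] --> fS 0,
      fS 0 = 0 &
      forall a b : R, 0 <= a -> a < b -> fS b - fS a = \int[m]_(x in `]a, b]) g x].

Definition strong_markov :=
  forall x T (A B : set (cpath R)), 0 <= x -> markov_time T -> markov_time_events T A ->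
    measurable B ->
    let A' := A `&` [set w | (T w < +oo)%E] in
    P x (A' `&` [set w | B (path_shift (fine (T w)) w)]) =
    (\int[P x]_(w in A') P (w (fine (T w))) B)%E.

(* Only the values of P x for x >= 0, of S on [0, +oo[ and of m on subsets of
   [0, +oo[ matter; S is extended by 0 and m by the null measure.  With S
   finite at 0 and m finite near 0, the point 0 is both exit and entrance;
   with fS 0 = 0 and m [set 0] = 0 it is instantaneously reflecting. *)
Record linear_diffusion : Prop := LinearDiffusion {
  diff_start : forall x, 0 <= x -> P x [set w | w 0 = x] = 1%E ;
  diff_kernel : forall B : set (cpath R), measurable B ->
    measurable_fun (`[0, +oo[ : set R) (fun x : R => P x B) ;
  diff_strong_markov : strong_markov ;
  diff_regular : forall x y, 0 <= x -> 0 <= y ->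
    (0 < P x [set w | hitting_time y w < +oo])%E ;
  diff_recurrent : forall x y, 0 <= x -> 0 <= y ->
    P x [set w | (hitting_time y w < +oo)%E] = 1%E ;
  scale_le0 : forall x, x <= 0 -> S x = 0 ;
  scale_continuous : continuous S ;
  scale_increasing : forall x y, 0 <= x -> x < y -> S x < S y ;
  scale_pinfty : S x @[x --> +oo] --> +oo ;
  scale_exit : forall a x b : R, 0 <= a -> a < x -> x < b ->
    P x [set w | (hitting_time a w < hitting_time b w)%E] =
    ((S b - S x) / (S b - S a))%:E ;
  speed_neg : m `]-oo, 0[%classic = 0%E ;
  speed_noatom : forall x, m [set x] = 0%E ;
  speed_finite : forall b : R, 0 <= b -> (m `[0%R, b]%classic < +oo)%E ;
  speed_gt0 : forall a b : R, 0 <= a -> a < b -> (0 < m `]a, b[%classic)%E ;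
  (* Feller's criteria: +oo is natural, i.e. neither exit nor entrance *)
  pinfty_not_exit : forall z : R, 0 < z ->
    (\int[lebesgue_stieltjes_measure S]_(y in `]z, +oo[) m `]z, y[%classic
      = +oo)%E ;
  pinfty_not_entrance : forall z : R, 0 < z ->
    (\int[m]_(y in `]z, +oo[) (S y - S z)%:E = +oo)%E ;
  diff_generator : forall f g,
    generator f g <->
    [/\ bounded_continuous f, bounded_continuous g & dm_dS_reflecting f g] }.

Record transition_density (p : R -> R -> R -> R) : Prop := TransitionDensity {
  density_ge0 : forall t x y, 0 < t -> 0 <= x -> 0 <= y -> 0 <= p t x y ;
  density_sym : forall t x y, 0 < t -> 0 <= x -> 0 <= y -> p t x y = p t y x ;
  density_continuous :
    {within [set z : R * R * R | [/\ 0 < z.1.1, 0 <= z.1.2 & 0 <= z.2]],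
      continuous (fun z => p z.1.1 z.1.2 z.2)} ;
  densityE : forall t x (B : set R), 0 < t -> 0 <= x -> measurable B ->
    P x [set w | B (w t)] =
    (\int[m]_(y in B `&` `[0%R, +oo[) (p t x y)%:E)%E }.

Definition resolvent_density (p : R -> R -> R -> R) lambda x y : R :=
  \int[lebesgue_measure]_(t in `]0, +oo[) (expR (- lambda * t) * p t x y).

Definition normalized_occupation t w (delta : R) : R :=
  (fine (m `]0, delta[%classic))^-1 *
  \int[lebesgue_measure]_(s in `[0, t]) \1_(`[0, delta[%classic) (w s).

Definition local_time t w : R :=
  lim (normalized_occupation t w delta @[delta --> 0^'+]).

(* The total operator lim is meaningless where there is no limit: local_time
   is the local time at 0 provided the limit exists, almost surely for all t
   simultaneously, and defines a continuous process. *)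
Definition local_time_exists := forall x, 0 <= x ->
  {ae P x, forall w,
    (forall t, 0 <= t ->
      cvg (normalized_occupation t w delta @[delta --> 0^'+])) /\
    {within `[0, +oo[, continuous (fun t => local_time t w)}}.

Definition inverse_local_time ell w : \bar R :=
  ereal_inf [set s%:E | s in [set s : R | 0 <= s /\ ell < local_time s w]].

Definition inverse_local_time_levy_measure (p : R -> R -> R -> R)
    (nu : {measure set R -> \bar R}) :=
  nu `]-oo, 0]%classic = 0%E /\
  forall lambda ell, 0 < lambda -> 0 <= ell ->
    let laplace :=
      (\int[P 0%R]_w expeR (- (lambda%:E * inverse_local_time ell w)))%E in
    laplace = (expR (- (ell / resolvent_density p lambda 0 0)))%:E /\
    laplace = expeR (- (ell%:E *
      \int[nu]_(v in `]0%R, +oo[) (1 - expR (- lambda * v))%:E))%E.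

Definition primitive (h : R -> R) x : R := \int[lebesgue_measure]_(y in `[0, x]) h y.

Definition penalization (h : R -> R) t w : R :=
  S (w t) * h (local_time t w) + 1 - primitive h (local_time t w).

Definition penalized_measure (h : R -> R) (Q : probability (cpath R) R) :=
  forall (u : R) (Lambda : set (cpath R)), 0 <= u -> path_filtration u Lambda ->
    Q Lambda = ('E_(P 0%R)[(fun w => \1_Lambda w * penalization h u w)%R])%E.

End diffusions.

Section subexponential.
Variable R : realType.

Definition convolution_square (F : cumulative R R) (x : R) : R :=
  \int[lebesgue_stieltjes_measure F]_y F (x - y).

Definition subexponential (F : R -> R) := exists2 G : cumulative R R,
  F = G :> (R -> R) &
  [/\ forall x : R, x <= 0 -> F x = 0,
      F x @[x --> 0^'+] --> (0 : R),
      forall x : R, 0 < x -> F x < 1,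
      F x @[x --> +oo] --> (1 : R) &
      (1 - convolution_square G x) / (1 - F x) @[x --> +oo] --> (2 : R)].

Definition normalized_levy_cdf (nu : {measure set R -> \bar R}) (x : R) : R :=
  if 1 < x then fine (nu `]1, x]%classic) / fine (nu `]1, +oo[%classic) else 0.

End subexponential.

(* Main.v *)
(* The heart of the proof is the inequality E_0[S(X_t) psi(L_t)] <= \int psi for
   Borel psi >= 0.  With psi = 1_B h it yields
     Q(L_t in B) <= \int_B h + E_0[1 - H(L_t)],
   where the error tends to 0 because L_oo = +oo P_0-a.s. (the Laplace transform
   of the inverse local time tends to 1 at 0).  Both sides being governed by
   probability measures, the inequality for B and for its complement gives
   Q(L_t in B) --> \int_B h, and L is nondecreasing Q-a.s. because Q << P_0 on
   every C_t.
   For the inequality, S is approximated by functions f in the domain of the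
   generator, with image g - k where g >= 0 is an approximate identity at 0, so that
   D_t := \int_0^t g(X_s) ds is close to L_t, and k >= 0 lives near infinity.  For
   psi the indicator of an interval with primitive kappa, the generator gives
   E_0[f(X_t) psi(D_t)] <= E_0[kappa(D_t)] up to small terms, and one passes to the
   limit by Fatou's lemma. *)

Require Import Defs.
From HB Require Import structures.
From mathcomp Require Import all_boot all_order all_algebra.
From mathcomp Require Import all_classical all_reals all_analysis.
From mathcomp Require Import measurable_realfun.
From mathcomp Require Import ring lra.

Set Implicit Arguments.
Unset Strict Implicit.
Unset Printing Implicit Defensive.

Import Order.TTheory GRing.Theory Num.Theory.
Import numFieldNormedType.Exports.

Local Open Scope classical_set_scope.
Local Open Scope ring_scope.

(** * Real functions and integrals *)

(** Heuristically [S (X t) * psi (L t) - kappa (L t)] is a martingale, so its first term has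
    expectation at most the total increase of [kappa]. Several obstacles shape the rigorous version.
    [S] is unbounded, hence outside the domain of the generator; the term [k] makes its substitute
    bounded, and since [k >= 0] enters with a favourable sign, an upper bound survives. Local time
    has no density in time, whereas [D] has right derivative [g (X t)]: one-step increments, the
    Markov property and a Dini derivative then replace stochastic calculus. The substitute [f] does
    not vanish where [g > 0] but is at most [S (q n)] there; this forces a Lipschitz [psi] of slope
    [N], at the price of an error [N * S (q n)], and two successive limits, in [n] at fixed slope
    and then in the slope. Finally [Q] is controlled by [P 0] only up to finite times, while the
    existence of the local time involves uncountably many times and values of delta; both are
    reduced to countably many, so that the exceptional sets are events of the filtration. *)

Lemma cvg_maxr (R : realType) T (F : set_system T) (f g : T -> R) (a b : R) :
  Filter F -> f @ F --> a -> g @ F --> b ->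
  (fun x => Num.max (f x) (g x)) @ F --> Num.max a b.
Proof.
move=> FF fa gb; rewrite maxr_absE; under eq_fun do rewrite maxr_absE.
by apply: cvgMr_tmp; apply: cvgD; [exact: cvgD|apply: cvg_norm; exact: cvgB].
Qed.

Lemma cvg_minr (R : realType) T (F : set_system T) (f g : T -> R) (a b : R) :
  Filter F -> f @ F --> a -> g @ F --> b ->
  (fun x => Num.min (f x) (g x)) @ F --> Num.min a b.
Proof.
move=> FF fa gb; rewrite minr_absE; under eq_fun do rewrite minr_absE.
by apply: cvgMr_tmp; apply: cvgB; [exact: cvgD|apply: cvg_norm; exact: cvgB].
Qed.

(** Serves expectations of which only forward difference quotients are controlled. The supremum of
    the times at which [u] is under the line of slope [e / T] from [u 0] is such a time by
    continuity, and the hypothesis moves it to the right unless it is [T], where the line is [e]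
    above [u 0]. *)
Lemma right_Dini_le (R : realType) (u : R -> R) (T : R) :
  0 <= T -> continuous u ->
  (forall t e : R, 0 <= t -> 0 < e ->
     \forall h \near 0^'+, u (t + h) <= u t + e * h) ->
  u T <= u 0.
Proof.
move=> T0 uC uD; apply/ler_addgt0Pr => e e0.
have [T00|] := eqVneq T 0; first by rewrite T00 lerDl ltW.
move=> Tn0; have {Tn0}T0' : 0 < T by rewrite lt_def Tn0.
pose e' := e / T.
have e'0 : 0 < e' by rewrite divr_gt0.
pose A := [set s : R | 0 <= s <= T /\ u s <= u 0 + e' * s].
have A0 : A 0 by split; [rewrite lexx T0|rewrite mulr0 addr0].
have supA : has_sup A.
  by split; [exists 0|exists T => s [/andP[]]].
pose s := sup A.
have s0 : 0 <= s by apply: sup_ubound => //; exact: supA.2.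
have sT : s <= T by apply: ge_sup; [exists 0|move=> x [/andP[]]].
have As : A s.
  split; first by rewrite s0 sT.
  have gC : continuous (fun x => u x - e' * x).
    move=> x; apply: cvgB; first exact: uC.
    by apply: cvgM; [exact: cvg_cst|exact: cvg_id].
  apply/ler_addgt0Pr => d d0.
  have /cvgrPdist_lt/(_ d d0) := gC s.
  move=> /nbhs_ballP[r /= r0 hr].
  have [x Ax sx] := sup_adherent r0 supA.
  have xs : x <= s by apply: sup_ubound => //; exact: supA.2.
  have := hr x; rewrite /ball /= ger0_norm ?subr_ge0//.
  rewrite ltrBlDr -ltrBlDl => /(_ sx).
  case: Ax => _; rewrite ltr_norml => ux /andP[_ h1]; lra.
have [sT'|] := eqVneq s T.
  case: As => _; rewrite sT' => /le_trans; apply.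
  by rewrite lerD2l /e' divfK// gt_eqF.
move=> sT'; have {sT'}sT' : s < T by rewrite lt_neqAle sT'.
have /nbhs_ballP[r /= r0 hr] : \forall h \near 0^'+, u (s + h) <= u s + e' * h := uD _ _ s0 e'0.
pose h := Num.min (r / 2) (T - s).
have h0 : 0 < h by rewrite lt_min divr_gt0//= subr_gt0.
have hr2 : h < r.
  by rewrite gt_min ltr_pdivrMr// ltr_pMr// ltr1n.
have := hr h; rewrite /ball /= sub0r normrN gtr0_norm// => /(_ hr2 h0) us.
have : A (s + h).
  split.
    rewrite addr_ge0//=; last exact: ltW.
    by rewrite -lerBrDl ge_min lexx orbT.
  case: As => _ us'; rewrite mulrDr; lra.
move=> /(sup_ubound supA.2); rewrite -/s => /(lt_le_trans _) => /(_ s).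
by rewrite ltrDl h0 ltxx => /(_ isT).
Qed.

Section bump.
Variable R : realType.
Implicit Types a c k x y : R.

(* [clamp a c] is a primitive of the indicator of ]a, c[, of which [bump a c k]
   is a [k]-Lipschitz approximation from below. *)
Definition clamp a c x : R := Num.max a (Num.min x c) - a.

Definition bump a c k x : R :=
  Num.min 1 (k * Num.max 0 (Num.min (x - a) (c - x))).

Lemma clamp_ge0 a c x : 0 <= clamp a c x.
Proof. by rewrite subr_ge0 le_max lexx. Qed.

Lemma clamp_le a c x : a <= c -> clamp a c x <= c - a.
Proof. by move=> ac; rewrite lerB// ge_max ac ge_min lexx orbT. Qed.

Lemma bump_ge0 a c k x : 0 <= k -> 0 <= bump a c k x.
Proof. by move=> k0; rewrite le_min ler01 mulr_ge0// le_max lexx. Qed.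

Lemma bump_le1 a c k x : bump a c k x <= 1.
Proof. by rewrite ge_min lexx. Qed.

Lemma le_clamp a c x y : x <= y -> clamp a c x <= clamp a c y.
Proof.
move=> xy; rewrite lerD2r ge_max le_max lexx/= le_max; apply/orP; right.
by rewrite le_min ge_min xy/= ge_min lexx orbT.
Qed.

Lemma clampE a c x : a <= c ->
  [\/ x <= a /\ clamp a c x = 0, a <= x <= c /\ clamp a c x = x - a
    | c <= x /\ clamp a c x = c - a].
Proof.
move=> ac; rewrite /clamp; have [xa|/ltW ax] := leP x a.
  by apply: Or31; rewrite (max_idPl _) ?subrr// ge_min xa.
have [xc|/ltW cx] := leP x c.
  by apply: Or32; rewrite ax (max_idPr ax).
by apply: Or33; rewrite (max_idPr ac).
Qed.

Lemma clampB a c x y : a <= c -> x <= y ->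
  clamp a c y - clamp a c x <= y - x.
Proof.
move=> ac xy; case: (clampE x ac) => [[? ->]|[/andP[? ?] ->]|[? ->]];
  by case: (clampE y ac) => [[? ->]|[/andP[? ?] ->]|[? ->]]; lra.
Qed.

(** [bump] can rise only inside []a, c[], with slope at most [k], and there [clamp] has slope 1. A
    fall of [bump] only helps, so the bound is one-sided. *)
Lemma bumpB a c k x y : a <= c -> 0 <= k -> x <= y ->
  bump a c k y - bump a c k x <= k * (clamp a c y - clamp a c x).
Proof.
move=> ac k0 xy.
have key : Num.max 0 (Num.min (y - a) (c - y)) -
    Num.max 0 (Num.min (x - a) (c - x)) <= clamp a c y - clamp a c x.
  have ge0 z : 0 <= Num.max 0 (Num.min (z - a) (c - z)) by rewrite le_max lexx.
  have le0 z : z <= a \/ c <= z -> Num.max 0 (Num.min (z - a) (c - z)) = 0.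
    by move=> az; apply/max_idPl; rewrite ge_min !subr_le0; apply/orP.
  have cxy : 0 <= clamp a c y - clamp a c x.
    by rewrite subr_ge0 le_clamp.
  have [ya|/ltW ay] := leP y a.
    by apply: le_trans cxy; rewrite (le0 y); [rewrite sub0r oppr_le0|left].
  have [cy|/ltW yc] := leP c y.
    by apply: le_trans cxy; rewrite (le0 y); [rewrite sub0r oppr_le0|right].
  have -> : clamp a c y = y - a.
    by rewrite /clamp (min_idPl yc) (max_idPr ay).
  have mya : Num.max 0 (Num.min (y - a) (c - y)) <= y - a.
    by rewrite ge_max subr_ge0 ay ge_min lexx.
  have [xa|/ltW ax] := leP x a.
    by rewrite (le0 x); [case: (clampE x ac) => [[_ ->]|[/andP[? ?] ->]|[? ->]]; lra|left].
  have -> : clamp a c x = x - a.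
    by rewrite /clamp (min_idPl (le_trans xy yc)) (max_idPr ax).
  rewrite lerBlDl ge_max; apply/andP; split; first by have := ge0 x; lra.
  have mle : Num.min (x - a) (c - x) <= Num.max 0 (Num.min (x - a) (c - x)).
    by rewrite le_max lexx orbT.
  apply: le_trans (lerD mle (lexx _)).
  by rewrite -lerBlDr le_min !lerBlDr !ge_min; apply/andP; split; apply/orP; [left|right]; lra.
have kc : 0 <= k * (clamp a c y - clamp a c x).
  by rewrite mulr_ge0// subr_ge0 le_clamp.
move: (ler_wpM2l k0 key) kc; rewrite [X in X <= _]mulrBr /bump.
set Y := k * Num.max 0 (Num.min (y - a) _).
set X := k * Num.max 0 (Num.min (x - a) _).
move=> YX C0; rewrite lerBlDr ge_min.
by case: (leP 1 X) => ?; apply/orP; [left|right]; lra.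
Qed.

Lemma bump_eq0 a c k x : (x <= a) || (c <= x) -> bump a c k x = 0.
Proof.
move=> xac; rewrite /bump.
have -> : Num.max 0 (Num.min (x - a) (c - x)) = 0.
  by apply/max_idPl; rewrite ge_min !subr_le0.
by rewrite mulr0; apply/min_idPr; exact: ler01.
Qed.

(** [bump] lies below the derivative of [clamp]. The quadratic term pays for a step from inside []a,
    c[] past [c], where [clamp] stops growing: then [bump a c k x <= k * (c - x) <= k * (y - x)]. *)
Lemma bump_clamp a c k x y : 0 <= k -> x <= y ->
  bump a c k x * (y - x) <=
  clamp a c y - clamp a c x + k * (y - x) ^+ 2.
Proof.
move=> k0 xy.
have d0 : 0 <= y - x by rewrite subr_ge0.
have kd : 0 <= k * (y - x) ^+ 2 by rewrite mulr_ge0// sqr_ge0.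
have cl : 0 <= clamp a c y - clamp a c x by rewrite subr_ge0 le_clamp.
have [xa|ax] := leP x a.
  by rewrite bump_eq0 ?xa// mul0r addr_ge0.
have [cx|xc] := leP c x.
  by rewrite bump_eq0 ?cx ?orbT// mul0r addr_ge0.
have clx : clamp a c x = x - a.
  by rewrite /clamp (min_idPl (ltW xc)) (max_idPr (ltW ax)).
have [yc|cy] := leP y c.
  have -> : clamp a c y = y - a.
    by rewrite /clamp (min_idPl yc) (max_idPr _)// (le_trans (ltW ax)).
  rewrite clx; have := ler_wpM2r d0 (bump_le1 a c k x); lra.
rewrite expr2 mulrA; apply: (le_trans (ler_wpM2r d0 (_ : _ <= k * (y - x)))).
  rewrite /bump ge_min; apply/orP; right.
  rewrite ler_wpM2l// ge_max d0 ge_min; apply/orP; right.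
  by rewrite lerB// ltW.
by rewrite lerDr.
Qed.

End bump.

Lemma continuous_clamp (R : realType) (a c : R) : continuous (clamp a c).
Proof.
move=> x; apply: cvgB; last exact: cvg_cst.
apply: cvg_maxr; first exact: cvg_cst.
by apply: cvg_minr; [exact: cvg_id|exact: cvg_cst].
Qed.

Lemma continuous_bump (R : realType) (a c k : R) : continuous (bump a c k).
Proof.
move=> x; apply: cvg_minr; first exact: cvg_cst.
apply: cvgM; first exact: cvg_cst.
apply: cvg_maxr; first exact: cvg_cst.
by apply: cvg_minr; apply: cvgB; (exact: cvg_cst || exact: cvg_id).
Qed.

Lemma bump_cvg (R : realType) (a c x : R) :
  bump a c n%:R x @[n --> \oo] --> (\1_(`]a, c[%classic) x : R).
Proof.
have [xac|xac] := boolP (x \in `]a, c[%classic).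
  rewrite indicE xac/=.
  move: xac; rewrite inE/= in_itv/= => /andP[ax xc].
  pose d := Num.min (x - a) (c - x).
  have d0 : 0 < d by rewrite lt_min !subr_gt0 ax xc.
  have [n0 _ hn0] : \forall n \near \oo, d^-1 <= n%:R by exact: nbhs_infty_ger.
  apply: cvg_near_cst; exists n0 => // n /= /hn0/= dn.
  rewrite /bump (max_idPr (ltW d0)).
  by apply/min_idPl; rewrite -ler_pdivrMr// div1r.
rewrite indicE (negbTE xac)/=.
apply: cvg_near_cst; near=> n.
apply: bump_eq0.
by move: xac; rewrite notin_setE/= in_itv/= => /negP; rewrite negb_and -!leNgt.
Unshelve. all: by end_near.
Qed.

Section finite_measure_integral.
Context d (T : measurableType d) (R : realType).
Variable P : {finite_measure set T -> \bar R}.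
Implicit Types (f g : T -> R) (K : R).

Lemma bounded_integrable f K : measurable_fun setT f ->
  (forall w, `|f w| <= K) -> P.-integrable setT (EFin \o f).
Proof.
move=> mf fK; apply: measurable_bounded_integrable => //.
  by rewrite ltey_eq fin_num_measure.
exists K; split; first exact: num_real.
by move=> x Kx w _ /=; exact: le_trans (fK w) (ltW Kx).
Qed.

Lemma bounded_cvg_Rintegral (f_ : nat -> T -> R) f K :
  (forall n, measurable_fun setT (f_ n)) -> measurable_fun setT f ->
  (forall n w, `|f_ n w| <= K) ->
  {ae P, forall w, f_ n w @[n --> \oo] --> f w} ->
  \int[P]_w f_ n w @[n --> \oo] --> \int[P]_w f w.
Proof.
move=> mf_ mf fK f_f.
have [] := @dominated_convergence _ _ _ P setT measurableT
  (fun n w => (f_ n w)%:E) (EFin \o f) (EFin \o cst K).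
- by move=> n; apply/measurable_EFinP.
- exact/measurable_EFinP.
- apply: filterS f_f => w fw _.
  by apply: cvg_EFin; [exact: nearW|exact: fw].
- exact: finite_measure_integrable_cst.
- by apply: aeW => w n _; rewrite /= lee_fin.
move=> intf _ cvgf; apply: fine_cvg.
by rewrite fineK//; exact: integrable_fin_num.
Qed.

End finite_measure_integral.

Section integral_indic_extension.
Import HBNNSimple.
Context d1 (T1 : measurableType d1) d2 (T2 : measurableType d2)
  d3 (T3 : measurableType d3) (R : realType).

Lemma ge0_cvg_integral_nnsfun d (T : measurableType d)
    (mu : {measure set T -> \bar R}) (a : T -> R) (Z : T -> T3)
    (psi : T3 -> \bar R) (mpsi : measurable_fun setT psi) :
  (forall y, (0 <= psi y)%E) -> (forall x, 0 <= a x) ->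
  measurable_fun setT a -> measurable_fun setT Z ->
  (\int[mu]_x ((a x)%:E * (nnsfun_approx measurableT mpsi n (Z x))%:E))%E
    @[n --> \oo] --> (\int[mu]_x ((a x)%:E * psi (Z x)))%E.
Proof.
move=> psi0 a0 ma mZ.
have -> : (\int[mu]_x ((a x)%:E * psi (Z x)) = \int[mu]_x
    limn (fun n => (a x)%:E * (nnsfun_approx measurableT mpsi n (Z x))%:E))%E.
  apply: eq_integral => x _; apply/esym/cvg_lim => //.
  apply: cvgeZl => //.
  exact: (cvg_nnsfun_approx measurableT mpsi (fun y _ => psi0 y)).
apply: cvg_monotone_convergence => //.
- move=> n; apply: emeasurable_funM; apply/measurable_EFinP => //.
  by apply: measurableT_comp => //.
- by move=> n x _; rewrite mule_ge0// lee_fin.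
- move=> x _ m n mn; rewrite lee_wpmul2l ?lee_fin//.
  by have /lefP := nd_nnsfun_approx measurableT mpsi mn; exact.
Qed.

Variables (mu1 : {measure set T1 -> \bar R}) (mu2 : {measure set T2 -> \bar R}).
Variables (a1 : T1 -> R) (a2 : T2 -> R) (Z1 : T1 -> T3) (Z2 : T2 -> T3).
Hypotheses (a10 : forall x, 0 <= a1 x) (a20 : forall x, 0 <= a2 x).
Hypotheses (ma1 : measurable_fun setT a1) (ma2 : measurable_fun setT a2).
Hypotheses (mZ1 : measurable_fun setT Z1) (mZ2 : measurable_fun setT Z2).

(** Simple functions approximating [psi] reduce both sides to finite sums of indicator integrals,
    and monotone convergence does the rest. Two spaces with their own weights cover both the
    comparison of [P 0] with Lebesgue measure and an identity under [P x], taken as two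
    inequalities. *)
Lemma ge0_le_integral_indic_ext (psi : T3 -> \bar R) :
  (forall B, measurable B ->
    (\int[mu1]_x ((a1 x)%:E * (\1_B (Z1 x))%:E) <=
     \int[mu2]_x ((a2 x)%:E * (\1_B (Z2 x))%:E))%E) ->
  measurable_fun setT psi -> (forall y, (0 <= psi y)%E) ->
  (\int[mu1]_x ((a1 x)%:E * psi (Z1 x)) <=
   \int[mu2]_x ((a2 x)%:E * psi (Z2 x)))%E.
Proof.
move=> indic mpsi psi0.
have cvg1 := ge0_cvg_integral_nnsfun (mu := mu1) mpsi psi0 a10 ma1 mZ1.
have cvg2 := ge0_cvg_integral_nnsfun (mu := mu2) mpsi psi0 a20 ma2 mZ2.
apply: (lee_cvg_to cvg1 cvg2).
apply: nearW => n; set s := nnsfun_approx _ _ _.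
have intE d (T : measurableType d) (mu : {measure set T -> \bar R})
    (a : T -> R) (Z : T -> T3) : (forall x, 0 <= a x) ->
    measurable_fun setT a -> measurable_fun setT Z ->
    (\int[mu]_x ((a x)%:E * (s (Z x))%:E) =
     \sum_(y \in range s) (y%:E *
       \int[mu]_x ((a x)%:E * (\1_(s @^-1` [set y]) (Z x))%:E)))%E.
  move=> a0 ma mZ.
  have mI y : measurable_fun setT
      (fun x => ((a x)%:E * (\1_(s @^-1` [set y]) (Z x))%:E)%E).
    apply: emeasurable_funM; first exact/measurable_EFinP.
    apply/measurable_EFinP; apply: measurableT_comp => //.
  have yI0 y x : (0 <= y%:E * ((a x)%:E * (\1_(s @^-1` [set y]) (Z x))%:E))%E.
    rewrite muleCA; apply: mule_ge0; first by rewrite lee_fin.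
    exact: nnfun_muleindic_ge0.
  transitivity (\int[mu]_x (\sum_(y \in range s)
      (y%:E * ((a x)%:E * (\1_(s @^-1` [set y]) (Z x))%:E))))%E.
    apply: eq_integral => x _.
    rewrite [in LHS](fimfunE s (Z x)) -fsumEFin//.
    under eq_fsbigr do rewrite EFinM.
    rewrite ge0_mule_fsumr//; last by move=> y; exact: nnfun_muleindic_ge0.
    by apply: eq_fsbigr => y _; rewrite muleCA.
  rewrite ge0_integral_fsum//; last first.
    by move=> y; apply: emeasurable_funM.
  apply: eq_fsbigr => y; rewrite inE => -[z _ <-].
  rewrite ge0_integralZl_EFin//.
  by move=> x _; rewrite mule_ge0// lee_fin.
rewrite !intE//.
apply: lee_fsum => // y [z _ <-]; apply: lee_wpmul2l; first by rewrite lee_fin.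
by apply: indic; exact: measurable_sfunP.
Qed.

End integral_indic_extension.

(** * Paths and occupation times *)

Section path_space.
Variable R : realType.
Implicit Types (s t x y : R) (w : cpath R) (phi : R -> R).

Lemma path_max0 w s : w (Num.max s 0) = w s.
Proof.
by have [//|/ltW s0] := leP 0 s; rewrite [RHS](path_const w s0).
Qed.

Lemma measurable_eval s : measurable_fun setT (fun w => w s).
Proof.
move=> _ B mB; rewrite setTI; apply: sub_sigma_algebra.
(* Cylinders see only times [>= 0]; at a negative time the path has its value at 0. *)
exists (Num.max s 0); first by rewrite /= le_max lexx orbT.
by exists B => //; apply/seteqP; split => w /=; rewrite path_max0.
Qed.

Let grid n s : R := (Num.floor (s * n.+1%:R))%:~R / n.+1%:R.

Let gridP n s : `|s - grid n s| <= n.+1%:R^-1.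
Proof.
have n0 : 0 < n.+1%:R :> R by [].
rewrite -(ler_pM2r n0) -[X in _ * X]gtr0_norm// -normrM mulVf ?gt_eqF//.
rewrite mulrBl /grid divfK ?gt_eqF//.
have := floor_itv (s * n.+1%:R); rewrite intrD1 => /andP[h1 h2].
by rewrite ger0_norm ?subr_ge0// lerBlDl ltW.
Qed.

Let cvg_grid s : grid n s @[n --> \oo] --> s.
Proof.
apply/cvgrPdist_le => e e0; near=> n.
rewrite (le_trans (gridP _ _))// ltW//.
by near: n; exact: near_infty_natSinv_lt (PosNum e0).
Unshelve. all: by end_near.
Qed.

(** By continuity of paths, evaluation is the limit of evaluation at the grid point below [s], which
    is constant in [s] on each of countably many intervals. Joint measurability is what Tonelli's
    theorem needs for occupation times. *)
Lemma measurable_joint_eval :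
  measurable_fun setT (fun z : cpath R * R => z.1 z.2).
Proof.
suff mgrid n : measurable_fun setT (fun z : cpath R * R => z.1 (grid n z.2)).
  apply: (measurable_fun_cvg mgrid) => -[w s] _ /=.
  exact: (@cvg_comp _ _ _ (fun n => grid n s) w _ _ _ (cvg_grid (s := s))
    (@path_continuous _ w s)).
move=> _ B mB; rewrite setTI.
have -> : (fun z : cpath R * R => z.1 (grid n z.2)) @^-1` B =
    \bigcup_(k : int) ([set w : cpath R | B (w (k%:~R / n.+1%:R))] `*`
      [set s | k%:~R <= s * n.+1%:R < (k + 1)%:~R]).
  apply/seteqP; split=> [[w s] /= Bws|[w s] [k _ [/= Bws /floor_def fk]]].
    exists (Num.floor (s * n.+1%:R)) => //; split => //=.
    exact: floor_itv.
  by rewrite /grid fk.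
apply: countable_bigcupT_measurable => // k; apply: measurableX.
  by rewrite -[X in measurable X]setTI; exact: measurable_eval.
have mmul : measurable_fun setT (fun s : R => s * n.+1%:R).
  by apply: measurable_funM => //; exact: measurable_id.
rewrite [X in measurable X](_ : _ = setT `&`
    (fun s : R => s * n.+1%:R) @^-1` `[k%:~R, (k + 1)%:~R[).
  exact: mmul.
by rewrite setTI; apply/seteqP; split => s /=; rewrite in_itv.
Qed.

Lemma stop_continuous t w : continuous (fun s => w (Num.min s t)).
Proof.
move=> s; apply: (@continuous_comp _ _ _ (fun s => Num.min s t) w).
  by apply: cvg_minr; [exact: cvg_id|exact: cvg_cst].
exact: path_continuous.
Qed.

Lemma stop_const t w s : 0 <= t -> s <= 0 -> w (Num.min s t) = w (Num.min 0 t).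
Proof.
move=> t0 s0; rewrite (min_idPl t0) (min_idPl (le_trans s0 t0)).
exact: path_const.
Qed.

Definition path_stop t (t0 : 0 <= t) w : cpath R :=
  CPath (@stop_continuous t w) (fun s => path_ge0 w (Num.min s t))
        (fun s => @stop_const t w s t0).

(** The stopped path reads [w] only at the times [Num.min s t], which lie in [[0, t]], so stopping
    is measurable from the sigma-field at time [t]. *)
Lemma measurable_path_stop t (t0 : 0 <= t) (A : set (cpath R)) :
  measurable A -> path_filtration t (path_stop t0 @^-1` A).
Proof.
move=> mA; pose FT := g_sigma_algebraType (@cylinders R [set s | 0 <= s <= t]).
have : measurable_fun setT (path_stop t0 : FT -> cpath R).
  apply: (measurability (@cylinders R [set s | 0 <= s])) => //.
  move=> _ [_ [s /= s0 [B mB ->]] <-]; rewrite setTI.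
  apply: sub_sigma_algebra; exists (Num.min s t).
    by rewrite /= le_min s0 t0 ge_min lexx orbT.
  by exists B.
by move=> /(_ measurableT _ mA); rewrite setTI.
Qed.

(* Galmarino's test. *)
Lemma path_filtration_stop t (t0 : 0 <= t) (A : set (cpath R)) :
  measurable A -> (forall w, A (path_stop t0 w) <-> A w) -> path_filtration t A.
Proof.
move=> mA Astop.
have -> : A = path_stop t0 @^-1` A by apply/seteqP; split => w /= /Astop.
exact: measurable_path_stop.
Qed.

Lemma path_filtration_measurable t (A : set (cpath R)) :
  path_filtration t A -> measurable A.
Proof.
apply: sub_sigma_algebra2 => _ [s /= /andP[s0 _] [B mB ->]].
by exists s => //; exists B.
Qed.

End path_space.

Lemma Rintegral_itv_cst (R : realType) (c s t : R) : s <= t ->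
  \int[@lebesgue_measure R]_(r in `]s, t]) c = c * (t - s).
Proof.
move=> st; rewrite Rintegral_cst//; congr (_ * _).
transitivity (fine (lebesgue_measure (`]s, t] : set R))) => //.
rewrite lebesgue_measure_itv/= lte_fin.
by move: st; rewrite le_eqVlt => /orP[/eqP ->|->//]; rewrite ltxx subrr.
Qed.

Section occupation.
Variable R : realType.
Implicit Types (s t x y : R) (w : cpath R).
Local Notation leb := (@lebesgue_measure R).

Definition occupation (phi : R -> R) t w : R :=
  \int[leb]_(s in `[0, t]) phi (w s).

Variables (phi : R -> R) (K : R).
Hypotheses (mphi : measurable_fun setT phi) (phi0 : forall x, 0 <= phi x)
  (phiK : forall x, phi x <= K).

Lemma measurable_path w : measurable_fun setT w.
Proof. by apply: continuous_measurable_fun; exact: path_continuous. Qed.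

Lemma occupation_integrable (i : interval R) w : (leb [set` i] < +oo)%E ->
  leb.-integrable [set` i] (EFin \o (phi \o w)).
Proof.
move=> iy; apply: measurable_bounded_integrable => //.
  apply: measurable_funTS; apply: measurableT_comp => //.
  exact: measurable_path.
exists K; split; first exact: num_real.
by move=> x Kx s _ /=; rewrite ger0_norm//; exact: le_trans (phiK _) (ltW Kx).
Qed.

Lemma lebesgue_itv_fin b1 b2 s t :
  (leb [set` Interval (BSide b1 s) (BSide b2 t)] < +oo)%E.
Proof.
rewrite lebesgue_measure_itv/=.
by case: ifPn => _; rewrite -?EFinB ltry.
Qed.

Lemma occupationB s t w : 0 <= s -> s <= t ->
  occupation phi t w - occupation phi s w = \int[leb]_(r in `]s, t]) phi (w r).
Proof.
move=> s0 st; rewrite /occupation.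
apply: (Rintegral_itvB (f := phi \o w)) => //.
by apply: occupation_integrable; exact: lebesgue_itv_fin.
Qed.

Lemma occupation0 t w : t <= 0 -> occupation phi t w = 0.
Proof.
rewrite /occupation le_eqVlt => /orP[/eqP ->|t0].
  by rewrite set_itv1 Rintegral_set1.
by rewrite set_itv_ge ?Rintegral_set0// bnd_simp -ltNge.
Qed.

(** Negative times, at which the occupation is 0, are included because the Dini argument asks for
    continuity in time on the whole line. *)
Lemma occupation_incr s t w : s <= t ->
  0 <= occupation phi t w - occupation phi s w <= K * (t - s).
Proof.
have K0 : 0 <= K by exact: le_trans (phi0 0) (phiK 0).
have main s' t' : 0 <= s' -> s' <= t' ->
    0 <= occupation phi t' w - occupation phi s' w <= K * (t' - s').
  move=> s0 st; rewrite occupationB//; apply/andP; split.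
    exact: Rintegral_ge0.
  have -> : K * (t' - s') = \int[leb]_(r in `]s', t']) K.
    by rewrite Rintegral_itv_cst.
  apply: le_Rintegral => //.
    by apply: occupation_integrable; exact: lebesgue_itv_fin.
  apply: measurable_bounded_integrable => //; first exact: lebesgue_itv_fin.
  exists K; split; first exact: num_real.
  by move=> x Kx r _ /=; rewrite ger0_norm//; exact: ltW.
move=> st; have [s0|/ltW s0] := leP 0 s; first exact: main.
have [t0|/ltW t0] := leP 0 t.
  have := main 0 t (lexx _) t0; rewrite !(occupation0 _ s0) (occupation0 _ (lexx 0)).
  rewrite !subr0 => /andP[-> h]/=; apply: le_trans h _.
  by apply: ler_wpM2l => //; lra.
by rewrite !occupation0// subrr lexx mulr_ge0// subr_ge0.
Qed.

Lemma occupation_ge0 t w : 0 <= occupation phi t w.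
Proof. exact: Rintegral_ge0. Qed.

Lemma le_occupation s t w : s <= t -> occupation phi s w <= occupation phi t w.
Proof. by move=> /(occupation_incr w)/andP[]; rewrite subr_ge0. Qed.

Lemma continuous_occupation w : continuous (fun t => occupation phi t w).
Proof.
have K0 : 0 <= K by exact: le_trans (phi0 0) (phiK 0).
have lip s t : `|occupation phi s w - occupation phi t w| <= K * `|s - t|.
  wlog st : s t / s <= t => [hw|].
    by have [/hw//|/ltW /hw] := leP s t; rewrite distrC (distrC s).
  have /andP[h1 h2] := occupation_incr w st.
  by rewrite distrC ger0_norm// distrC ger0_norm// subr_ge0.
move=> t; apply/cvgrPdist_lt => e e0.
have K1 : 0 < K + 1 by rewrite ltr_wpDl.
near=> s; apply: le_lt_trans (lip _ _) _.
apply: (@le_lt_trans _ _ ((K + 1) * `|t - s|)).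
  by rewrite ler_wpM2r// lerDl.
rewrite mulrC -ltr_pdivlMr//; near: s.
by apply: cvgr_dist_lt => //; rewrite divr_gt0.
Unshelve. all: by end_near.
Qed.

(** Continuity of [phi] along the path makes its average over []t, t + h]] converge. Right quotients
    suffice, as the semigroup quotients also run forward. *)
Lemma occupation_right_derivative t w : 0 <= t -> continuous phi ->
  (occupation phi (t + h) w - occupation phi t w) / h @[h --> 0^'+] -->
  phi (w t).
Proof.
move=> t0 cphi; apply/cvgrPdist_le => e e0.
have : {for t, continuous (phi \o w)}.
  by apply: continuous_comp; [exact: path_continuous|exact: cphi].
move=> /cvgrPdist_le/(_ e e0)/nbhs_ballP[d /= d0 hd].
near=> h.
have h0 : 0 < h by near: h; exact: nbhs_right_gt.
have hdd : h < d by near: h; exact: nbhs_right_lt.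
rewrite occupationB//; last by rewrite lerDl ltW.
have -> : phi (w t) = (\int[leb]_(r in `]t, t + h]) phi (w t)) / h.
  by rewrite Rintegral_itv_cst ?lerDl ?ltW// [t + h]addrC addrK mulfK// gt_eqF.
rewrite -mulrBl normrM [`|h^-1|]gtr0_norm ?invr_gt0//.
rewrite ler_pdivrMr//.
have ic : leb.-integrable `]t, t + h] (EFin \o fun=> phi (w t)).
  apply: measurable_bounded_integrable => //; first exact: lebesgue_itv_fin.
  exists K; split; first exact: num_real.
  by move=> x Kx r _ /=; rewrite ger0_norm//; exact: le_trans (phiK _) (ltW Kx).
have iphi := occupation_integrable w (lebesgue_itv_fin false false t (t + h)).
rewrite -RintegralB//.
have iB : leb.-integrable `]t, t + h] (EFin \o (fun r => phi (w t) - phi (w r))).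
  exact: (integrableB _ ic iphi).
apply: le_trans (le_normr_Rintegral _ _) _ => //.
have -> : e * h = \int[leb]_(r in `]t, t + h]) e.
  by rewrite Rintegral_itv_cst ?lerDl ?ltW// [t + h]addrC addrK.
apply: le_Rintegral => //.
- exact: integrable_norm iB.
- apply: measurable_bounded_integrable => //; first exact: lebesgue_itv_fin.
  exists e; split; first exact: num_real.
  by move=> x Kx r _ /=; rewrite gtr0_norm//; exact: ltW.
move=> r /=; rewrite in_itv/= => /andP[tr rh].
by apply: hd; rewrite /ball/= distrC gtr0_norm ?subr_gt0// ltrBlDl (le_lt_trans rh)// ltrD2l.
Unshelve. all: by end_near.
Qed.

(** The occupation is the integral over time of a jointly measurable nonnegative function of path
    and time, so Tonelli's theorem applies. *)
Lemma measurable_occupation t : measurable_fun setT (occupation phi t).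
Proof.
pose F (z : cpath R * R) : \bar R :=
  (phi (z.1 z.2) * (\1_(`[0, t]%classic : set R) z.2))%:E.
have mF : measurable_fun setT F.
  apply/measurable_EFinP; apply: measurable_funM.
    by apply: measurableT_comp => //; exact: measurable_joint_eval.
  apply: (measurableT_comp (f := (\1_(`[0, t]%classic : set R) : R -> R))).
    exact: measurable_indic.
  exact: measurable_snd.
have F0 z : (0 <= F z)%E by rewrite lee_fin mulr_ge0// indicE.
have := measurable_fun_fubini_tonelli_F (m2 := leb) F mF F0.
have -> : occupation phi t = fine \o fubini_F leb F.
  apply/funext => w; rewrite /occupation/= Rintegral_mkcond.
  rewrite /fubini_F /Rintegral; congr fine; apply: eq_integral => s _.
  by rewrite /F /= patch_indic.
by move=> mG; apply: measurableT_comp.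
Qed.

Lemma occupation_stop t T (T0 : 0 <= T) w : t <= T ->
  occupation phi t (path_stop T0 w) = occupation phi t w.
Proof.
move=> tT; apply: eq_Rintegral => s; rewrite inE/= in_itv/= => /andP[_ st].
by rewrite (min_idPl (le_trans st tT)).
Qed.

End occupation.

Lemma occupation_le (R : realType) (phi psi : R -> R) (K K' t : R) (w : cpath R) :
  measurable_fun setT phi -> (forall x, 0 <= phi x) -> (forall x, phi x <= K) ->
  measurable_fun setT psi -> (forall x, 0 <= psi x) -> (forall x, psi x <= K') ->
  (forall x, 0 <= x -> phi x <= psi x) ->
  occupation phi t w <= occupation psi t w.
Proof.
move=> mphi phi0 phiK mpsi psi0 psiK pp; apply: le_Rintegral => //.
- by apply: occupation_integrable mphi phi0 phiK _ _ _; exact: lebesgue_itv_fin.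
- by apply: occupation_integrable mpsi psi0 psiK _ _ _; exact: lebesgue_itv_fin.
by move=> s _; apply: pp; exact: path_ge0.
Qed.

(** * The Markov property *)

Section disintegration.
Import HBNNSimple.
Context d (T : measurableType d) d2 (T2 : measurableType d2) (R : realType).
Variables (mu : {measure set T -> \bar R}) (A : set T) (theta : T -> T2)
  (kappa : T -> {measure set T2 -> \bar R}).
Hypotheses (mA : measurable A) (mtheta : measurable_fun setT theta)
  (mkappa : forall B, measurable B -> measurable_fun setT (fun w => kappa w B)).

(** The Markov property is stated for events of the shifted path. Simple functions and monotone
    convergence, inside the kernel integral as well, carry it to nonnegative functions. *)
Lemma ge0_integral_disintegration (f : T2 -> \bar R) :
  (forall B, measurable B ->
    (mu (A `&` theta @^-1` B) = \int[mu]_(w in A) kappa w B)%E) ->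
  measurable_fun setT f -> (forall y, (0 <= f y)%E) ->
  (\int[mu]_(w in A) f (theta w) = \int[mu]_(w in A) \int[kappa w]_y f y)%E.
Proof.
move=> dis mf f0.
pose s := nnsfun_approx measurableT mf.
have ms n : measurable_fun setT (fun y => (s n y)%:E) by exact/measurable_EFinP.
have s0 n y : (0 <= (s n y)%:E)%E by rewrite lee_fin.
have sle y m n : (m <= n)%N -> ((s m y)%:E <= (s n y)%:E)%E.
  by move=> mn; rewrite lee_fin; exact/lefP/(nd_nnsfun_approx measurableT mf mn).
have sf y : (s n y)%:E @[n --> \oo] --> f y.
  exact: (cvg_nnsfun_approx measurableT mf (fun y _ => f0 y)).
have eq_s n : (\int[mu]_(w in A) (s n (theta w))%:E =
    \int[mu]_(w in A) \int[kappa w]_y (s n y)%:E)%E.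
  have mpre y : measurable (s n @^-1` [set y]) by exact: measurable_sfunP.
  have mpret y : measurable (theta @^-1` (s n @^-1` [set y])).
    by rewrite -[X in measurable X]setTI; exact: mtheta.
  transitivity (\sum_(y \in range (s n)) (y%:E * mu (A `&` theta @^-1` (s n @^-1` [set y]))))%E.
    transitivity (\int[mu]_(w in A) \sum_(y \in range (s n))
        (y%:E * (\1_(s n @^-1` [set y]) (theta w))%:E))%E.
      apply: eq_integral => w _; rewrite [in LHS](fimfunE (s n) (theta w)) -fsumEFin//.
    rewrite ge0_integral_fsum//; last 2 first.
    - move=> y; apply: measurable_funeM; apply/measurable_EFinP.
      by apply: measurable_funTS; apply: measurableT_comp => //.
    - by move=> y w _; exact: nnfun_muleindic_ge0.
    apply: eq_fsbigr => y; rewrite inE => -[z _ <-].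
    rewrite ge0_integralZl_EFin//; last first.
      by apply/measurable_EFinP; apply: measurable_funTS; apply: measurableT_comp => //.
    congr (_ * _)%E.
    rewrite (_ : (fun x => _) = (fun x => (\1_(theta @^-1` (s n @^-1` [set s n z])) x)%:E))//.
    by rewrite integral_indic// setIC.
  under [RHS]eq_integral => w _ do rewrite integralT_nnsfun sintegralE.
  rewrite ge0_integral_fsum//; last 2 first.
  - by move=> y; apply: measurable_funeM; apply: measurable_funTS; exact: mkappa.
  - move=> y w _; exact: nnsfun_mulemu_ge0.
  apply: eq_fsbigr => y; rewrite inE => -[z _ <-].
  rewrite ge0_integralZl_EFin//; last by apply: measurable_funTS; exact: mkappa.
  by congr (_ * _)%E; exact: dis.
have L1 : (\int[mu]_(w in A) (s n (theta w))%:E)%E @[n --> \oo] -->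
    (\int[mu]_(w in A) f (theta w))%E.
  have -> : (\int[mu]_(w in A) f (theta w) =
      \int[mu]_(w in A) limn (fun n => (s n (theta w))%:E))%E.
    by apply: eq_integral => w _; apply/esym/cvg_lim => //; exact: sf.
  apply: cvg_monotone_convergence => //.
  - move=> n; apply: measurable_funTS; exact: (measurableT_comp (ms n) mtheta).
  - by move=> w _ m n mn; exact: sle.
have L2 : (\int[mu]_(w in A) \int[kappa w]_y (s n y)%:E)%E @[n --> \oo] -->
    (\int[mu]_(w in A) \int[kappa w]_y f y)%E.
  have -> : (\int[mu]_(w in A) \int[kappa w]_y f y =
      \int[mu]_(w in A) limn (fun n => \int[kappa w]_y (s n y)%:E))%E.
    apply: eq_integral => w _; rewrite -monotone_convergence//.
      by apply: eq_integral => y _; apply/esym/cvg_lim => //; exact: sf.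
    by move=> y _ m n mn; exact: sle.
  apply: cvg_monotone_convergence => //.
  - move=> n; apply: measurable_funTS.
    exact: (measurable_fun_integral_kernel mkappa (s0 n) (ms n)).
  - by move=> n w _; exact: integral_ge0.
  - by move=> w _ m n mn; apply: ge0_le_integral => // y _; exact: sle.
apply: (cvg_unique _ L1) => //.
by rewrite /= (eq_cvg _ _ eq_s).
Qed.

End disintegration.

Section markov.
Variable R : realType.
Variables (P : R -> probability (cpath R) R) (S : cumulative R R)
  (m : {measure set R -> \bar R}).
Hypothesis HX : linear_diffusion P S m.
Implicit Types (x t u h : R) (w : cpath R) (f : R -> R).

Lemma measurable_path_shift u : 0 <= u -> measurable_fun setT (path_shift u).
Proof.
move=> u0; apply: (measurability (@cylinders R [set s | 0 <= s])) => //.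
move=> _ [_ [s /= s0 [B mB ->]] <-].
exact: (measurable_eval (u + Num.max s 0) measurableT mB).
Qed.

Lemma measurable_kernel_path t (B : set (cpath R)) : measurable B ->
  measurable_fun setT (fun w => P (w t) B).
Proof.
move=> mB; apply: (@measurable_comp _ _ _ (cpath R) R (\bar R) `[0, +oo[%classic
  (fun x => P x B) setT (fun w => w t)) => //.
- by move=> _ [w _ <-]; rewrite /= in_itv/= andbT path_ge0.
- exact: (diff_kernel HX mB).
- exact: measurable_eval.
Qed.

(** A constant time [u] is a Markov time: [u < t] holds for all paths or for none, so every event of
    the filtration at [u] is admissible in the strong Markov property. *)
Lemma simple_markov x u (A B : set (cpath R)) : 0 <= x -> 0 <= u ->
  path_filtration u A -> measurable B ->
  P x (A `&` path_shift u @^-1` B) = (\int[P x]_(w in A) P (w u) B)%E.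
Proof.
move=> x0 u0 FA mB.
have mt : markov_time (fun _ : cpath R => u%:E).
  split=> [w|t t0]; first by rewrite lee_fin.
  have [ut|tu] := ltP u t.
    rewrite [X in path_filtration _ X](_ : _ = setT).
      exact: (@measurableT _ (g_sigma_algebraType (@cylinders R [set s | 0 <= s <= t]))).
    by apply/seteqP; split => // w _ /=; rewrite lte_fin.
  rewrite [X in path_filtration _ X](_ : _ = set0); first exact: sigma_algebra0.
  by apply/seteqP; split => // w /=; rewrite lte_fin ltNge tu.
have mtA : markov_time_events (fun _ : cpath R => u%:E) A.
  split; first exact: path_filtration_measurable FA.
  move=> t t0; have [ut|tu] := ltP u t.
    rewrite [X in path_filtration _ X](_ : _ = A).
      move: A FA; apply: sub_sigma_algebra2 => _ [s /= /andP[s0 su] [C mC ->]].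
      by exists s; [rewrite /= s0 (le_trans su)// ltW|exists C].
    by apply/seteqP; split => [w []//|w Aw]; split => //=; rewrite lte_fin.
  rewrite [X in path_filtration _ X](_ : _ = set0); first exact: sigma_algebra0.
  by apply/seteqP; split => // w /= []; rewrite lte_fin ltNge tu.
have := diff_strong_markov HX x0 mt mtA mB.
rewrite /= [X in A `&` X](_ : _ = setT) ?setIT//.
by apply/seteqP; split => // w _ /=; rewrite ltry.
Qed.

Lemma measurable_semigroup f t u : measurable_fun setT f -> (forall y, 0 <= f y) ->
  measurable_fun setT (fun w => semigroup P t f (w u)).
Proof.
move=> mf f0; rewrite /semigroup /Rintegral.
apply: measurableT_comp => //.
apply: (@measurable_fun_integral_kernel _ _ (cpath R) (cpath R) R
  (fun w => P (w u)) _ (fun w => (f (w t))%:E)).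
- by move=> U mU; exact: measurable_kernel_path.
- by move=> w; rewrite lee_fin.
- by apply/measurable_EFinP; apply: measurableT_comp => //; exact: measurable_eval.
Qed.

Lemma semigroup_bound f t x K : measurable_fun setT f -> (forall y, 0 <= f y) ->
  (forall y, f y <= K) -> 0 <= semigroup P t f x <= K.
Proof.
move=> mf f0 fK; apply/andP; split; first exact: Rintegral_ge0.
have -> : K = \int[P x]_w K.
  transitivity (K * fine (P x setT)); last by rewrite Rintegral_cst.
  by rewrite (@probability_setT _ _ _ (P x)) mulr1.
apply: le_Rintegral => //.
- apply: (bounded_integrable _ (K := K)).
    by apply: measurableT_comp => //; exact: measurable_eval.
  by move=> w; rewrite ger0_norm.
- by apply: (bounded_integrable _ (K := `|K|)).
Qed.

(** Since [Z] depends on the path up to [u], the Markov property at [u] gives the identity for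
    indicators of [Z]; the extension lemma, used in both directions, passes to [psi]. The bound [K]
    keeps the kernel integrals finite, so that [fine] in [semigroup] loses nothing. *)
Lemma markov_semigroup x u h f (psi : R -> R) (Z : cpath R -> R) K L :
  0 <= x -> 0 <= u -> 0 <= h ->
  measurable_fun setT f -> (forall y, 0 <= f y) -> (forall y, f y <= K) ->
  measurable_fun setT psi -> (forall y, 0 <= psi y) -> (forall y, psi y <= L) ->
  (forall B, measurable B -> path_filtration u (Z @^-1` B)) ->
  \int[P x]_w (f (w (u + h)) * psi (Z w)) =
  \int[P x]_w (semigroup P h f (w u) * psi (Z w)).
Proof.
move=> x0 u0 h0 mf f0 fK mpsi psi0 psiL mZ.
have mZ' : measurable_fun setT Z.
  move=> _ B mB; rewrite setTI; exact: path_filtration_measurable (mZ _ mB).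
have mfu : measurable_fun setT (fun w => f (w (u + h))).
  by apply: measurableT_comp => //; exact: measurable_eval.
have msu := measurable_semigroup h u mf f0.
have su0 w : 0 <= semigroup P h f (w u).
  by have /andP[] := semigroup_bound h (w u) mf f0 fK.
have ind B : measurable B ->
    (\int[P x]_w ((f (w (u + h)))%:E * (\1_B (Z w))%:E) =
     \int[P x]_w ((semigroup P h f (w u))%:E * (\1_B (Z w))%:E))%E.
  move=> mB; set A := Z @^-1` B.
  have FA : path_filtration u A by exact: mZ.
  have mA : measurable A by exact: path_filtration_measurable FA.
  transitivity (\int[P x]_(w in A) (f (w (u + h)))%:E)%E.
    rewrite [RHS]integral_mkcond; apply: eq_integral => w _.
    by rewrite epatch_indic.
  transitivity (\int[P x]_(w in A) (semigroup P h f (w u))%:E)%E; last first.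
    rewrite [LHS]integral_mkcond; apply: eq_integral => w _.
    by rewrite epatch_indic.
  have := @ge0_integral_disintegration _ _ _ _ _ (P x) A (path_shift u)
    (fun w => P (w u)) mA (measurable_path_shift u0)
    (fun B mB => measurable_kernel_path u mB) (fun w => (f (w h))%:E).
  move=> /(_ (fun B mB => simple_markov x0 u0 FA mB)) dis.
  transitivity (\int[P x]_(w in A) (f (path_shift u w h))%:E)%E.
    by apply: eq_integral => w _ /=; rewrite (max_idPl h0).
  rewrite dis; last 2 first.
  - by apply/measurable_EFinP; apply: measurableT_comp => //; exact: measurable_eval.
  - by move=> w; rewrite lee_fin.
  apply: eq_integral => w _; rewrite /semigroup /Rintegral fineK//.
  apply: (@integrable_fin_num _ _ _ (P (w u)) setT) => //.
  apply: (bounded_integrable _ (K := K)).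
    by apply: measurableT_comp => //; exact: measurable_eval.
  by move=> w'; rewrite ger0_norm.
rewrite /Rintegral; congr fine.
rewrite (eq_integral (fun w => ((f (w (u + h)))%:E * (psi (Z w))%:E)%E))//.
rewrite [RHS](eq_integral (fun w => ((semigroup P h f (w u))%:E * (psi (Z w))%:E)%E))//.
apply/eqP; rewrite eq_le; apply/andP; split.
  apply: (@ge0_le_integral_indic_ext _ _ _ _ _ R R (P x) (P x)
    (fun w => f (w (u + h))) (fun w => semigroup P h f (w u)) Z Z
    _ _ _ _ mZ' mZ' (EFin \o psi)) => //.
  - by move=> B mB; rewrite ind.
  - exact/measurable_EFinP.
apply: (@ge0_le_integral_indic_ext _ _ _ _ _ R R (P x) (P x)
    (fun w => semigroup P h f (w u)) (fun w => f (w (u + h))) Z Z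
    _ _ _ _ mZ' mZ' (EFin \o psi)) => //.
- by move=> B mB; rewrite ind.
- exact/measurable_EFinP.
Qed.

End markov.

(** * Solutions of the reflecting equation *)

Section reflecting_solution.
Variable R : realType.
Variables (P : R -> probability (cpath R) R) (S : cumulative R R)
  (m : {measure set R -> \bar R}).
Hypothesis HX : linear_diffusion P S m.
Implicit Types (x y z : R) (G : R -> R).

Lemma speed_set1 x : m [set x] = 0%E.
Proof. exact: (speed_noatom HX). Qed.

Definition speed_cdf x : R := fine (m `[0, x]%classic).

Lemma speed_itv_fin b1 b2 x y : 0 <= x ->
  (m [set` Interval (BSide b1 x) (BSide b2 y)] < +oo)%E.
Proof.
move=> x0; have [y0|y0] := leP 0 y.
  apply: le_lt_trans (speed_finite HX y0); apply: le_measure; rewrite ?inE//.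
  by apply: subset_itv; rewrite bnd_simp//; case: b1 => //=; rewrite ltW.
rewrite set_itv_ge ?measure0//.
by case: b1; case: b2; rewrite bnd_simp -?ltNge -?leNgt; lra.
Qed.

Lemma speed_cdf0 x : x <= 0 -> speed_cdf x = 0.
Proof.
rewrite /speed_cdf le_eqVlt => /orP[/eqP ->|x0].
  by rewrite set_itv1 speed_set1.
by rewrite set_itv_ge ?measure0// bnd_simp -ltNge.
Qed.

Lemma speed_itv b1 b2 x y :
  m [set` Interval (BSide b1 x) (BSide b2 y)] = m `[x, y]%classic.
Proof.
apply/eqP; rewrite eq_le; apply/andP; split.
  apply: le_measure; rewrite ?inE//.
  by apply: subset_itv; rewrite bnd_simp.
apply: (@le_trans _ _ (m ([set x] `|` ([set y] `|`
    [set` Interval (BSide b1 x) (BSide b2 y)])))).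
  apply: le_measure; rewrite ?inE//; first by do 2! apply: measurableU => //.
  move=> z /=; rewrite !in_itv/= => /andP[].
  rewrite le_eqVlt => /orP[/eqP ->|xz]; first by left.
  rewrite le_eqVlt => /orP[/eqP ->|zy]; first by right; left.
  by right; right; case: b1; case: b2 => /=; rewrite ?xz ?zy ?ltW.
have mI := measurable_itv (Interval (BSide b1 x) (BSide b2 y)).
have hU2 A z : measurable A -> (m ([set z] `|` A) <= m A)%E.
  move=> mA; rewrite (le_trans (measureU2 _ _ _))//.
  by rewrite [X in (X + _)%E](speed_set1 z) add0e.
by apply: le_trans (hU2 _ x _) (hU2 _ y _) => //; exact: measurableU.
Qed.

Lemma speed_cdfB b1 b2 x y : 0 <= x -> x <= y ->
  fine (m [set` Interval (BSide b1 x) (BSide b2 y)]) = speed_cdf y - speed_cdf x.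
Proof.
move=> x0 xy; rewrite speed_itv /speed_cdf.
have -> : (m `[0%R, y]%classic = m `[0%R, x]%classic + m `[x, y]%classic)%E.
  have -> : `[0, y]%classic = `[0, x[%classic `|` `[x, y]%classic :> set R.
    by rewrite -itv_bndbnd_setU// bnd_simp.
  rewrite -(speed_itv true true 0 x); apply: measureU => //.
  apply/seteqP; split => // z [] /=; rewrite !in_itv/= => /andP[_ zx] /andP[xz _].
  by rewrite leNgt zx in xz.
by rewrite fineD ?ge0_fin_numE ?speed_itv_fin// addrAC subrr add0r.
Qed.

Lemma le_speed_cdf x y : x <= y -> speed_cdf x <= speed_cdf y.
Proof.
move=> xy; have [x0|/ltW x0] := leP 0 x; last first.
  by rewrite (speed_cdf0 x0) fine_ge0.
by rewrite -subr_ge0 -(speed_cdfB true true x0 xy) fine_ge0.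
Qed.

(** Indicators of [[0, u n]] converge to that of [[0, x]] except at the point [x], which is null
    because there are no atoms; a bounded interval, of finite speed measure, dominates. *)
Lemma continuous_speed_cdf : continuous speed_cdf.
Proof.
move=> x; apply/(@cvg_nbhsP _ R^o) => u ux.
have [b [b0 xb ub]] : exists b, [/\ 0 <= b, x <= b & forall n, u n <= b].
  have /cvg_seq_bounded[b [_ hb]] : cvgn u by apply/cvg_ex; exists x.
  exists (Num.max `|x| (`|b| + 1)); split=> [||n]; rewrite le_max ?normr_ge0//.
    by rewrite ler_norm.
  apply/orP; right; apply: le_trans (ler_norm _) _; apply: (hb (`|b| + 1)) => //.
  by rewrite (le_lt_trans (ler_norm _))// ltrDl.
have cdfE y : (speed_cdf y)%:E = (\int[m]_z (\1_(`[0, y]%classic) z)%:E)%E.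
  by rewrite integral_indic// setIT fineK// ge0_fin_numE// speed_itv_fin.
have [] := @dominated_convergence _ _ _ m setT measurableT
  (fun n z => (\1_(`[0, u n]%classic) z)%:E)
  (fun z => (\1_(`[0, x]%classic) z)%:E) (fun z => (\1_(`[0, b]%classic) z)%:E).
- by move=> n; apply/measurable_EFinP; exact: measurable_indic.
- by apply/measurable_EFinP; exact: measurable_indic.
- exists [set x]; split => //; first exact: (speed_noatom HX).
  move=> z /= nz; apply: contrapT => zx; apply: nz => _.
  apply: cvg_EFin; first exact: nearW.
  apply: cvg_near_cst; have [xz|zx'|/esym//] := ltgtP x z.
    have : \forall n \near \oo, u n < z by apply: (cvgr_lt x).
    apply: filterS => n un; rewrite [LHS]indicE [RHS]indicE !mem_setE !in_itv/=.
    by rewrite [z <= u n]leNgt un [z <= x]leNgt xz !andbF.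
  have : \forall n \near \oo, z < u n by apply: (cvgr_gt x).
  apply: filterS => n un; rewrite [LHS]indicE [RHS]indicE !mem_setE !in_itv/=.
  by rewrite (ltW un) (ltW zx').
- apply/integrableP; split; first by apply/measurable_EFinP; exact: measurable_indic.
  under eq_integral do rewrite gee0_abs ?lee_fin//.
  by rewrite integral_indic// setIT speed_itv_fin.
- apply: aeW => z n _; rewrite gee0_abs ?lee_fin// !indicE !mem_setE !in_itv/=.
  have [zu|zu] := leP z (u n); first by rewrite (le_trans zu (ub n)).
  by rewrite andbF ler0n.
move=> _ _ h; apply: fine_cvg; rewrite [X in _ --> X]cdfE.
apply: cvg_trans h; apply: near_eq_cvg; apply: nearW => n.
by rewrite /= integral_indic// setIT.
Qed.

Section solution.
Variables (G : R -> R) (C : R).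
Hypotheses (cG : continuous G) (GC : forall x, `|G x| <= C).

(** The pair solves d/dm df/dS = [G] with value and scale derivative 0 at 0. [reflecting_sol] is the
    iterated integral of [reflecting_deriv] against dS with the order of integration exchanged, so
    that only integrals against [m] occur. *)
Definition reflecting_deriv x : R := \int[m]_(z in `]0, x]) G z.
Definition reflecting_sol x : R := \int[m]_(z in `]0, x]) ((S x - S z) * G z).

Let C0 : 0 <= C. Proof. exact: le_trans (normr_ge0 _) (GC 0). Qed.

Lemma scale_le x y : x <= y -> S x <= S y.
Proof. exact: cumulative_is_nondecreasing. Qed.

Lemma scale_ge0 x : 0 <= S x.
Proof.
have [x0|/ltW x0] := leP 0 x; last by rewrite (scale_le0 HX x0).
by rewrite -(scale_le0 HX (lexx 0)) scale_le.
Qed.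

Let mG : measurable_fun setT G.
Proof. exact: continuous_measurable_fun. Qed.

Let mS : measurable_fun setT S.
Proof.
have cS : continuous (S : R -> R) by move=> x; exact: (Defs.scale_continuous HX).
exact: continuous_measurable_fun.
Qed.

Lemma speed_integrable (phi : R -> R) (K x y : R) : 0 <= x -> measurable_fun setT phi ->
  (forall z, x < z <= y -> `|phi z| <= K) ->
  m.-integrable `]x, y] (EFin \o phi).
Proof.
move=> x0 mphi phiK; apply: measurable_bounded_integrable => //.
- exact: speed_itv_fin.
- exact: measurable_funTS.
exists K; split; first exact: num_real.
move=> l Kl z /=; rewrite in_itv/= => /phiK h; exact: le_trans h (ltW Kl).
Qed.

Lemma speed_Rintegral_le (phi : R -> R) (K x y : R) : 0 <= x -> x <= y ->
  measurable_fun setT phi ->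
  (forall z, x < z <= y -> `|phi z| <= K) ->
  `|\int[m]_(z in `]x, y]) phi z| <= K * (speed_cdf y - speed_cdf x).
Proof.
move=> x0 xy mphi phiK.
have iphi := speed_integrable x0 mphi phiK.
apply: le_trans (le_normr_Rintegral _ iphi) _ => //.
have -> : K * (speed_cdf y - speed_cdf x) = \int[m]_(z in `]x, y]) K.
  by rewrite Rintegral_cst// speed_cdfB.
apply: le_Rintegral => //.
- exact: integrable_norm iphi.
- by apply: (speed_integrable (K := `|K|)) => //.
Qed.

Lemma speed_Rintegral_split (phi : R -> R) (K x y : R) : 0 <= x -> x <= y ->
  measurable_fun setT phi -> (forall z, 0 < z <= y -> `|phi z| <= K) ->
  \int[m]_(z in `]0, y]) phi z =
  \int[m]_(z in `]0, x]) phi z + \int[m]_(z in `]x, y]) phi z.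
Proof.
move=> x0 xy mphi phiK.
have e : `]0, y]%classic = `]0, x]%classic `|` `]x, y]%classic :> set R.
  by rewrite -itv_bndbnd_setU// bnd_simp.
rewrite e Rintegral_setU//.
  by rewrite -e; apply: speed_integrable phiK.
apply/disj_set2P/seteqP; split => // z [] /=; rewrite !in_itv/=.
by move=> /andP[_ zx] /andP[xz _]; rewrite leNgt xz in zx.
Qed.

Lemma reflecting_derivB x y : 0 <= x -> x <= y ->
  reflecting_deriv y - reflecting_deriv x = \int[m]_(z in `]x, y]) G z.
Proof.
move=> x0 xy; rewrite /reflecting_deriv (speed_Rintegral_split (K := C) x0 xy)//.
by rewrite addrC addKr.
Qed.

(** A first-order expansion in the scale: on []0, x]] the two integrands differ by
    [(S y - S x) * G z], and the part on []x, y]] is the remainder. *)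
Lemma reflecting_solB x y : 0 <= x -> x <= y ->
  reflecting_sol y - reflecting_sol x =
  (S y - S x) * reflecting_deriv x + \int[m]_(z in `]x, y]) ((S y - S z) * G z).
Proof.
move=> x0 xy.
have mSG y' : measurable_fun setT (fun z => (S y' - S z) * G z).
  by apply: measurable_funM => //; exact: measurable_funB.
have SGC y' z : 0 < z <= y' -> `|(S y' - S z) * G z| <= S y' * C.
  move=> /andP[z0 zy]; rewrite normrM ler_pM// ger0_norm ?subr_ge0 ?scale_le//.
  by rewrite gerBl scale_ge0.
rewrite /reflecting_sol (speed_Rintegral_split (K := S y * C) x0 xy)//; last exact: SGC.
rewrite addrAC; congr (_ + _).
rewrite -RintegralB//.
- rewrite /reflecting_deriv -RintegralZl//; last exact: (speed_integrable (K := C)).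
  by apply: eq_Rintegral => z _; ring.
- apply: (speed_integrable (K := S y * C)) => // z /andP[z0 zx].
  by apply: SGC; rewrite z0 (le_trans zx).
- by apply: (speed_integrable (K := S x * C)) => // z /SGC.
Qed.

Lemma reflecting_derivB_le x y : 0 <= x -> x <= y ->
  `|reflecting_deriv y - reflecting_deriv x| <= C * (speed_cdf y - speed_cdf x).
Proof.
by move=> x0 xy; rewrite reflecting_derivB//; exact: speed_Rintegral_le.
Qed.

Lemma reflecting_solB_le x y : 0 <= x -> x <= y ->
  `|reflecting_sol y - reflecting_sol x - (S y - S x) * reflecting_deriv x| <=
  (S y - S x) * C * (speed_cdf y - speed_cdf x).
Proof.
move=> x0 xy; rewrite reflecting_solB// addrC addKr.
apply: speed_Rintegral_le => //.
  by apply: measurable_funM => //; exact: measurable_funB.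
move=> z /andP[xz zy]; rewrite normrM ler_pM//.
by rewrite ger0_norm ?subr_ge0 ?scale_le// lerB// scale_le// ltW.
Qed.

(** For [y < x] the expansion is centred at [y], and moving the derivative from [y] to [x] costs a
    second error of the same size; hence the factor 2. *)
Lemma reflecting_quotient x y : 0 <= x -> 0 <= y -> y != x ->
  `|reflecting_deriv x - (reflecting_sol y - reflecting_sol x) / (S y - S x)| <=
  2 * C * `|speed_cdf x - speed_cdf y|.
Proof.
move=> x0 y0; rewrite neq_lt => /orP[yx|xy].
- have Syx : 0 < S x - S y by rewrite subr_gt0 (scale_increasing HX).
  have h1 := reflecting_derivB_le y0 (ltW yx).
  have h2 := reflecting_solB_le y0 (ltW yx).
  have h3 : `|(reflecting_sol x - reflecting_sol y) / (S x - S y) - reflecting_deriv y| <=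
      C * (speed_cdf x - speed_cdf y).
    rewrite -(ler_pM2l Syx) -[X in X * `|_|]gtr0_norm// -normrM mulrBr.
    by rewrite mulrCA mulfV ?gt_eqF// mulr1 mulrA.
  rewrite -[in X in X / _]opprB -[S y - _]opprB invrN mulrNN.
  rewrite [X in _ <= _ * X]ger0_norm; last by rewrite subr_ge0 le_speed_cdf// ltW.
  move: h1 h3; set q := _ / _; set M := C * _ => h1 h3.
  rewrite -mulrA -/M.
  have -> : reflecting_deriv x - q = (reflecting_deriv x - reflecting_deriv y) -
    (q - reflecting_deriv y) by ring.
  apply: (le_trans (ler_normB _ _)); lra.
- have Syx : 0 < S y - S x by rewrite subr_gt0 (scale_increasing HX).
  have h2 := reflecting_solB_le x0 (ltW xy).
  have h3 : `|reflecting_deriv x - (reflecting_sol y - reflecting_sol x) / (S y - S x)| <=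
      C * (speed_cdf y - speed_cdf x).
    rewrite distrC -(ler_pM2l Syx) -[X in X * `|_|]gtr0_norm// -normrM mulrBr.
    by rewrite mulrCA mulfV ?gt_eqF// mulr1 mulrA.
  apply: le_trans h3 _; rewrite distrC ger0_norm; last by rewrite subr_ge0 le_speed_cdf// ltW.
  rewrite -mulrA; have : 0 <= C * (speed_cdf y - speed_cdf x).
    by rewrite mulr_ge0// subr_ge0 le_speed_cdf// ltW.
  lra.
Qed.

(** The restriction to [y >= 0] treats the two-sided derivative at [x > 0] and the right derivative
    at 0 together. *)
Lemma reflecting_quotient_cvg x : 0 <= x ->
  (reflecting_sol y - reflecting_sol x) / (S y - S x)
    @[y --> within [set y | 0 <= y] x^'] --> reflecting_deriv x.
Proof.
move=> x0; apply/cvgrPdist_le => e e0.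
have C2 : 0 < 2 * C + 1 by rewrite ltr_wpDl// mulr_ge0.
have := continuous_speed_cdf (x := x).
move=> /cvgrPdist_le/(_ (e / (2 * C + 1))); rewrite divr_gt0// => /(_ isT) h.
rewrite near_withinE.
near=> y => y0.
have yx : y != x by near: y; exact: nbhs_dnbhs_neq.
apply: le_trans (reflecting_quotient x0 y0 yx) _.
apply: (@le_trans _ _ ((2 * C + 1) * `|speed_cdf x - speed_cdf y|)).
  by rewrite ler_wpM2r// lerDl.
rewrite mulrC -ler_pdivlMr//; near: y.
exact: nbhs_dnbhs.
Unshelve. all: by end_near.
Qed.

Lemma reflecting_deriv_le0 x : x <= 0 -> reflecting_deriv x = 0.
Proof.
by move=> x0; rewrite /reflecting_deriv set_itv_ge ?Rintegral_set0// bnd_simp -leNgt.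
Qed.

Lemma reflecting_sol_le0 x : x <= 0 -> reflecting_sol x = 0.
Proof.
by move=> x0; rewrite /reflecting_sol set_itv_ge ?Rintegral_set0// bnd_simp -leNgt.
Qed.

Lemma reflecting_sol_dm_dS : dm_dS_reflecting S m reflecting_sol G.
Proof.
exists reflecting_deriv; split.
- move=> x x0; apply: cvg_trans (reflecting_quotient_cvg (ltW x0)).
  apply: cvg_app => A hA.
  have {}hA : \forall y \near x^', 0 <= y -> A y by exact: hA.
  have hx : \forall y \near x^', 0 <= y.
    by apply: nbhs_dnbhs; near=> y; apply: ltW; near: y; exact: lt_nbhsr.
  suff : \forall y \near x^', A y by [].
  by near=> y; apply: (near hA y) => //; exact: (near hx y).
- apply: cvg_trans (reflecting_quotient_cvg (lexx 0)).
  apply: cvg_app => A hA.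
  have {}hA : \forall y \near nbhs 0, y != 0 -> 0 <= y -> A y by exact: hA.
  apply: filterS hA => y hy y0.
  by apply: hy; [rewrite gt_eqF|exact: ltW].
- exact: reflecting_deriv_le0.
- by move=> a b a0 ab; apply: reflecting_derivB => //; exact: ltW.
Unshelve. all: by end_near.
Qed.

Lemma reflecting_sol_lip x y : x <= y ->
  `|reflecting_sol y - reflecting_sol x| <= (S y - S x) * (C * speed_cdf y).
Proof.
have main x' y' : 0 <= x' -> x' <= y' ->
    `|reflecting_sol y' - reflecting_sol x'| <= (S y' - S x') * (C * speed_cdf y').
  move=> x0 xy.
  have Sxy : 0 <= S y' - S x' by rewrite subr_ge0 scale_le.
  have := reflecting_solB_le x0 xy; have := reflecting_derivB_le (lexx 0) x0.
  rewrite (reflecting_deriv_le0 (lexx 0)) (speed_cdf0 (lexx 0)) !subr0 => h1 h2.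
  rewrite -[X in `|X|](subrK ((S y' - S x') * reflecting_deriv x')).
  apply: (le_trans (ler_normD _ _)); rewrite normrM (ger0_norm Sxy).
  have := ler_wpM2l Sxy h1; rewrite -mulrA in h2; rewrite !mulrBr in h2 *; lra.
move=> xy; have [x0|/ltW x0] := leP 0 x; first exact: main.
have [y0|/ltW y0] := leP 0 y; last first.
  rewrite !reflecting_sol_le0// subrr normr0 (scale_le0 HX x0) (scale_le0 HX y0).
  by rewrite subrr mul0r.
have := main 0 y (lexx 0) y0.
by rewrite !(reflecting_sol_le0 (lexx 0), reflecting_sol_le0 x0,
  scale_le0 HX (lexx 0), scale_le0 HX x0).
Qed.

Lemma continuous_reflecting_sol : continuous reflecting_sol.
Proof.
move=> x; apply/cvgrPdist_le => e e0.
have M0 y : 0 <= speed_cdf y by exact: fine_ge0.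
(* Bounds the Lipschitz constant with respect to [S] at all points up to [x + 1]; the added 1 makes
   it positive. *)
pose K := C * speed_cdf (x + 1) + 1.
have K0 : 0 < K by rewrite ltr_wpDl// mulr_ge0.
have := @Defs.scale_continuous _ _ _ _ HX x.
move=> /cvgrPdist_le/(_ (e / K)); rewrite divr_gt0// => /(_ isT) h.
near=> y.
have yx1 : y <= x + 1.
  apply: ltW; near: y; apply: lt_nbhsl; by rewrite ltrDl.
have hxy : `|S x - S y| <= e / K by near: y.
have key a b : a <= b -> b <= x + 1 -> `|S b - S a| <= e / K ->
    `|reflecting_sol b - reflecting_sol a| <= e.
  move=> ab bx hab; apply: le_trans (reflecting_sol_lip ab) _.
  have Sab : 0 <= S b - S a by rewrite subr_ge0 scale_le.
  rewrite ger0_norm// in hab.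
  rewrite -[leRHS](divfK (lt0r_neq0 K0)) ler_pM//; first by rewrite mulr_ge0.
  rewrite /K; apply: le_trans (ler_wpM2l C0 (le_speed_cdf bx)) _.
  by rewrite lerDl.
have [xy|/ltW yx] := leP x y; last by apply: key => //; rewrite lerDl.
by rewrite distrC; apply: key => //; rewrite distrC.
Unshelve. all: by end_near.
Qed.

End solution.
End reflecting_solution.

Lemma Rintegral_eq0 d (T : measurableType d) (R : realType)
    (mu : {measure set T -> \bar R}) (D : set T) (f : T -> R) :
  (forall x, D x -> f x = 0) -> \int[mu]_(x in D) f x = 0.
Proof.
move=> f0; rewrite /Rintegral (eq_integral (cst 0%E)) ?integral0//.
by move=> x; rewrite inE => /f0 ->.
Qed.

Section reflecting_bounds.
Variable R : realType.
Variables (P : R -> probability (cpath R) R) (S : cumulative R R)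
  (m : {measure set R -> \bar R}).
Hypothesis HX : linear_diffusion P S m.
Implicit Types (x y z : R).

Let mS : measurable_fun setT S.
Proof.
have cS : continuous (S : R -> R) by move=> x; exact: (Defs.scale_continuous HX).
exact: continuous_measurable_fun.
Qed.

Lemma reflecting_integrable (G : R -> R) (C x y : R) :
  continuous G -> (forall z, `|G z| <= C) ->
  m.-integrable `]0, y] (EFin \o G) /\
  m.-integrable `]0, y] (EFin \o (fun z => (S x - S z) * G z)).
Proof.
move=> cG GC; have mG : measurable_fun setT G by exact: continuous_measurable_fun.
split; first by apply: (speed_integrable HX _ mG (K := C)) => //.
apply: (@speed_integrable _ _ _ _ HX _ ((`|S x| + S y) * C)) => //.
  by apply: measurable_funM => //; exact: measurable_funB.
move=> z /andP[z0 zy]; rewrite normrM ler_pM//.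
apply: (le_trans (ler_normB _ _)); rewrite lerD2l ger0_norm ?(scale_ge0 HX)//.
exact: scale_le.
Qed.

Section nonneg.
Variables (g : R -> R) (C : R).
Hypotheses (cg : continuous g) (g0 : forall z, 0 <= g z) (gC : forall z, g z <= C).

Let gC' z : `|g z| <= C. Proof. by rewrite ger0_norm. Qed.
Let mg : measurable_fun setT g. Proof. exact: continuous_measurable_fun. Qed.

Lemma reflecting_deriv_ge0 x : 0 <= reflecting_deriv m g x.
Proof. exact: Rintegral_ge0. Qed.

Lemma reflecting_deriv_cst d x : 0 <= d -> d <= x ->
  (forall z, d < z -> g z = 0) -> reflecting_deriv m g x = reflecting_deriv m g d.
Proof.
move=> d0 dx gd; apply/eqP; rewrite -subr_eq0 (reflecting_derivB HX cg gC' d0 dx).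
apply/eqP/Rintegral_eq0.
by move=> z; rewrite /= in_itv/= => /andP[dz _]; exact: gd.
Qed.

Lemma le_reflecting_deriv x y : 0 <= x -> x <= y ->
  reflecting_deriv m g x <= reflecting_deriv m g y.
Proof.
move=> x0 xy; rewrite -subr_ge0 (reflecting_derivB HX cg gC' x0 xy).
exact: Rintegral_ge0.
Qed.

Lemma reflecting_sol_ge0 x : 0 <= reflecting_sol S m g x.
Proof.
apply: Rintegral_ge0 => z /=; rewrite in_itv/= => /andP[_ zx].
by rewrite mulr_ge0// subr_ge0 scale_le.
Qed.

Lemma reflecting_sol_le b x : 0 <= x -> (forall z, z <= b -> g z = 0) ->
  reflecting_sol S m g x <= (S x - S b) * reflecting_deriv m g x.
Proof.
move=> x0 gb; have [ig isg] := reflecting_integrable x x cg gC'.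
rewrite /reflecting_deriv -RintegralZl//; apply: le_Rintegral => //.
  exact: (integrableZl _ _ ig).
move=> z _; have [zb|bz] := leP z b; first by rewrite gb// !mulr0.
by rewrite ler_wpM2r// lerB// scale_le// ltW.
Qed.

Lemma reflecting_sol_le_scale x : 0 <= x ->
  reflecting_sol S m g x <= S x * reflecting_deriv m g x.
Proof.
move=> x0; have [ig isg] := reflecting_integrable x x cg gC'.
rewrite /reflecting_deriv -RintegralZl//; apply: le_Rintegral => //.
  exact: (integrableZl _ _ ig).
by move=> z _; rewrite ler_wpM2r// gerBl (scale_ge0 HX).
Qed.

Lemma reflecting_sol_ge d x : 0 <= x -> (forall z, d < z -> g z = 0) ->
  (S x - S d) * reflecting_deriv m g x <= reflecting_sol S m g x.
Proof.
move=> x0 gd; have [ig isg] := reflecting_integrable x x cg gC'.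
rewrite /reflecting_deriv -RintegralZl//; apply: le_Rintegral => //.
  exact: (integrableZl _ _ ig).
move=> z _; have [zd|dz] := leP z d; last by rewrite gd// !mulr0.
by rewrite ler_wpM2r// lerB// scale_le// ltW.
Qed.

Lemma reflecting_sol_eq0 b x : x <= b -> (forall z, z <= b -> g z = 0) ->
  reflecting_sol S m g x = 0.
Proof.
move=> xb gb; apply: Rintegral_eq0.
move=> z; rewrite /= in_itv/= => /andP[_ zx].
by rewrite gb ?mulr0// (le_trans zx).
Qed.

End nonneg.

(* The flux created by [g] near 0 is absorbed by [k] far away: [f] solves
   d/dm df/dS = g - k, differs from [S] by at most [S d] on [0, b] and is bounded,
   hence belongs to the domain of the generator. *)
Section two_bumps.
Variables (g k : R -> R) (C d b b' : R).
Hypotheses (cg : continuous g) (ck : continuous k).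
Hypotheses (g0 : forall z, 0 <= g z) (gC : forall z, g z <= C).
Hypotheses (k0 : forall z, 0 <= k z) (kC : forall z, k z <= C).
Hypotheses (d0 : 0 <= d) (db : d <= b) (bb : b <= b').
Hypotheses (gd : forall z, d < z -> g z = 0)
  (kb : forall z, z <= b -> k z = 0) (kb' : forall z, b' < z -> k z = 0).
Hypotheses (g1 : reflecting_deriv m g d = 1) (k1 : reflecting_deriv m k b' = 1).

Let G z := g z - k z.
Let f := reflecting_sol S m G.

Let cG : continuous G.
Proof. by move=> z; apply: cvgB; [exact: cg|exact: ck]. Qed.

Let GC z : `|G z| <= C + C.
Proof. by apply: (le_trans (ler_normB _ _)); rewrite lerD// ger0_norm. Qed.

Let gC' z : `|g z| <= C. Proof. by rewrite ger0_norm. Qed.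
Let kC' z : `|k z| <= C. Proof. by rewrite ger0_norm. Qed.
Let b0 : 0 <= b. Proof. exact: le_trans db. Qed.
Let b0' : 0 <= b'. Proof. exact: le_trans bb. Qed.

Lemma reflecting_solD x : f x = reflecting_sol S m g x - reflecting_sol S m k x.
Proof.
have [_ i1] := reflecting_integrable x x cg gC'.
have [_ i2] := reflecting_integrable x x ck kC'.
rewrite -RintegralB//; apply: eq_Rintegral => z _.
by rewrite -mulrBr.
Qed.

Let deriv_k_le1 x : 0 <= x -> reflecting_deriv m k x <= 1.
Proof.
move=> x0; have [xb|/ltW bx] := leP x b'.
  by rewrite -k1; exact: (le_reflecting_deriv ck k0 kC x0 xb).
by rewrite -k1 (reflecting_deriv_cst ck k0 kC b0' bx kb').
Qed.

Let deriv_g_le1 x : 0 <= x -> reflecting_deriv m g x <= 1.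
Proof.
move=> x0; have [xb|/ltW bx] := leP x d.
  by rewrite -g1; exact: (le_reflecting_deriv cg g0 gC x0 xb).
by rewrite -g1 (reflecting_deriv_cst cg g0 gC d0 bx gd).
Qed.

Let sol_g_ge x : 0 <= x -> S x - S d <= reflecting_sol S m g x.
Proof.
move=> x0; have [xd|/ltW dx] := leP x d.
  by apply: le_trans (reflecting_sol_ge0 g0 x); rewrite subr_le0 scale_le.
have := reflecting_sol_ge cg g0 gC x0 gd.
by rewrite (reflecting_deriv_cst cg g0 gC d0 dx gd) g1 mulr1.
Qed.

(** Absorption comes after creation: [k] has flux at most 1 and acts only beyond [b], so its
    solution is at most [S x - S b <= S x - S d] there, and that of [g] is at least [S x - S d]. *)
Lemma two_bumps_ge0 x : 0 <= f x.
Proof.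
have [x0|x0] := leP x 0; first by rewrite /f reflecting_sol_le0.
rewrite reflecting_solD; have [xb|/ltW bx] := leP x b.
  by rewrite (reflecting_sol_eq0 xb kb) subr0 reflecting_sol_ge0.
have h1 := sol_g_ge (ltW x0).
have h2 := reflecting_sol_le ck k0 kC (ltW x0) kb.
have h3 : (S x - S b) * reflecting_deriv m k x <= S x - S b.
  rewrite -[leRHS]mulr1 ler_wpM2l ?subr_ge0 ?scale_le//.
  exact: (deriv_k_le1 (ltW x0)).
have := scale_le S db; lra.
Qed.

(** Up to [b] only [g] acts. Its flux is at most 1, which gives the upper bound, and equals 1 beyond
    [d], which gives the lower one. *)
Lemma two_bumps_near x : 0 <= x -> x <= b -> S x - S d <= f x <= S x.
Proof.
move=> x0 xb; rewrite reflecting_solD (reflecting_sol_eq0 xb kb) subr0.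
rewrite sol_g_ge//=; apply: (le_trans (reflecting_sol_le_scale cg g0 gC x0)).
rewrite -[leRHS]mulr1 ler_wpM2l ?(scale_ge0 HX)//; exact: deriv_g_le1.
Qed.

Lemma two_bumps_le x : f x <= S b'.
Proof.
have [x0|/ltW x0] := leP x 0; first by rewrite /f reflecting_sol_le0// (scale_ge0 HX).
have main y : 0 <= y -> y <= b' -> f y <= S b'.
  move=> y0 yb; rewrite reflecting_solD.
  have h1 := reflecting_sol_ge0 k0 y.
  have h2 := reflecting_sol_le_scale cg g0 gC y0.
  have h3 : S y * reflecting_deriv m g y <= S b' * 1.
    rewrite ler_pM ?(scale_ge0 HX) ?reflecting_deriv_ge0 ?scale_le//.
    exact: deriv_g_le1.
  lra.
have [xb|/ltW bx] := leP x b'; first exact: main.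
suff -> : f x = f b' by exact: main.
apply/eqP; rewrite -subr_eq0 (reflecting_solB HX cG GC b0' bx).
(* The unit fluxes of [g] and [k] cancel at [b'] and no source is left beyond, so [f] is constant
   from there on. *)
have -> : reflecting_deriv m G b' = 0.
  have [i1 _] := reflecting_integrable b' b' cg gC'.
  have [i2 _] := reflecting_integrable b' b' ck kC'.
  rewrite /reflecting_deriv RintegralB// -/(reflecting_deriv m g b') -/(reflecting_deriv m k b').
  by rewrite (reflecting_deriv_cst cg g0 gC d0 (le_trans db bb) gd) g1 k1 subrr.
rewrite mulr0 add0r; apply/eqP/Rintegral_eq0.
move=> z; rewrite /= in_itv/= => /andP[bz _].
by rewrite /G gd ?kb' ?subr0 ?mulr0// (le_lt_trans _ bz)// (le_trans db bb).
Qed.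

Lemma two_bumps_generator : generator P f G.
Proof.
apply: (diff_generator HX f G).2; split.
- split; first by apply: continuous_subspaceT => x; exact: (continuous_reflecting_sol HX cG GC).
  exists (S b') => x _; rewrite ger0_norm ?two_bumps_ge0//; exact: two_bumps_le.
- split; first exact: continuous_subspaceT.
  by exists (C + C) => x _.
- exact: (reflecting_sol_dm_dS HX cG GC).
Qed.

Lemma continuous_two_bumps : continuous f.
Proof. exact: (continuous_reflecting_sol HX cG GC). Qed.

End two_bumps.
End reflecting_bounds.

(** * A supermartingale estimate *)

Section bounded_measurable.
Context d (T : measurableType d) (R : realType) (P : probability T R).
Implicit Types X Y : T -> R.

(** A class closed under sums, differences and products and made of integrable functions, so that
    linearity of the expectation applies to the compound expressions below. *)
Definition bounded_measurable X :=
  measurable_fun setT X /\ exists K, forall w, `|X w| <= K.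

Lemma bounded_measurable_integrable X : bounded_measurable X ->
  P.-integrable setT (EFin \o X).
Proof. by move=> [mX [K XK]]; exact: (bounded_integrable _ mX XK). Qed.

Lemma bounded_measurable_cst r : bounded_measurable (fun _ => r).
Proof. by split => //; exists `|r|. Qed.

Lemma bounded_measurableD X Y : bounded_measurable X -> bounded_measurable Y ->
  bounded_measurable (fun w => X w + Y w).
Proof.
move=> [mX [K XK]] [mY [L YL]]; split; first exact: measurable_funD.
by exists (K + L) => w; apply: (le_trans (ler_normD _ _)); rewrite lerD.
Qed.

Lemma bounded_measurableM X Y : bounded_measurable X -> bounded_measurable Y ->
  bounded_measurable (fun w => X w * Y w).
Proof.
move=> [mX [K XK]] [mY [L YL]]; split; first exact: measurable_funM.
by exists (K * L) => w; rewrite normrM ler_pM.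
Qed.

Lemma bounded_measurableB X Y : bounded_measurable X -> bounded_measurable Y ->
  bounded_measurable (fun w => X w - Y w).
Proof.
move=> bX bY.
have := bounded_measurableD bX (bounded_measurableM (bounded_measurable_cst (-1)) bY).
by under eq_fun do rewrite mulN1r.
Qed.

Lemma bounded_measurable_RintegralD X Y :
  bounded_measurable X -> bounded_measurable Y ->
  \int[P]_w (X w + Y w) = \int[P]_w X w + \int[P]_w Y w.
Proof. by move=> bX bY; rewrite RintegralD//; exact: bounded_measurable_integrable. Qed.

Lemma bounded_measurable_RintegralB X Y :
  bounded_measurable X -> bounded_measurable Y ->
  \int[P]_w (X w - Y w) = \int[P]_w X w - \int[P]_w Y w.
Proof. by move=> bX bY; rewrite RintegralB//; exact: bounded_measurable_integrable. Qed.

Lemma bounded_measurable_RintegralZ X r : bounded_measurable X ->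
  \int[P]_w (r * X w) = r * \int[P]_w X w.
Proof. by move=> bX; rewrite RintegralZl//; exact: bounded_measurable_integrable. Qed.

Lemma le_bounded_measurable_Rintegral X Y :
  bounded_measurable X -> bounded_measurable Y -> (forall w, X w <= Y w) ->
  \int[P]_w X w <= \int[P]_w Y w.
Proof. by move=> bX bY XY; apply: le_Rintegral => //; exact: bounded_measurable_integrable. Qed.

Lemma probability_Rintegral_cst r : \int[P]_w r = r.
Proof.
transitivity (r * fine (P setT)); first by rewrite Rintegral_cst.
by rewrite probability_setT mulr1.
Qed.

End bounded_measurable.

Section occupation_estimate.
Variable R : realType.
Variables (P : R -> probability (cpath R) R) (S : cumulative R R)
  (m : {measure set R -> \bar R}).
Hypothesis HX : linear_diffusion P S m.
Variables (f g k : R -> R) (F C s a c N : R).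
Hypotheses (cf : continuous f) (f0 : forall z, 0 <= f z) (fF : forall z, f z <= F)
  (f00 : f 0 = 0).
Hypotheses (cg : continuous g) (g0 : forall z, 0 <= g z) (gC : forall z, g z <= C).
Hypotheses (k0 : forall z, 0 <= k z).
Hypothesis fG : generator P f (fun z => g z - k z).
Hypothesis gf : forall z, 0 <= z -> g z * Num.max 0 (f z - s) = 0.
Hypotheses (s0 : 0 <= s) (ac : a <= c) (N0 : 0 <= N).

Implicit Types (t h : R) (w : cpath R).

Let phi := bump a c N.
Let kappa := clamp a c.
Let D t w := occupation g t w.
Let E0 (X : cpath R -> R) : R := \int[P 0]_w X w.
(* [f (X t) phi(D t) - kappa(D t)] would be a supermartingale by Ito's formula if
   [phi] were the derivative of [kappa] and [f] vanished where [g > 0]; the term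
   [N * s] accounts for [f <= s] there.  [V t h] bounds the increment of [U], and
   [W t h] has the same expectation as [V t h / h] by the Markov property. *)
Let U t w : R := f (w t) * phi (D t w) - (1 + N * s) * kappa (D t w).
Let V t h w : R := phi (D t w) * (f (w (t + h)) - f (w t)) +
  (N * Num.max 0 (f (w (t + h)) - s) - phi (D t w) + N * (D (t + h) w - D t w)) *
  (D (t + h) w - D t w).
Let W t h w : R := phi (D t w) * ((semigroup P h f (w t) - f (w t)) / h) +
  (N * Num.max 0 (f (w (t + h)) - s) - phi (D t w) + N * (D (t + h) w - D t w)) *
  ((D (t + h) w - D t w) / h).
Let W0 t w : R := phi (D t w) * (g (w t) - k (w t)) +
  (N * Num.max 0 (f (w t) - s) - phi (D t w)) * g (w t).

Let mf : measurable_fun setT f. Proof. exact: continuous_measurable_fun. Qed.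
Let mg : measurable_fun setT g. Proof. exact: continuous_measurable_fun. Qed.
Let mphi : measurable_fun setT phi.
Proof. by apply: continuous_measurable_fun; exact: continuous_bump. Qed.
Let C0 : 0 <= C. Proof. exact: le_trans (g0 0) (gC 0). Qed.

Let D_incr t h w : 0 <= h -> 0 <= D (t + h) w - D t w <= C * h.
Proof.
move=> h0; have th : t <= t + h by rewrite lerDl.
have := occupation_incr mg g0 gC w th.
by rewrite [t + h]addrC addrK.
Qed.

(** The factor [f (w (t + h))] of the increment of [phi (D)] is split at level [s]. Up to [s],
    [bumpB] yields [N * s] times the increment of [kappa], which the extra term of [U] cancels; the
    excess over [s] goes into [V]. The remaining copy of [kappa] gives [- phi (D t w)] times the
    increment of [D], with a quadratic error, by [bump_clamp]. *)
Let U_le t h w : 0 <= h -> U (t + h) w - U t w <= V t h w.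
Proof.
move=> h0; have /andP[] := D_incr t w h0; rewrite subr_ge0 /U /V => DD _.
have h1 := bumpB ac N0 DD; have h2 := clampB ac DD; have h3 := le_clamp a c DD.
have h4 := bump_clamp a c N0 DD.
move: DD h1 h2 h3 h4; rewrite -/phi -/kappa.
move: (D t w) (D (t + h) w) => x y xy h1 h2 h3 h4.
move: (f (w t)) (f (w (t + h))) (f0 (w (t + h))) => ft fth fth0.
have p1 := ler_wpM2l fth0 h1.
have p2 : fth * (N * (kappa y - kappa x)) <=
    N * s * (kappa y - kappa x) + N * Num.max 0 (fth - s) * (y - x).
  have m0 : fth - s <= Num.max 0 (fth - s) by rewrite le_max lexx orbT.
  have m1 : 0 <= Num.max 0 (fth - s) by rewrite le_max lexx.
  have q1 : (fth - s) * (kappa y - kappa x) <= Num.max 0 (fth - s) * (y - x).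
    apply: (@le_trans _ _ (Num.max 0 (fth - s) * (kappa y - kappa x))).
      by rewrite ler_wpM2r// subr_ge0.
    by rewrite ler_wpM2l.
  have := ler_wpM2l N0 q1; rewrite !mulrA; lra.
lra.
Qed.

(** The two products [phi * g] cancel and [gf] kills the excess over [s]. What remains is
    [- phi * k]: the absorption at infinity only lowers the expectation. *)
Let W0_le0 t w : W0 t w <= 0.
Proof.
have -> : W0 t w = N * (g (w t) * Num.max 0 (f (w t) - s)) - phi (D t w) * k (w t).
  by rewrite /W0; ring.
rewrite gf ?path_ge0// mulr0 sub0r.
have := mulr_ge0 (bump_ge0 a c (D t w) N0) (k0 (w t)); rewrite -/phi; lra.
Qed.

Let bm_eval (q : R -> R) K t : measurable_fun setT q -> (forall z, 0 <= q z) ->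
  (forall z, q z <= K) -> bounded_measurable (fun w : cpath R => q (w t)).
Proof.
move=> mq q0 qK; split; last by exists K => w; rewrite ger0_norm.
by apply: measurableT_comp => //; exact: measurable_eval.
Qed.

Let bm_phi t : bounded_measurable (fun w => phi (D t w)).
Proof.
split; last by exists 1 => w; rewrite ger0_norm ?bump_ge0 ?bump_le1.
by apply: measurableT_comp => //; exact: (measurable_occupation mg g0).
Qed.

Let bm_kappa t : bounded_measurable (fun w => kappa (D t w)).
Proof.
split; last by exists (c - a) => w; rewrite ger0_norm ?clamp_ge0 ?clamp_le.
apply: measurableT_comp; last exact: (measurable_occupation mg g0).
by apply: continuous_measurable_fun; exact: continuous_clamp.
Qed.

Let bm_f t := bm_eval t mf f0 fF.

Let bm_U t : bounded_measurable (U t).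
Proof.
apply: bounded_measurableB; first exact: bounded_measurableM.
by apply: bounded_measurableM => //; exact: bounded_measurable_cst.
Qed.

Let bm_D t h : 0 <= h -> bounded_measurable (fun w => D (t + h) w - D t w).
Proof.
move=> h0; split.
  by apply: measurable_funB; exact: (measurable_occupation mg g0).
exists (C * h) => w.
by have /andP[h1 h2] := D_incr t w h0; rewrite ger0_norm.
Qed.

Let bm_max t : bounded_measurable (fun w => Num.max 0 (f (w t) - s)).
Proof.
apply: (@bm_eval (fun z => Num.max 0 (f z - s)) F).
- by apply: measurable_maxr => //; exact: measurable_funB.
- by move=> z; rewrite le_max lexx.
- move=> z; rewrite ge_max (le_trans (f0 0))//=.
  by rewrite lerBlDr (le_trans (fF z))// lerDl.
Qed.

Let bm_semigroup t h : bounded_measurable (fun w => semigroup P h f (w t)).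
Proof.
split; first exact: (measurable_semigroup HX).
exists F => w; have /andP[h1 h2] := semigroup_bound P h (w t) mf f0 fF.
by rewrite ger0_norm.
Qed.

Let bm_rest t h : 0 <= h -> bounded_measurable (fun w =>
  N * Num.max 0 (f (w (t + h)) - s) - phi (D t w) + N * (D (t + h) w - D t w)).
Proof.
move=> h0; apply: bounded_measurableD.
  apply: bounded_measurableB => //.
  by apply: bounded_measurableM => //; exact: bounded_measurable_cst.
by apply: bounded_measurableM; [exact: bounded_measurable_cst|exact: bm_D].
Qed.

Let bm_cst (r : R) : bounded_measurable (fun _ : cpath R => r).
Proof. exact: bounded_measurable_cst. Qed.

Let bm_V t h : 0 <= h -> bounded_measurable (V t h).
Proof.
move=> h0; apply: bounded_measurableD.
  by apply: bounded_measurableM => //; exact: bounded_measurableB.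
by apply: bounded_measurableM; [exact: bm_rest|exact: bm_D].
Qed.

Let bm_W t h : 0 <= h -> bounded_measurable (W t h).
Proof.
move=> h0; apply: bounded_measurableD.
  apply: bounded_measurableM => //; apply: bounded_measurableM => //.
  exact: bounded_measurableB.
apply: bounded_measurableM; first exact: bm_rest.
by apply: bounded_measurableM => //; exact: bm_D.
Qed.

(** Since [phi (D t w)] depends on the path up to [t], the Markov property replaces [f (w (t + h))]
    by its semigroup value in the first summand; the second is only divided and multiplied by
    [h]. *)
Let E0_V t h : 0 <= t -> 0 < h -> E0 (V t h) = h * E0 (W t h).
Proof.
move=> t0 h0; rewrite /E0 -bounded_measurable_RintegralZ; last exact: bm_W (ltW h0).
have bD := bm_D t (ltW h0); have bR := bm_rest t (ltW h0).
have -> : (fun w => h * W t h w) = (fun w =>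
    (semigroup P h f (w t) * phi (D t w) - f (w t) * phi (D t w)) +
    (N * Num.max 0 (f (w (t + h)) - s) - phi (D t w) + N * (D (t + h) w - D t w)) *
    (D (t + h) w - D t w)).
  apply/funext => w; rewrite /W mulrDr; congr (_ + _).
    by rewrite mulrCA [h * _]mulrC divfK ?gt_eqF// mulrC mulrBl.
  by rewrite mulrCA [h * _]mulrC divfK ?gt_eqF.
have -> : V t h = (fun w =>
    (f (w (t + h)) * phi (D t w) - f (w t) * phi (D t w)) +
    (N * Num.max 0 (f (w (t + h)) - s) - phi (D t w) + N * (D (t + h) w - D t w)) *
    (D (t + h) w - D t w)).
  by apply/funext => w; rewrite /V mulrC mulrBl.
rewrite [LHS]bounded_measurable_RintegralD; last 2 first.
- by apply: bounded_measurableB; exact: bounded_measurableM.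
- exact: bounded_measurableM.
rewrite [RHS]bounded_measurable_RintegralD; last 2 first.
- by apply: bounded_measurableB; exact: bounded_measurableM.
- exact: bounded_measurableM.
congr (_ + _).
rewrite !bounded_measurable_RintegralB; do ?exact: bounded_measurableM.
congr (_ - _).
apply: (markov_semigroup HX (K := F) (L := 1)) => //.
- exact: ltW.
- by move=> y; exact: bump_ge0.
- by move=> y; exact: bump_le1.
move=> B mB; apply: (path_filtration_stop (t0 := t0)).
  by rewrite -[X in measurable X]setTI; exact: (measurable_occupation mg g0).
by move=> w /=; rewrite /D occupation_stop.
Qed.

(** The semigroup quotient converges by definition of the generator, the quotient of [D] tends to
    [g (w t)], and the bare increment of [D] in the bracket vanishes. *)
Let W_cvg t (h_ : nat -> R) w : 0 <= t -> (forall n, 0 < h_ n) ->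
  h_ n @[n --> \oo] --> (0 : R) -> W t (h_ n) w @[n --> \oo] --> W0 t w.
Proof.
move=> t0 hp h0.
have [_ _ _ gen] := fG.
have cvgr q l : q h @[h --> (0:R)^'+] --> l -> q (h_ n) @[n --> \oo] --> (l : R).
  by move=> /cvg_at_rightP; apply; split.
have cvth (q : R -> R) : continuous q -> q (t + h_ n) @[n --> \oo] --> q t.
  move=> cq; have ct : t + h_ n @[n --> \oo] --> t.
    by rewrite -[X in _ --> X]addr0; apply: cvgD => //; exact: cvg_cst.
  exact: (@cvg_comp _ _ _ (fun n => t + h_ n) q _ _ _ ct (cq t)).
have cD := cvgr _ _ (occupation_right_derivative mg g0 gC (w := w) t0 cg).
have cD' : D (t + h_ n) w @[n --> \oo] --> D t w.
  exact: cvth (continuous_occupation mg g0 gC (w := w)).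
have cfw : f (w (t + h_ n)) @[n --> \oo] --> f (w t).
  apply: (cvth (f \o w)) => x.
  by apply: continuous_comp; [exact: path_continuous|exact: cf].
apply: cvgD.
  by apply: cvgM; [exact: cvg_cst|exact: (cvgr _ _ (gen _ (path_ge0 w t)))].
apply: cvgM; last exact: cD.
rewrite -[X in _ --> X]addr0; apply: cvgD.
  apply: cvgB; last exact: cvg_cst.
  apply: cvgM; first exact: cvg_cst.
  apply: cvg_maxr; first exact: cvg_cst.
  by apply: cvgB => //; exact: cvg_cst.
rewrite -[X in _ --> X](mulr0 N); apply: cvgM; first exact: cvg_cst.
by rewrite -(subrr (D t w)); apply: cvgB => //; exact: cvg_cst.
Qed.

(** By bounded convergence [E0 (W t h)] tends to the expectation of [W0 t], which is at most 0. The
    convergence theorem being sequential, a failure is first turned into a sequence [h_] tending to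
    0. *)
Let right_dini t e : 0 <= t -> 0 < e ->
  \forall h \near 0^'+, E0 (U (t + h)) <= E0 (U t) + e * h.
Proof.
move=> t0 e0; have [_ _ [K hK] _] := fG.
suff hW : \forall h \near 0^'+, E0 (W t h) <= e.
  near=> h.
  have h0 : 0 < h by near: h; exact: nbhs_right_gt.
  rewrite -lerBlDl /E0 -bounded_measurable_RintegralB//.
  apply: (@le_trans _ _ (E0 (V t h))).
    apply: le_bounded_measurable_Rintegral; [exact: bounded_measurableB|exact: bm_V (ltW h0)|].
    by move=> w; exact: U_le (ltW h0).
  rewrite E0_V// mulrC; apply: ler_wpM2r; first exact: ltW.
  by near: h; exact: hW.
apply: contrapT => nW.
have [h_ [hp hW]] : exists h_ : nat -> R, (forall n, 0 < h_ n < n.+1%:R^-1) /\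
    forall n, e < E0 (W t (h_ n)).
  have ex n : exists h, 0 < h < n.+1%:R^-1 /\ e < E0 (W t h).
    apply: contrapT => /forallNP nex; apply: nW; near=> h.
    have h0 : 0 < h by near: h; exact: nbhs_right_gt.
    rewrite leNgt; apply/negP => eW; apply: (nex h); split=> //.
    by rewrite h0/=; near: h; apply: nbhs_right_lt; rewrite invr_gt0.
  by have [h_ hh] := choice ex; exists h_; split => n; have [] := hh n.
have h_0 : h_ n @[n --> \oo] --> (0 : R).
  apply: (@squeeze_cvgr _ _ _ _ (fun=> 0) (fun n => n.+1%:R^-1)).
  - by apply: nearW => n; have /andP[h1 h2] := hp n; rewrite !ltW.
  - exact: cvg_cst.
  - exact: cvg_harmonic.
have h_gt0 n : 0 < h_ n by have /andP[] := hp n.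
have h_le1 n : h_ n <= 1.
  have /andP[_ /ltW h2] := hp n; apply: le_trans h2 _.
  by rewrite invf_le1 ?ler1n.
(* [K] is the uniform bound on semigroup quotients contained in [generator], [C] bounds the growth
   rate of [D], and [h_ n <= 1] turns that rate into a bound on the increment. *)
have bW n w : `|W t (h_ n) w| <= K + (N * (F + s) + 1 + N * C) * C.
  have /andP[d1 d2] := D_incr t w (ltW (h_gt0 n)).
  have p1 : `|phi (D t w)| <= 1 by rewrite ger0_norm ?bump_ge0 ?bump_le1.
  have p2 : `|N * Num.max 0 (f (w (t + h_ n)) - s)| <= N * (F + s).
    rewrite ger0_norm ?mulr_ge0 ?le_max ?lexx//; apply: ler_wpM2l => //.
    have h1 := f0 0; have h2 := fF 0; have h3 := fF (w (t + h_ n)).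
    by rewrite ge_max; apply/andP; split; move: s0; lra.
  have p3 : `|N * (D (t + h_ n) w - D t w)| <= N * C.
    rewrite ger0_norm ?mulr_ge0//; apply: ler_wpM2l => //; apply: le_trans d2 _.
    by rewrite -[leRHS]mulr1 ler_wpM2l.
  have p4 : `|(D (t + h_ n) w - D t w) / h_ n| <= C.
    by rewrite ger0_norm ?ler_pdivrMr// divr_ge0// ltW.
  have p5 := hK _ _ (h_gt0 n) (path_ge0 w t).
  apply: (le_trans (ler_normD _ _)); apply: lerD.
    by rewrite normrM -[K]mul1r ler_pM.
  rewrite normrM ler_pM//; apply: (le_trans (ler_normD _ _)); apply: lerD => //.
  by apply: (le_trans (ler_normB _ _)); exact: lerD.
have mW0 : measurable_fun setT (W0 t).
  apply: (@measurable_fun_cvg _ _ _ _ (fun n => W t (h_ n))).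
    by move=> n; exact: (bm_W t (ltW (h_gt0 n))).1.
  by move=> w _; exact: W_cvg.
have := bounded_cvg_Rintegral (P := P 0) (fun n => (bm_W t (ltW (h_gt0 n))).1) mW0 bW
  (aeW _ (fun w => W_cvg (w := w) t0 h_gt0 h_0)).
move=> cvgE.
have : e <= \int[P 0]_w W0 t w.
  by apply: (cvgr_to_ge cvgE); apply: nearW => n; exact: ltW.
have bW0 : bounded_measurable (W0 t).
  split=> //; exists (K + (N * (F + s) + 1 + N * C) * C) => w.
  have cW : `|W t (h_ n) w| @[n --> \oo] --> `|W0 t w|.
    exact: cvg_norm (W_cvg (w := w) t0 h_gt0 h_0).
  by apply: (cvgr_to_le cW); apply: nearW => n; exact: bW.
have : \int[P 0]_w W0 t w <= \int[P 0]_w 0.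
  exact: le_bounded_measurable_Rintegral.
by rewrite probability_Rintegral_cst => h1 /le_trans/(_ h1); rewrite leNgt e0.
Unshelve. all: by end_near.
Qed.

Let cU : continuous (fun t => E0 (U t)).
Proof.
move=> t; apply/(@cvg_nbhsP _ R^o) => u ut.
apply: (bounded_cvg_Rintegral (P := P 0) (K := F + (1 + N * s) * (c - a))).
- by move=> n; exact: (bm_U (u n)).1.
- exact: (bm_U t).1.
- move=> n w; have Ns0 : 0 <= 1 + N * s by rewrite addr_ge0// mulr_ge0.
  apply: (le_trans (ler_normB _ _)); apply: lerD.
    rewrite normrM -[leRHS]mulr1 ler_pM//; first by rewrite ger0_norm.
    by rewrite ger0_norm ?bump_ge0 ?bump_le1.
  by rewrite normrM ger0_norm// ler_wpM2l// ger0_norm ?clamp_ge0 ?clamp_le.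
- apply: aeW => w.
  have cD : D (u n) w @[n --> \oo] --> D t w.
    exact: (@cvg_comp _ _ _ u (D^~ w) _ _ _ ut (continuous_occupation mg g0 gC (w := w) (x := t))).
  apply: cvgB.
    apply: cvgM.
      have cfw : continuous (f \o w).
        by move=> x; apply: continuous_comp; [exact: path_continuous|exact: cf].
      exact: (@cvg_comp _ _ _ u (f \o w) _ _ _ ut (cfw t)).
    exact: (@cvg_comp _ _ _ (fun n => D (u n) w) phi _ _ _ cD (continuous_bump (x := D t w))).
  apply: cvgM; first exact: cvg_cst.
  exact: (@cvg_comp _ _ _ (fun n => D (u n) w) kappa _ _ _ cD (continuous_clamp (x := D t w))).
Qed.

(** Under [P 0] the path starts almost surely at 0, where [f] vanishes, and [kappa >= 0] enters [U]
    with a minus sign. *)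
Let E0_U0 : E0 (U 0) <= 0.
Proof.
have bf0 : bounded_measurable (fun w => f (w 0) * phi (D 0 w)) by exact: bounded_measurableM.
rewrite /E0 bounded_measurable_RintegralB//; last exact: bounded_measurableM.
have -> : \int[P 0]_w (f (w 0) * phi (D 0 w)) = 0.
  rewrite /Rintegral (ae_eq_integral (cst 0%E)) ?integral0//.
    by apply/measurable_EFinP; exact: bf0.1.
  have m0 : measurable [set w : cpath R | w 0 = 0].
    have := @measurable_eval R 0 measurableT [set 0] (measurable_set1 _).
    by rewrite setTI.
  exists (~` [set w : cpath R | w 0 = 0]); split.
  - exact: measurableC.
  - transitivity (1 - P 0%R [set w : cpath R | w 0%R = 0%R])%E; first exact: probability_setC.
    by rewrite (diff_start HX)// subee.
  - move=> w /= nw w0; apply: nw => _; by rewrite w0 f00 mul0r.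
rewrite sub0r oppr_le0; apply: Rintegral_ge0 => w _.
by rewrite mulr_ge0 ?clamp_ge0// addr_ge0// mulr_ge0.
Qed.

(** The Dini estimate keeps the expectation of [U] at most 0, and [kappa] never exceeds [c - a]. The
    resulting bound depends neither on [t] nor on the height of [g], which will blow up. *)
Lemma occupation_estimate t : 0 <= t ->
  \int[P 0]_w (f (w t) * bump a c N (occupation g t w)) <= (1 + N * s) * (c - a).
Proof.
move=> t0; have : E0 (U t) <= 0.
  exact: le_trans (right_Dini_le t0 cU right_dini) E0_U0.
rewrite /E0 bounded_measurable_RintegralB//; last 2 first.
- exact: bounded_measurableM.
- exact: bounded_measurableM.
rewrite subr_le0 => /le_trans; apply.
rewrite bounded_measurable_RintegralZ// ler_wpM2l ?addr_ge0 ?mulr_ge0//.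
rewrite -[leRHS](probability_Rintegral_cst (P 0)).
by apply: le_bounded_measurable_Rintegral => // w; exact: clamp_le.
Qed.

End occupation_estimate.

(** * Local time *)

(** With tolerances [k.+1%:R^-1], the Cauchy criterion consists of countably many conditions, which
    makes convergence sets measurable. *)
Lemma cvgn_cauchyE (R : realType) (u : nat -> R) :
  cvgn u <-> forall k : nat, exists n : nat, forall i j : nat,
    (n <= i)%N -> (n <= j)%N -> `|u i - u j| <= k.+1%:R^-1.
Proof.
split=> [/cvg_ex[l /cvgrPdist_le ul] k|hu].
  have k0 : 0 < k.+1%:R^-1 / 2 :> R by rewrite divr_gt0// invr_gt0.
  have [n _ hn] := ul _ k0; exists n => i j ni nj.
  have -> : u i - u j = (l - u j) - (l - u i) by ring.
  apply: (le_trans (ler_normB _ _)).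
  by rewrite [leRHS](splitr (k.+1%:R^-1)) lerD//; apply: hn.
apply/cauchy_cvgP/cauchy_exP => e e0.
have [k _ hk] := near_infty_natSinv_lt (PosNum e0).
have [n hn] := hu k; exists (u n); exists n => // i /= ni.
by rewrite /ball/=; apply: le_lt_trans (hn n i (leqnn n) ni) _; exact: (hk k (leqnn k)).
Qed.

Section local_time.
Variable R : realType.
Variables (P : R -> probability (cpath R) R) (S : cumulative R R)
  (m : {measure set R -> \bar R}).
Hypothesis HX : linear_diffusion P S m.
Implicit Types (s t x y d l : R) (w : cpath R) (n : nat).

Lemma speed_cdf_oo d : 0 <= d -> fine (m `]0, d[%classic) = speed_cdf m d.
Proof.
by move=> d0; rewrite (speed_cdfB HX false true (lexx 0) d0) (speed_cdf0 HX (lexx 0)) subr0.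
Qed.

Lemma speed_cdf_lt x y : 0 <= x -> x < y -> speed_cdf m x < speed_cdf m y.
Proof.
move=> x0 xy; rewrite -subr_gt0 -(speed_cdfB HX false true x0 (ltW xy)).
by apply: fine_gt0; rewrite (speed_gt0 HX)//= (speed_itv_fin HX).
Qed.

Lemma speed_cdf_gt0 d : 0 < d -> 0 < speed_cdf m d.
Proof. by move=> d0; rewrite -(speed_cdf0 HX (lexx 0)) speed_cdf_lt. Qed.

(* Convergence of the normalized occupation times along these levels implies
   convergence along all delta, as consecutive levels have asymptotically
   equivalent speed masses. *)
Lemma speed_level_exists : exists q : nat -> R, [/\ forall n, 0 < q n <= 1,
  forall n, speed_cdf m (q n) = speed_cdf m 1 / n.+1%:R,
  forall n, q n.+1 < q n & q n @[n --> \oo] --> (0 : R)].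
Proof.
have M1 : 0 < speed_cdf m 1 by exact: speed_cdf_gt0.
have ex n : exists x, 0 < x <= 1 /\ speed_cdf m x = speed_cdf m 1 / n.+1%:R.
  (* The level exists by continuity of [speed_cdf], and it is not 0 because its mass is positive. *)
  have [] := @IVT R (speed_cdf m) 0 1 (speed_cdf m 1 / n.+1%:R) ler01.
  - by apply: continuous_subspaceT => x; exact: (continuous_speed_cdf HX).
  - rewrite (speed_cdf0 HX (lexx 0)) (min_idPl (ltW M1)) (max_idPr (ltW M1)).
    apply/andP; split; first by rewrite divr_ge0// ltW.
    by rewrite ler_pdivrMr// ler_peMr ?ler1n// ltW.
  move=> x; rewrite in_itv/= => /andP[x0 x1] Mx; exists x; split => //.
  rewrite x1 andbT lt_neqAle x0 andbT; apply/eqP => x00.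
  move: Mx; rewrite -x00 (speed_cdf0 HX (lexx 0)) => /eqP.
  by rewrite eq_sym gt_eqF// divr_gt0.
have [q hq] := choice ex; exists q.
have q01 n : 0 < q n <= 1 by have [] := hq n.
have qE n : speed_cdf m (q n) = speed_cdf m 1 / n.+1%:R by have [] := hq n.
have qlt x n : 0 < x -> speed_cdf m (q n) < speed_cdf m x -> q n < x.
  move=> x0; rewrite ltNge [q n < x]ltNge; apply: contra => xq.
  exact: (le_speed_cdf HX).
split=> // [n|].
  have /andP[q0 _] := q01 n; apply: qlt => //; rewrite !qE ltr_pM2l//.
  by rewrite ltf_pV2 ?posrE// ltr_nat.
apply/cvgrPdist_lt => e e0; near=> n.
have /andP[q0 _] := q01 n; rewrite sub0r normrN gtr0_norm//.
apply: qlt => //; rewrite qE ltr_pdivrMr// mulrC -ltr_pdivrMr ?speed_cdf_gt0//.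
apply: (@lt_le_trans _ _ n%:R); last by rewrite ler_nat.
by near: n; exact: nbhs_infty_gtr.
Unshelve. all: by end_near.
Qed.

Variable q : nat -> R.
Hypotheses (q01 : forall n, 0 < q n <= 1)
  (qE : forall n, speed_cdf m (q n) = speed_cdf m 1 / n.+1%:R)
  (q_dec : forall n, q n.+1 < q n) (q_cvg0 : q n @[n --> \oo] --> (0 : R)).

Let q0 n : 0 < q n. Proof. by have /andP[] := q01 n. Qed.

Let le_q i j : (i <= j)%N -> q j <= q i.
Proof.
elim: j => [|j IH]; first by rewrite leqn0 => /eqP ->.
rewrite leq_eqVlt ltnS => /orP[/eqP -> //|/IH]; exact: le_trans (ltW (q_dec j)).
Qed.

Lemma speed_level_ratio n :
  speed_cdf m (q n) / speed_cdf m (q n.+1) = n.+2%:R / n.+1%:R.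
Proof.
have M1 := speed_cdf_gt0 ltr01; rewrite !qE; field.
by rewrite !nat1r; apply/and3P; split; rewrite ?gt_eqF.
Qed.

Let I d : R -> R := \1_(`[0, d[%classic).

Let mI d : measurable_fun setT (I d). Proof. exact: measurable_indic. Qed.
Let I0 d x : 0 <= I d x. Proof. by rewrite /I indicE. Qed.
Let I1 d x : I d x <= 1. Proof. by rewrite /I indicE; case: (_ \in _). Qed.

Lemma normalized_occupationE t w d : 0 <= d ->
  normalized_occupation m t w d = (speed_cdf m d)^-1 * occupation (I d) t w.
Proof. by move=> d0; rewrite /normalized_occupation speed_cdf_oo. Qed.

Lemma normalized_occupation_ge0 t w d : 0 <= normalized_occupation m t w d.
Proof.
rewrite /normalized_occupation mulr_ge0 ?invr_ge0 ?fine_ge0//.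
by apply: integral_ge0 => s _; rewrite lee_fin; exact: I0.
Qed.

Lemma measurable_normalized_occupation t d : 0 <= d ->
  measurable_fun setT (fun w => normalized_occupation m t w d).
Proof.
move=> d0.
have -> : (fun w => normalized_occupation m t w d) =
    (fun w => (speed_cdf m d)^-1 * occupation (I d) t w).
  by apply/funext => w; exact: normalized_occupationE.
by apply: measurable_funM => //; exact: measurable_occupation.
Qed.

Lemma normalized_occupation_stop t T (T0 : 0 <= T) w d : t <= T ->
  normalized_occupation m t (path_stop T0 w) d = normalized_occupation m t w d.
Proof.
by move=> tT; congr (_ * _); exact: (occupation_stop (I d) T0 w tT).
Qed.

Lemma le_normalized_occupation s t w d : s <= t ->
  normalized_occupation m s w d <= normalized_occupation m t w d.
Proof.
move=> st; rewrite ler_wpM2l ?invr_ge0 ?fine_ge0//.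
exact: (le_occupation (mI d) (I0 d) (I1 d) w st).
Qed.

Let N t w n : R := normalized_occupation m t w (q n).

Let le_I x y z : x <= y -> I x z <= I y z.
Proof.
move=> xy; rewrite /I !indicE !mem_setE !in_itv/=.
have [zx|zx] := ltP z x; first by rewrite (lt_le_trans zx xy).
by rewrite andbF ler0n.
Qed.

(** The occupation of [[0, d[] and its speed mass both increase with [d]; replacing the
    normalization by that of a neighbouring level costs the ratio of consecutive masses. *)
Lemma normalized_occupation_sandwich t w n d : q n.+1 <= d -> d <= q n ->
  N t w n.+1 * (n.+1%:R / n.+2%:R) <= normalized_occupation m t w d <=
  N t w n * (n.+2%:R / n.+1%:R).
Proof.
move=> qd dq; have d0 : 0 < d by exact: lt_le_trans qd.
have Md := speed_cdf_gt0 d0; have M1 := speed_cdf_gt0 (q0 n.+1).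
have M0 := speed_cdf_gt0 (q0 n).
rewrite /N !normalized_occupationE; do ?exact: ltW.
have r' : n.+1%:R / n.+2%:R = speed_cdf m (q n.+1) / speed_cdf m (q n).
  by rewrite -[LHS]invf_div -speed_level_ratio invf_div.
rewrite -(speed_level_ratio n) r'.
have o1 := occupation_le t w (mI (q n.+1)) (I0 _) (I1 _) (mI d) (I0 _) (I1 _)
  (fun z _ => le_I z qd).
have o2 := occupation_le t w (mI d) (I0 _) (I1 _) (mI (q n)) (I0 _) (I1 _)
  (fun z _ => le_I z dq).
have Mqd : speed_cdf m (q n.+1) <= speed_cdf m d by exact: (le_speed_cdf HX).
have Mdq : speed_cdf m d <= speed_cdf m (q n) by exact: (le_speed_cdf HX).
have o0 := occupation_ge0 (I0 (q n.+1)) t w.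
have o0' := occupation_ge0 (I0 d) t w.
have V x y : 0 < x -> x <= y -> y^-1 <= x^-1.
  by move=> x0 xy; rewrite lef_pV2 ?posrE//; exact: lt_le_trans xy.
have Vge0 x : 0 < x -> 0 <= x^-1 by move=> x0; rewrite invr_ge0 ltW.
have cancel x y z : 0 < x -> x^-1 * z * (x / y) = y^-1 * z.
  move=> /gt_eqF/negbT x0; by rewrite mulrACA mulVf// mul1r mulrC.
rewrite !cancel//; apply/andP; split; apply: ler_pM; do ?[exact: V|exact: Vge0|by []].
Qed.

Lemma normalized_occupation_cvg t w l :
  N t w n @[n --> \oo] --> l -> normalized_occupation m t w d @[d --> 0^'+] --> l.
Proof.
move=> Nl.
have r1 : n.+2%:R / n.+1%:R @[n --> \oo] --> (1 : R).
  rewrite [X in X @ _](_ : _ = (fun n => 1 + n.+1%:R^-1 : R)); last first.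
    by apply/funext => n; rewrite -[n.+2]addn1 natrD mulrDl mulfV ?gt_eqF// mul1r.
  by rewrite -[X in _ --> X]addr0; apply: cvgD; [exact: cvg_cst|exact: cvg_harmonic].
have r2 : n.+1%:R / n.+2%:R @[n --> \oo] --> (1 : R).
  rewrite [X in X @ _](_ : _ = (fun n => (n.+2%:R / n.+1%:R : R)^-1)); last first.
    by apply/funext => n; rewrite invf_div.
  by rewrite -[X in _ --> X]invr1; apply: cvgV => //; exact: oner_neq0.
have up : N t w n * (n.+2%:R / n.+1%:R) @[n --> \oo] --> l.
  by rewrite -[X in _ --> X]mulr1; exact: cvgM.
have lo : N t w n.+1 * (n.+1%:R / n.+2%:R) @[n --> \oo] --> l.
  rewrite -[X in _ --> X]mulr1; apply: cvgM => //.
  by rewrite (cvg_shiftS (N t w)).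
apply/cvgrPdist_le => e e0.
have /cvgrPdist_le/(_ e e0)[n1 _ hn1] := up.
have /cvgrPdist_le/(_ e e0)[n2 _ hn2] := lo.
near=> d.
have d0 : 0 < d by near: d; exact: nbhs_right_gt.
have dq : d < q (maxn n1 n2) by near: d; exact: nbhs_right_lt.
have ex : exists n, q n <= d.
  have /cvgrPdist_lt/(_ d d0)[n _ hn] := q_cvg0; exists n.
  by have := hn n (leqnn n); rewrite sub0r normrN gtr0_norm// => /ltW.
(* The least index whose level is at most [d] is a successor, because [d] is below [q 0]; its
   predecessor provides the upper level of the sandwich. *)
have [[|n] qn nmin] := ex_minnP ex.
  by have := lt_le_trans dq (le_q (leq0n _)); rewrite ltNge qn.
have nn : (maxn n1 n2 <= n)%N.
  rewrite leqNgt; apply/negP => nm.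
  by have := lt_le_trans dq (le_q nm); rewrite ltNge qn.
have qn' : d <= q n.
  by rewrite leNgt; apply/negP => /ltW/nmin; rewrite ltnn.
have /andP[s1 s2] := normalized_occupation_sandwich t w qn qn'.
have /ler_normlP[a1 a2] : `|l - N t w n * (n.+2%:R / n.+1%:R)| <= e.
  exact: hn1 n (leq_trans (leq_maxl _ _) nn).
have /ler_normlP[b1 b2] : `|l - N t w n.+1 * (n.+1%:R / n.+2%:R)| <= e.
  exact: hn2 n (leq_trans (leq_maxr _ _) nn).
rewrite ler_norml.
move: s1 s2 a1 a2 b1 b2.
set x := N t w n.+1 * _; set y := N t w n * _ => s1 s2 a1 a2 b1 b2.
by apply/andP; split; lra.
Unshelve. all: by end_near.
Qed.

Lemma normalized_occupation_cvgnP t w :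
  cvg (normalized_occupation m t w d @[d --> 0^'+]) <-> cvgn (N t w).
Proof.
split=> [/cvg_ex[l Nl]|/cvg_ex[l /normalized_occupation_cvg Nl]]; apply/cvg_ex; exists l => //.
by move/cvg_at_rightP : Nl; apply.
Qed.

Lemma local_time_cvg t w : cvg (normalized_occupation m t w d @[d --> 0^'+]) ->
  N t w n @[n --> \oo] --> local_time m t w.
Proof. by move=> cN; move/cvg_at_rightP : (cN); apply. Qed.

(** The limit over all delta is equivalent to that along the levels, for which the Cauchy criterion
    is a countable combination of events. *)
Lemma measurable_occupation_cvg t :
  measurable [set w | cvg (normalized_occupation m t w d @[d --> 0^'+])].
Proof.
rewrite [X in measurable X](_ : _ = \bigcap_k \bigcup_n \bigcap_i \bigcap_j
    [set w | (n <= i)%N -> (n <= j)%N -> `|N t w i - N t w j| <= k.+1%:R^-1]).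
  apply: bigcapT_measurable => k; apply: bigcupT_measurable => n.
  apply: bigcapT_measurable => i; apply: bigcapT_measurable => j.
  have [ni|ni] := boolP (n <= i)%N; last first.
    by rewrite [X in measurable X](_ : _ = setT)//; apply/seteqP; split.
  have [nj|nj] := boolP (n <= j)%N; last first.
    by rewrite [X in measurable X](_ : _ = setT)//; apply/seteqP; split.
  have mN k' : measurable_fun setT (fun w => N t w k').
    by apply: measurable_normalized_occupation; exact: ltW.
  have := measurable_funB (mN i) (mN j).
  move=> /(measurableT_comp (@normr_measurable R setT)).
  move=> /(_ measurableT _ (measurable_itv `]-oo, k.+1%:R^-1])).
  rewrite setTI; congr (measurable _); apply/seteqP; split => w /=.
    by rewrite in_itv.
  by rewrite in_itv/=; exact.
apply/seteqP; split => w /=.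
  move=> /normalized_occupation_cvgnP/cvgn_cauchyE Nc k _.
  by have [n hn] := Nc k; exists n => // i _ j _ /= ni nj; exact: hn.
move=> Nc; apply/normalized_occupation_cvgnP/cvgn_cauchyE => k.
by have [n _ hn] := Nc k Logic.I; exists n => i j ni nj; exact: hn.
Qed.

Lemma local_time_ge0 t w : 0 <= local_time m t w.
Proof.
have [cN|/dvgP nN] := pselect (cvg (normalized_occupation m t w d @[d --> 0^'+])).
  apply: limr_ge => //; apply: nearW => d; exact: normalized_occupation_ge0.
by rewrite /local_time nN.
Qed.

(** Off the convergence set [lim] takes the default value 0, which is also the limit of the terms
    multiplied by [\1_A]. *)
Lemma measurable_local_time_levels t : measurable_fun setT (local_time m t).
Proof.
pose A := [set w | cvg (normalized_occupation m t w d @[d --> 0^'+])].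
have mA : measurable A by exact: measurable_occupation_cvg.
suff mh n : measurable_fun setT (fun w => \1_A w * N t w n).
  apply: (measurable_fun_cvg mh) => w _.
  have [Aw|nAw] := pselect (A w).
    under eq_fun do rewrite indicE mem_set// mul1r.
    exact: local_time_cvg.
  under eq_fun do rewrite indicE memNset// mul0r.
  by rewrite /local_time (dvgP nAw); exact: cvg_cst.
apply: measurable_funM; first exact: measurable_indic.
by apply: measurable_normalized_occupation; exact: ltW.
Qed.

Lemma local_time_stop t T (T0 : 0 <= T) w : t <= T ->
  normalized_occupation m t (path_stop T0 w) = normalized_occupation m t w.
Proof. by move=> tT; apply/funext => d; exact: normalized_occupation_stop. Qed.

Lemma le_local_time s t w : s <= t ->
  cvg (normalized_occupation m s w d @[d --> 0^'+]) ->
  cvg (normalized_occupation m t w d @[d --> 0^'+]) ->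
  local_time m s w <= local_time m t w.
Proof.
move=> st cs ct; apply: (ler_cvg_to cs ct).
by apply: nearW => d; exact: le_normalized_occupation.
Qed.

End local_time.

(** Truncation at [k] makes bounded convergence available, and monotone convergence in [k] removes
    it. Bounds [r_ n] with a limit are the form in which the estimates arrive. *)
Lemma fatou_bound d (T : measurableType d) (R : realType)
    (P : {finite_measure set T -> \bar R}) (f_ : nat -> T -> R) (f : T -> R)
    (r_ : nat -> R) (r : R) :
  (forall n, measurable_fun setT (f_ n)) -> measurable_fun setT f ->
  (forall n w, 0 <= f_ n w) -> (forall w, 0 <= f w) ->
  {ae P, forall w, f_ n w @[n --> \oo] --> f w} ->
  (forall n, (\int[P]_w (f_ n w)%:E <= (r_ n)%:E)%E) ->
  r_ n @[n --> \oo] --> r ->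
  (\int[P]_w (f w)%:E <= r%:E)%E.
Proof.
move=> mf_ mf f_0 f0 f_f int_r r_r.
have mmin (g : T -> R) (k : nat) : measurable_fun setT g ->
    measurable_fun setT (fun w => Num.min (g w) k%:R).
  by move=> mg; apply: measurable_minr => //.
have min_norm (x : R) (k : nat) : 0 <= x -> `|Num.min x k%:R| <= k%:R.
  by move=> x0; rewrite ger0_norm ?ge_min ?lexx ?orbT// le_min x0 ler0n.
have trunc (k : nat) : (\int[P]_w (Num.min (f w) k%:R)%:E <= r%:E)%E.
  have bm : P.-integrable setT (EFin \o (fun w => Num.min (f w) k%:R)).
    by apply: (bounded_integrable _ (mmin _ k mf)) => w; exact: min_norm.
  rewrite -(fineK (integrable_fin_num measurableT bm)) lee_fin.
  have cvgm : \int[P]_w Num.min (f_ n w) k%:R @[n --> \oo] -->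
      \int[P]_w Num.min (f w) k%:R.
    apply: (bounded_cvg_Rintegral (K := k%:R)) => //.
    - by move=> n; exact: mmin.
    - exact: mmin.
    - by move=> n w; exact: min_norm.
    - by apply: filterS f_f => w fw; apply: cvg_minr => //; exact: cvg_cst.
  apply: (ler_cvg_to cvgm r_r); apply: nearW => n.
  rewrite -lee_fin fineK; last first.
    apply: (integrable_fin_num measurableT).
    by apply: (bounded_integrable _ (mmin _ k (mf_ n))) => w; exact: min_norm.
  apply: le_trans (int_r n); apply: ge0_le_integral => //.
  - by move=> w _; rewrite lee_fin le_min f_0 ler0n.
  - by apply/measurable_EFinP; exact: mmin.
  - exact/measurable_EFinP.
  - by move=> w _; rewrite lee_fin ge_min lexx.
have -> : (\int[P]_w (f w)%:E =
    \int[P]_w limn (fun k => (Num.min (f w) k%:R)%:E))%E.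
  apply: eq_integral => w _; apply/esym/cvg_lim => //.
  apply: cvg_near_cst.
  have [k _ hk] : \forall k \near \oo, f w <= k%:R by exact: nbhs_infty_ger.
  by exists k => // i /= /hk fi; rewrite (min_idPl fi).
rewrite monotone_convergence//.
- apply: lime_le; last exact: nearW.
  apply: ereal_nondecreasing_is_cvgn => i j ij; apply: ge0_le_integral => //.
  - by move=> w _; rewrite lee_fin le_min f0 ler0n.
  - by apply/measurable_EFinP; exact: mmin.
  - by apply/measurable_EFinP; exact: mmin.
  - by move=> w _; rewrite lee_fin le_min !ge_min lexx/= ler_nat ij orbT.
- by move=> k; apply/measurable_EFinP; exact: mmin.
- by move=> k w _; rewrite lee_fin le_min f0 ler0n.
- by move=> w _ i j ij; rewrite lee_fin le_min !ge_min lexx/= ler_nat ij orbT.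
Qed.

(** * From occupation times to local time: the bound on intervals *)

Section local_time_bound.
Variable R : realType.
Variables (P : R -> probability (cpath R) R) (S : cumulative R R)
  (m : {measure set R -> \bar R}).
Hypothesis HX : linear_diffusion P S m.
Hypothesis HL : local_time_exists P m.
Implicit Types (x y z t d l : R) (w : cpath R) (n : nat).

Variable q : nat -> R.
Hypotheses (q01 : forall n, 0 < q n <= 1)
  (qE : forall n, speed_cdf m (q n) = speed_cdf m 1 / n.+1%:R)
  (q_dec : forall n, q n.+1 < q n) (q_cvg0 : q n @[n --> \oo] --> (0 : R)).

Let q0 n : 0 < q n. Proof. by have /andP[] := q01 n. Qed.

(** On the half-line [tau n] lies between the indicators of [[0, q n.+1[] and [[0, q n[], so its
    occupation is comparable with those of two consecutive levels; functions in the image of the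
    generator are continuous, which excludes the indicators themselves. [theta n] is a tent on
    [[n + 1, n + 2]], which escapes to infinity. *)
Let tau n z : R := Num.min 1 (Num.max 0 ((q n - z) / (q n - q n.+1))).
Let theta n z : R := Num.max 0 (Num.min (z - n.+1%:R) (n.+2%:R - z)).

Let dq n : 0 < q n - q n.+1. Proof. by rewrite subr_gt0. Qed.

Let tau0 n z : 0 <= tau n z. Proof. by rewrite le_min ler01 le_max lexx. Qed.
Let tau1 n z : tau n z <= 1. Proof. by rewrite ge_min lexx. Qed.
Let tau_eq1 n z : z <= q n.+1 -> tau n z = 1.
Proof.
move=> zq; apply/min_idPl; rewrite le_max; apply/orP; right.
by rewrite ler_pdivlMr// mul1r lerD2l lerN2.
Qed.
Let tau_eq0 n z : q n <= z -> tau n z = 0.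
Proof.
move=> qz; rewrite /tau (max_idPl _) ?(min_idPr ler01)//.
by rewrite pmulr_lle0 ?invr_gt0// subr_le0.
Qed.
Let ctau n : continuous (tau n).
Proof.
move=> z; apply: cvg_minr; first exact: cvg_cst.
apply: cvg_maxr; first exact: cvg_cst.
apply: cvgM; last exact: cvg_cst.
by apply: cvgB; [exact: cvg_cst|exact: cvg_id].
Qed.

Let theta0 n z : 0 <= theta n z. Proof. by rewrite le_max lexx. Qed.
Let theta1 n z : theta n z <= 1.
Proof.
rewrite ge_max ler01/= ge_min; have [zn|nz] := leP z n.+2%:R.
  by apply/orP; left; rewrite lerBlDl natr1.
by apply/orP; right; rewrite lerBlDl; apply: (le_trans (ltW nz)); rewrite lerDl.
Qed.
Let theta_eq0 n z : z <= n.+1%:R \/ n.+2%:R <= z -> theta n z = 0.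
Proof. by move=> h; apply/max_idPl; rewrite ge_min !subr_le0; apply/orP. Qed.
Let ctheta n : continuous (theta n).
Proof.
move=> z; apply: cvg_maxr; first exact: cvg_cst.
by apply: cvg_minr; apply: cvgB; (exact: cvg_cst || exact: cvg_id).
Qed.

Let kt n := reflecting_deriv m (tau n) (q n).
Let kh n := reflecting_deriv m (theta n) n.+2%:R.

Let kt_bounds n : speed_cdf m (q n.+1) <= kt n <= speed_cdf m (q n).
Proof.
have tn z : `|tau n z| <= 1 by rewrite ger0_norm.
apply/andP; split; last first.
  have := speed_Rintegral_le HX (lexx 0) (ltW (q0 n))
    (continuous_measurable_fun (ctau (n := n))) (fun z _ => tn z).
  by rewrite (speed_cdf0 HX (lexx 0)) subr0 mul1r; exact: le_trans (ler_norm _).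
apply: (@le_trans _ _ (reflecting_deriv m (tau n) (q n.+1))); last first.
  exact: (le_reflecting_deriv HX (ctau (n := n)) (tau0 n) (tau1 n) (ltW (q0 _)) (ltW (q_dec n))).
have -> : reflecting_deriv m (tau n) (q n.+1) = \int[m]_(z in `]0, q n.+1]) 1.
  apply: eq_Rintegral => z; rewrite inE/= in_itv/= => /andP[_ zq].
  exact: tau_eq1.
rewrite Rintegral_cst// mul1r (speed_cdfB HX false false (lexx 0) (ltW (q0 _))).
by rewrite (speed_cdf0 HX (lexx 0)) subr0.
Qed.

Let kt_gt0 n : 0 < kt n.
Proof.
have /andP[h _] := kt_bounds n; apply: lt_le_trans h.
exact: (speed_cdf_gt0 HX).
Qed.

(** On []x, y]], in the rising half of the tent, [theta] is at least 1/4, and this interval has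
    positive speed measure. *)
Let kh_gt0 n : 0 < kh n.
Proof.
pose x : R := n.+1%:R + 4^-1; pose y : R := n.+1%:R + 2^-1.
have x0 : 0 <= x by rewrite addr_ge0.
have xy : x < y by rewrite ltrD2l; lra.
have y2 : y <= n.+2%:R by rewrite -[n.+2]addn1 natrD lerD2l; lra.
have tn z : `|theta n z| <= 1 by rewrite ger0_norm.
have h1 := reflecting_derivB HX (ctheta (n := n)) tn x0 (ltW xy).
have h2 := le_reflecting_deriv HX (ctheta (n := n)) (theta0 n) (theta1 n)
  (le_trans x0 (ltW xy)) y2.
have h3 := reflecting_deriv_ge0 m (theta0 n) x.
apply: lt_le_trans h2; rewrite -[ltRHS](subrK (reflecting_deriv m (theta n) x)).
apply: ltr_wpDr => //; rewrite h1.
have h4 : 4^-1 * (speed_cdf m y - speed_cdf m x) <= \int[m]_(z in `]x, y]) theta n z.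
  rewrite -(speed_cdfB HX false false x0 (ltW xy)) -Rintegral_cst//.
  apply: le_Rintegral => //.
  - by apply: (speed_integrable HX (K := 4^-1)) => // z _; rewrite ger0_norm.
  - apply: (speed_integrable HX (K := 1)) => //.
    exact: continuous_measurable_fun.
  move=> z /=; rewrite in_itv/= => /andP[xz zy].
  rewrite le_max le_min; apply/orP; right; move: xz zy.
  by rewrite /x /y -[n.+2]addn1 natrD => xz zy; apply/andP; split; lra.
apply: lt_le_trans h4; rewrite mulr_gt0// subr_gt0.
exact: (speed_cdf_lt HX).
Qed.

Let g n z := (kt n)^-1 * tau n z.
Let k n z := (kh n)^-1 * theta n z.
Let K n := (kt n)^-1 + (kh n)^-1.
Let f n := reflecting_sol S m (fun z => g n z - k n z).

Let VKt n : 0 <= (kt n)^-1. Proof. by rewrite invr_ge0 ltW. Qed.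
Let VKh n : 0 <= (kh n)^-1. Proof. by rewrite invr_ge0 ltW. Qed.

Let cg n : continuous (g n).
Proof. by move=> z; apply: cvgM; [exact: cvg_cst|exact: ctau]. Qed.
Let ck n : continuous (k n).
Proof. by move=> z; apply: cvgM; [exact: cvg_cst|exact: ctheta]. Qed.
Let g0 n z : 0 <= g n z. Proof. exact: mulr_ge0. Qed.
Let k0 n z : 0 <= k n z. Proof. exact: mulr_ge0. Qed.
Let gK n z : g n z <= K n.
Proof.
apply: (@le_trans _ _ (kt n)^-1); last by rewrite lerDl.
by rewrite -[leRHS]mulr1 ler_wpM2l.
Qed.
Let kK n z : k n z <= K n.
Proof.
apply: (@le_trans _ _ (kh n)^-1); last by rewrite lerDr.
by rewrite -[leRHS]mulr1 ler_wpM2l.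
Qed.
Let gd n z : q n < z -> g n z = 0.
Proof. by move=> qz; rewrite /g tau_eq0 ?mulr0// ltW. Qed.
Let kb n z : z <= n.+1%:R -> k n z = 0.
Proof. by move=> zn; rewrite /k theta_eq0 ?mulr0//; left. Qed.
Let kb' n z : n.+2%:R < z -> k n z = 0.
Proof. by move=> zn; rewrite /k theta_eq0 ?mulr0//; right; exact: ltW. Qed.

Let derivZ (u : R -> R) (c x : R) : 0 <= x -> continuous u -> (forall z, `|u z| <= 1) ->
  reflecting_deriv m (fun z => c * u z) x = c * reflecting_deriv m u x.
Proof.
move=> x0 cu u1; rewrite /reflecting_deriv RintegralZl//.
by apply: (speed_integrable HX (K := 1)) => //; exact: continuous_measurable_fun.
Qed.

Let g1 n : reflecting_deriv m (g n) (q n) = 1.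
Proof.
rewrite derivZ//; [by rewrite mulVf// gt_eqF//; exact: kt_gt0|exact: ltW|].
by move=> z; rewrite ger0_norm.
Qed.
Let k1 n : reflecting_deriv m (k n) n.+2%:R = 1.
Proof.
rewrite derivZ//; first by rewrite mulVf// gt_eqF//; exact: kh_gt0.
by move=> z; rewrite ger0_norm.
Qed.

Let qn n : q n <= n.+1%:R.
Proof. by have /andP[_ h] := q01 n; apply: (le_trans h); rewrite ler1n. Qed.
Let nn2 n : n.+1%:R <= n.+2%:R :> R. Proof. by rewrite ler_nat. Qed.

Let f_ge0 n z : 0 <= f n z.
Proof.
exact: (two_bumps_ge0 HX (cg (n := n)) (ck (n := n)) (g0 n) (gK n) (k0 n) (kK n)
  (ltW (q0 n)) (qn n) (nn2 n) (@gd n) (@kb n) (@kb' n) (g1 n) (k1 n)).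
Qed.

Let f_le n z : f n z <= S n.+2%:R.
Proof.
exact: (two_bumps_le HX (cg (n := n)) (ck (n := n)) (g0 n) (gK n) (k0 n) (kK n)
  (ltW (q0 n)) (qn n) (nn2 n) (@gd n) (@kb' n) (g1 n) (k1 n)).
Qed.

Let f_near n z : 0 <= z -> z <= n.+1%:R -> S z - S (q n) <= f n z <= S z.
Proof.
exact: (two_bumps_near HX (cg (n := n)) (ck (n := n)) (g0 n) (gK n) (k0 n) (kK n)
  (ltW (q0 n)) (@gd n) (@kb n) (g1 n)).
Qed.

Let f_generator n : generator P (f n) (fun z => g n z - k n z).
Proof.
exact: (two_bumps_generator HX (cg (n := n)) (ck (n := n)) (g0 n) (gK n) (k0 n) (kK n)
  (ltW (q0 n)) (qn n) (nn2 n) (@gd n) (@kb n) (@kb' n) (g1 n) (k1 n)).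
Qed.

Let cf n : continuous (f n).
Proof.
exact: (continuous_two_bumps HX (cg (n := n)) (ck (n := n)) (g0 n) (gK n) (k0 n) (kK n)).
Qed.

Let cS : continuous (S : R -> R).
Proof. by move=> x; exact: (Defs.scale_continuous HX). Qed.

(** Where [g n] is nonzero, [f n <= S z <= S (q n)]; so [S (q n)] is the level [s] of the
    supermartingale estimate, and it tends to 0. *)
Let f_estimate n a c N t : a <= c -> 0 <= N -> 0 <= t ->
  (\int[P 0]_w (f n (w t) * bump a c N (occupation (g n) t w))%:E <=
   ((1 + N * S (q n)) * (c - a))%:E)%E.
Proof.
move=> ac N0 t0.
have bm : bounded_measurable (fun w => f n (w t) * bump a c N (occupation (g n) t w)).
  have mf : measurable_fun setT (f n) by exact: continuous_measurable_fun.
  have mg : measurable_fun setT (g n) by exact: continuous_measurable_fun.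
  apply: bounded_measurableM; split.
  - by apply: measurableT_comp => //; exact: measurable_eval.
  - by exists (S n.+2%:R) => w; rewrite ger0_norm.
  - apply: measurableT_comp; last exact: (measurable_occupation mg (g0 n)).
    by apply: continuous_measurable_fun; exact: continuous_bump.
  - by exists 1 => w; rewrite ger0_norm ?bump_ge0 ?bump_le1.
rewrite -(fineK (integrable_fin_num measurableT (bounded_measurable_integrable (P 0) bm))).
rewrite lee_fin.
apply: (occupation_estimate HX (cf (n := n)) (f_ge0 n) (f_le n) _ (cg (n := n)) (g0 n)
  (gK n) (k0 n) (f_generator n)) => //.
- by rewrite /f reflecting_sol_le0.
- move=> z z0; have [zq|/ltW qz] := leP z (q n); last first.
    have [/eqP zq|zq] := boolP (z == q n); last first.
      by rewrite gd ?mul0r// lt_neqAle eq_sym zq.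
    by rewrite /g tau_eq0 ?mulr0 ?mul0r.
  have /andP[_ h] := f_near z0 (le_trans zq (qn n)).
  rewrite (max_idPl _) ?mulr0// subr_le0; apply: (le_trans h); exact: scale_le.
- exact: (scale_ge0 HX).
Qed.

Let f_cvg z : 0 <= z -> f n z @[n --> \oo] --> S z.
Proof.
move=> z0.
have Sq : S z - S (q n) @[n --> \oo] --> S z.
  rewrite -[X in _ --> X]subr0; apply: cvgB; first exact: cvg_cst.
  rewrite -(scale_le0 HX (lexx 0)).
  exact: (@cvg_comp _ _ _ q (S : R -> R) _ _ _ q_cvg0 (cS (x := 0))).
apply: (squeeze_cvgr _ Sq (cvg_cst (S z))).
have [n0 _ hn0] : \forall n \near \oo, z <= n%:R by exact: nbhs_infty_ger.
exists n0 => // n /= n0n; apply: f_near => //.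
by apply: (le_trans (hn0 n n0n)); rewrite ler_nat.
Qed.

(** The numerator is squeezed between the occupations of two consecutive levels and the
    normalization [kt n] between their speed masses, whose ratio tends to 1. *)
Let occupation_cvg t w : cvg (normalized_occupation m t w d @[d --> 0^'+]) ->
  occupation (g n) t w @[n --> \oo] --> local_time m t w.
Proof.
move=> cN; have NL := local_time_cvg q01 q_cvg0 cN.
have M0 n : 0 < speed_cdf m (q n) by exact: (speed_cdf_gt0 HX).
have r1 : n.+2%:R / n.+1%:R @[n --> \oo] --> (1 : R).
  rewrite [X in X @ _](_ : _ = (fun n => 1 + n.+1%:R^-1 : R)); last first.
    by apply/funext => n; rewrite -[n.+2]addn1 natrD mulrDl mulfV ?gt_eqF// mul1r.
  by rewrite -[X in _ --> X]addr0; apply: cvgD; [exact: cvg_cst|exact: cvg_harmonic].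
have r2 : n.+1%:R / n.+2%:R @[n --> \oo] --> (1 : R).
  rewrite [X in X @ _](_ : _ = (fun n => (n.+2%:R / n.+1%:R : R)^-1)); last first.
    by apply/funext => n; rewrite invf_div.
  by rewrite -[X in _ --> X]invr1; apply: cvgV => //; exact: oner_neq0.
have up : normalized_occupation m t w (q n) * (n.+2%:R / n.+1%:R) @[n --> \oo] --> local_time m t w.
  by rewrite -[X in _ --> X]mulr1; exact: cvgM.
have lo : normalized_occupation m t w (q n.+1) * (n.+1%:R / n.+2%:R)
    @[n --> \oo] --> local_time m t w.
  rewrite -[X in _ --> X]mulr1; apply: cvgM => //.
  by rewrite (cvg_shiftS (fun n => normalized_occupation m t w (q n))).
apply: (squeeze_cvgr _ lo up); apply: nearW => n.
have r' : n.+1%:R / n.+2%:R = speed_cdf m (q n.+1) / speed_cdf m (q n).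
  by rewrite -[LHS]invf_div -(speed_level_ratio HX qE) invf_div.
rewrite -(speed_level_ratio HX qE n) r'.
rewrite !(normalized_occupationE HX _ _ (ltW (q0 _))).
have mI d : measurable_fun setT (\1_(`[0, d[%classic) : R -> R) by exact: measurable_indic.
have I0 d (x : R) : 0 <= (\1_(`[0, d[%classic) x : R) by rewrite indicE.
have I1 d (x : R) : (\1_(`[0, d[%classic) x : R) <= 1 by rewrite indicE; case: (_ \in _).
have mt : measurable_fun setT (tau n) by exact: continuous_measurable_fun.
have o1 := occupation_le t w (mI (q n.+1)) (I0 _) (I1 _) mt (tau0 n) (tau1 n).
have o2 := occupation_le t w mt (tau0 n) (tau1 n) (mI (q n)) (I0 _) (I1 _).
have -> : occupation (g n) t w = (kt n)^-1 * occupation (tau n) t w.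
  rewrite /occupation RintegralZl//.
  by apply: (occupation_integrable mt (tau0 n) (tau1 n)); exact: lebesgue_itv_fin.
have {}o1 : occupation (\1_(`[0, q n.+1[%classic)) t w <= occupation (tau n) t w.
  apply: o1 => z z0; have [zq|qz] := ltP z (q n.+1).
    by rewrite tau_eq1; [exact: I1|exact: ltW].
  by rewrite indicE memNset//= in_itv/= z0 ltNge qz.
have {}o2 : occupation (tau n) t w <= occupation (\1_(`[0, q n[%classic)) t w.
  apply: o2 => z z0; have [zq|qz] := ltP z (q n).
    rewrite indicE mem_set/=; first exact: tau1.
    by rewrite in_itv/= z0 zq.
  by rewrite tau_eq0.
have /andP[k1' k2'] := kt_bounds n.
have o0 := occupation_ge0 (I0 (q n.+1)) t w.
have o0' := occupation_ge0 (tau0 n) t w.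
have V x y : 0 < x -> x <= y -> y^-1 <= x^-1.
  by move=> x0 xy; rewrite lef_pV2 ?posrE//; exact: lt_le_trans xy.
have Vge0 x : 0 < x -> 0 <= x^-1 by move=> x0; rewrite invr_ge0 ltW.
have cancel x y z : 0 < x -> x^-1 * z * (x / y) = y^-1 * z.
  by move=> /gt_eqF/negbT x0; rewrite mulrACA mulVf// mul1r mulrC.
rewrite !cancel//; apply/andP; split; apply: ler_pM; do ?[exact: V|exact: Vge0|by []].
Qed.

(** The slope [j] is fixed while [n] grows, so the error [j%:R * S (q n)] vanishes; continuity of
    [bump] transfers the almost sure convergence of the occupation times. *)
Lemma bump_local_time_bound a c (j : nat) t : a <= c -> 0 <= t ->
  (\int[P 0]_w (S (w t) * bump a c j%:R (local_time m t w))%:E <= (c - a)%:E)%E.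
Proof.
move=> ac t0.
have mL := measurable_local_time_levels HX q01 qE q_dec q_cvg0 t.
have mS : measurable_fun setT (S : R -> R) by exact: continuous_measurable_fun.
have mb : measurable_fun setT (bump a c j%:R).
  by apply: continuous_measurable_fun; exact: continuous_bump.
apply: (@fatou_bound _ _ _ (P 0)
  (fun n w => f n (w t) * bump a c j%:R (occupation (g n) t w)) _
  (fun n => (1 + j%:R * S (q n)) * (c - a))).
- move=> n.
  have mf : measurable_fun setT (f n) by exact: continuous_measurable_fun.
  have mg : measurable_fun setT (g n) by exact: continuous_measurable_fun.
  apply: measurable_funM; apply: measurableT_comp => //; first exact: measurable_eval.
  exact: (measurable_occupation mg (g0 n)).
- by apply: measurable_funM; apply: measurableT_comp => //; exact: measurable_eval.
- by move=> n w; rewrite mulr_ge0 ?bump_ge0.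
- by move=> w; rewrite mulr_ge0 ?bump_ge0 ?(scale_ge0 HX).
- apply: filterS (HL (lexx 0)) => w [cN _].
  apply: cvgM; first exact: f_cvg (path_ge0 w t).
  exact: (@cvg_comp _ _ _ _ (bump a c j%:R) _ _ _ (occupation_cvg (cN t t0))
    (continuous_bump (x := local_time m t w))).
- by move=> n; exact: f_estimate.
- rewrite -[X in _ --> X]mul1r; apply: cvgM; last exact: cvg_cst.
  rewrite -[X in _ --> X]addr0; apply: cvgD; first exact: cvg_cst.
  rewrite -(mulr0 j%:R); apply: cvgM; first exact: cvg_cst.
  rewrite -(scale_le0 HX (lexx 0)).
  exact: (@cvg_comp _ _ _ q (S : R -> R) _ _ _ q_cvg0 (cS (x := 0))).
Qed.

(** The slope now tends to infinity, which the bound no longer sees. The limit is the indicator of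
    an open interval, the shape used by the covers that define Lebesgue outer measure. *)
Lemma scale_local_time_itv a c t : a <= c -> 0 <= t ->
  (\int[P 0]_w ((S (w t))%:E * (\1_(`]a, c[%classic) (local_time m t w))%:E) <= (c - a)%:E)%E.
Proof.
move=> ac t0.
have mL := measurable_local_time_levels HX q01 qE q_dec q_cvg0 t.
have mS : measurable_fun setT (S : R -> R) by exact: continuous_measurable_fun.
rewrite (eq_integral (fun w => (S (w t) * \1_(`]a, c[%classic) (local_time m t w))%:E))//.
apply: (@fatou_bound _ _ _ (P 0)
  (fun j w => S (w t) * bump a c j%:R (local_time m t w)) _ (fun=> c - a)).
- move=> j; apply: measurable_funM; apply: measurableT_comp => //; first exact: measurable_eval.
  by apply: continuous_measurable_fun; exact: continuous_bump.
- apply: measurable_funM; apply: measurableT_comp => //; exact: measurable_eval.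
- by move=> n w; rewrite mulr_ge0 ?bump_ge0 ?(scale_ge0 HX).
- by move=> w; rewrite mulr_ge0 ?indicE// (scale_ge0 HX).
- by apply: aeW => w; apply: cvgM; [exact: cvg_cst|exact: bump_cvg].
- by move=> j; exact: bump_local_time_bound.
- exact: cvg_cst.
Qed.

End local_time_bound.

(** * From intervals to Borel functions *)

Section lebesgue_bound.
Variable R : realType.
Variables (P : R -> probability (cpath R) R) (S : cumulative R R)
  (m : {measure set R -> \bar R}).
Hypothesis HX : linear_diffusion P S m.
Hypothesis HL : local_time_exists P m.
Implicit Types (t : R) (w : cpath R).
Local Notation leb := (@lebesgue_measure R).

Lemma measurable_local_time t : measurable_fun setT (local_time m t).
Proof.
have [q [q01 qE q_dec q_cvg0]] := speed_level_exists HX.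
exact: (measurable_local_time_levels HX q01 qE q_dec q_cvg0).
Qed.

Let mS : measurable_fun setT (S : R -> R).
Proof.
have cS : continuous (S : R -> R) by move=> x; exact: (Defs.scale_continuous HX).
exact: continuous_measurable_fun.
Qed.

Lemma measurable_scale_path t : measurable_fun setT (fun w => S (w t)).
Proof. by apply: measurableT_comp => //; exact: measurable_eval. Qed.

(** The measure of [B] is the infimum of the total lengths of its covers by open intervals, and the
    left side is countably subadditive, so the interval bound sums over a cover. *)
Lemma scale_local_time_indic t (B : set R) : 0 <= t -> measurable B ->
  (\int[P 0]_w ((S (w t))%:E * (\1_B (local_time m t w))%:E) <= leb B)%E.
Proof.
move=> t0 mB; have [q [q01 qE q_dec q_cvg0]] := speed_level_exists HX.
have mL := measurable_local_time t.
have mSL (A : set R) : measurable A -> measurable_fun setT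
    (fun w => ((S (w t))%:E * (\1_A (local_time m t w))%:E)%E).
  move=> mA; apply: emeasurable_funM.
    by apply/measurable_EFinP; exact: measurable_scale_path.
  by apply/measurable_EFinP; apply: measurableT_comp => //.
have SL0 (A : set R) w : (0 <= (S (w t))%:E * (\1_A (local_time m t w))%:E)%E.
  by rewrite mule_ge0 ?lee_fin ?(scale_ge0 HX) ?indicE.
have -> : leb B = ereal_inf [set (\sum_(0 <= k <oo) wlength idfun (F k))%E | F in open_itv_cover B].
  by rewrite -outer_measure_open_itv_cover.
apply: le_ereal_inf_tmp => _ [F [Fitv BF] <-].
have mF k : measurable (F k).
  by have [[a b] ->] := Fitv k.
apply: (@le_trans _ _ (\int[P 0]_w \sum_(0 <= k <oo)
    ((S (w t))%:E * (\1_(F k) (local_time m t w))%:E))%E).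
  apply: ge0_le_integral => //; first exact: mSL.
    by apply: ge0_emeasurable_sum => *; [exact: SL0|exact: mSL].
  move=> w _; have [Bw|nBw] := pselect (B (local_time m t w)); last first.
    by rewrite [in leLHS]indicE memNset// mule0 nneseries_ge0// => k _ _; exact: SL0.
  have [k _ Fk] := BF _ Bw.
  rewrite [in leLHS]indicE mem_set// mule1.
  apply: (@le_trans _ _ (\sum_(0 <= i < k.+1) ((S (w t))%:E * (\1_(F i) (local_time m t w))%:E))%E).
    rewrite big_nat_recr//= indicE mem_set// mule1 leeDr// sume_ge0// => i _; exact: SL0.
  by apply: nneseries_lim_ge => *; exact: SL0.
rewrite integral_nneseries//; last by move=> k; exact: mSL.
apply: lee_nneseries => [k *|k *]; first by apply: integral_ge0 => w _; exact: SL0.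
have [[a b] ->] := Fitv k; rewrite /=.
have [ab|ba] := leP a b.
  rewrite (wlength_itv_bnd _ _ _ ab)/=.
  exact: (scale_local_time_itv HX HL q01 qE q_dec q_cvg0).
(* A cover may contain intervals with reversed endpoints; they are empty and contribute 0 to both
   sides. *)
rewrite set_itv_ge ?bnd_simp -?leNgt ?(ltW ba)// wlength0.
by rewrite integral0_eq// => w _; rewrite indic0 mule0.
Qed.

Lemma scale_local_time_le t (psi : R -> \bar R) : 0 <= t ->
  measurable_fun setT psi -> (forall x, (0 <= psi x)%E) ->
  (\int[P 0]_w ((S (w t))%:E * psi (local_time m t w)) <= \int[leb]_x psi x)%E.
Proof.
move=> t0 mpsi psi0.
rewrite -[X in (_ <= X)%E](_ :
  (\int[leb]_x ((cst (1 : R) x)%:E * psi (idfun x)) = _)%E); last first.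
  by apply: eq_integral => x _; rewrite mul1e.
apply: (@ge0_le_integral_indic_ext _ _ _ _ _ R R (P 0) leb (fun w => S (w t)) (cst 1)
  (local_time m t) idfun) => //.
- by move=> w; exact: (scale_ge0 HX).
- exact: measurable_scale_path.
- exact: measurable_local_time.
- exact: measurable_id.
move=> B mB; apply: (le_trans (scale_local_time_indic t0 mB)).
under eq_integral do rewrite mul1e.
by rewrite integral_indic// setIT.
Qed.

End lebesgue_bound.

(** The integral of a nonnegative function is a supremum over the simple functions below it, so
    monotonicity needs no measurability. This spares measurability proofs for the inverse local time
    and for the penalization weight. *)
Lemma ge0_le_integral_setT d (T : measurableType d) (R : realType)
    (mu : {measure set T -> \bar R}) (f g : T -> \bar R) :
  (forall x, (0 <= f x)%E) -> (forall x, (f x <= g x)%E) ->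
  (\int[mu]_x f x <= \int[mu]_x g x)%E.
Proof.
move=> f0 fg; have g0 x : (0 <= g x)%E by exact: le_trans (fg x).
rewrite !ge0_integralTE//; apply: ge_ereal_sup => _ [h hf <-].
by apply: ereal_sup_ubound; exists h => // x; exact: le_trans (hf x) (fg x).
Qed.

(** * Divergence of the local time under [P 0] *)

Section local_time_unbounded.
Variable R : realType.
Variables (P : R -> probability (cpath R) R) (S : cumulative R R)
  (m nu : {measure set R -> \bar R}) (p : R -> R -> R -> R).
Hypothesis HX : linear_diffusion P S m.
Hypothesis HL : local_time_exists P m.
Hypothesis Hnu : inverse_local_time_levy_measure P m p nu.

Let I (la : R) := (\int[nu]_(v in `]0%R, +oo[) (1 - expR (- la * v))%:E)%E.

Let I_integrand_ge0 (la v : R) : 0 <= la -> v \in `]0, +oo[ -> 0 <= 1 - expR (- la * v).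
Proof.
rewrite in_itv/= andbT => la0 v0; rewrite subr_ge0 -expR0 ler_expR mulNr oppr_le0.
by rewrite mulr_ge0// ltW.
Qed.

(** The Laplace transform at 1 is a positive exponential, whereas an infinite exponent would make it
    0. *)
Let I_fin : (I 1 < +oo)%E.
Proof.
have [_ /(_ 1 1 ltr01 ler01)[-> h]] := Hnu.
rewrite ltNge; apply/negP; rewrite leye_eq => /eqP Iy.
move: h; rewrite -/(I 1) Iy mul1e/= => /eqP.
by rewrite eqe gt_eqF// expR_gt0.
Qed.

Let mI (la : R) : measurable_fun setT (fun v => 1 - expR (- la * v)).
Proof.
by apply: measurable_funB => //; apply: measurableT_comp => //.
Qed.

Let I_cvg : I n.+1%:R^-1 @[n --> \oo] --> 0%E.
Proof.
have [] := @dominated_convergence _ _ _ nu `]0, +oo[%classic (measurable_itv _)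
  (fun n v => (1 - expR (- n.+1%:R^-1 * v))%:E) (cst 0%E)
  (fun v => (1 - expR (- 1 * v))%:E).
- by move=> n; apply/measurable_EFinP/measurable_funTS; exact: mI.
- exact: measurable_cst.
- apply: aeW => v _; apply: cvg_EFin; first exact: nearW.
  rewrite -[X in _ --> X](subrr 1); apply: cvgB; first exact: cvg_cst.
  have c0 : - n.+1%:R^-1 * v @[n --> \oo] --> (0 : R).
    rewrite -[X in _ --> X](mul0r v); apply: cvgM; last exact: cvg_cst.
    by rewrite -oppr0; apply: cvgN; exact: cvg_harmonic.
  rewrite -[X in _ --> X]expR0.
  exact: (@cvg_comp _ _ _ _ expR _ _ _ c0 (@continuous_expR R 0)).
- apply/integrableP; split.
    by apply/measurable_EFinP/measurable_funTS; exact: mI.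
  rewrite (eq_integral (fun v : R => (1 - expR (- 1 * v))%:E)); first exact: I_fin.
  by move=> v; rewrite inE => v0; rewrite gee0_abs// lee_fin I_integrand_ge0.
- apply: aeW => v n v0; rewrite gee0_abs ?lee_fin ?I_integrand_ge0//.
  rewrite lerD2l lerN2 ler_expR !mulNr lerN2.
  move: v0; rewrite /= in_itv/= andbT => v0.
  by rewrite ler_wpM2r ?(ltW v0)// invf_le1 ?ler1n.
by move=> _ _; rewrite integral0; exact.
Qed.

(** On a path that never exceeds [l] the inverse local time is infinite and its exponential is 0.
    The Laplace transform is thus at most the probability of exceeding [l], and it tends to 1 as
    lambda tends to 0. *)
Lemma local_time_unbounded (l : R) : 0 <= l ->
  P 0 (\bigcup_n [set w | l < local_time m n%:R w]) = 1%E.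
Proof.
move=> l0; set A := \bigcup_n _.
have mA : measurable A.
  apply: bigcupT_measurable => n.
  have := measurable_local_time HX n%:R measurableT (measurable_itv `]l, +oo[).
  by rewrite setTI; congr (measurable _); apply/seteqP; split => w /=; rewrite in_itv/= andbT.
have [N [mN N0 hN]] := HL (lexx 0).
have good w : ~ N w -> forall t, 0 <= t ->
    cvg (normalized_occupation m t w d @[d --> 0^'+]).
  by move=> nNw; apply: contrapT => h; apply: nNw; apply: hN => -[].
have bound (la : R) : 0 < la ->
    (expeR (- (l%:E * I la)) <= P 0%R A)%E.
  move=> la0; have [_ /(_ la l la0 l0)[_ <-]] := Hnu.
  (* The null set [N] is added because monotonicity in time, which moves a crossing of [l] to a
     later integer time, is available only outside it. *)
  apply: (@le_trans _ _ (\int[P 0%R]_w (\1_(A `|` N) w)%:E)%E); last first.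
    rewrite integral_indic ?setIT//; last exact: measurableU.
    by apply: le_trans (measureU2 _ _ _) _ => //; rewrite [X in (_ + X)%E]N0 adde0.
  apply: ge0_le_integral_setT => w; first exact: expeR_ge0.
  have tau0 : (0 <= inverse_local_time m l w)%E.
    by apply: le_ereal_inf_tmp => _ [s [s0 _] <-]; rewrite lee_fin.
  have [ANw|nANw] := pselect ((A `|` N) w).
    by rewrite indicE mem_set//= -expeR0 lee_expeR oppe_le0 mule_ge0// lee_fin ltW//.
  rewrite indicE memNset//=.
  suff -> : inverse_local_time m l w = +oo%E.
    by rewrite gt0_muley ?lte_fin.
  apply/eqP; rewrite -leye_eq; apply: le_ereal_inf_tmp => _ [s [s0 ls] <-].
  have nNw : ~ N w by move=> Nw; apply: nANw; right.
  exfalso; apply: nANw; left.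
  exists (Num.truncn s).+1; first exact: Logic.I.
  apply: (lt_le_trans ls).
  apply: le_local_time; [|exact: good|exact: good].
  by apply: ltW; exact: truncnS_gt.
apply/eqP; rewrite eq_le probability_le1//=.
have cvgE : expeR (- (l%:E * I n.+1%:R^-1)) @[n --> \oo] --> (1 : \bar R)%E.
  have /fine_cvgP[If fI] := I_cvg.
  have cE : (expR (- (l * fine (I n.+1%:R^-1))))%:E @[n --> \oo] --> (1 : \bar R)%E.
    apply: cvg_EFin; first exact: nearW.
    have c0 : - (l * fine (I n.+1%:R^-1)) @[n --> \oo] --> (0 : R).
      rewrite -oppr0 -[X in - X](mulr0 l); apply: cvgN.
      by apply: cvgM; [exact: cvg_cst|exact: fI].
    rewrite -[X in _ --> X]expR0.
    exact: (@cvg_comp _ _ _ _ expR _ _ _ c0 (@continuous_expR R 0)).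
  apply: cvg_trans cE; apply: near_eq_cvg; apply: filterS If => n fn.
  by rewrite -[in RHS](fineK fn).
apply: (@lee_cvg_to _ _ _ _ _ (fun=> P 0 A) _ _ cvgE (cvg_cst _)).
by apply: nearW => n; apply: bound.
Qed.

End local_time_unbounded.

(** * The law of the terminal local time *)

Section density.
Variable R : realType.
Variable f : R -> \bar R.
Hypotheses (mf : measurable_fun setT f) (f0 : forall x, (0 <= f x)%E).

(** The two proofs are arguments of the function so that the measure instance can be found from the
    term alone. *)
Definition density of measurable_fun setT f & (forall x, (0 <= f x)%E) :=
  fun A : set R => (\int[lebesgue_measure]_(x in A) f x)%E.

Local Notation nu := (density mf f0).

Let nu0 : nu set0 = 0%E. Proof. exact: integral_set0. Qed.
Let nu_ge0 A : (0 <= nu A)%E. Proof. exact: integral_ge0. Qed.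
Let nu_sigma_additive : semi_sigma_additive nu.
Proof.
move=> F mF tF mUF.
exact: (@semi_sigma_additive_nng_induced _ _ R lebesgue_measure f mf f0 F mF tF mUF).
Qed.

HB.instance Definition _ := isMeasure.Build _ _ _ nu nu0 nu_ge0 nu_sigma_additive.

End density.

Section penalization_density.
Variables (R : realType) (h : R -> R).
Local Notation leb := (@lebesgue_measure R).
Hypotheses (h_meas : measurable_fun (`[0, +oo[ : set R) h)
  (h_ge0 : forall x : R, 0 <= x -> 0 <= h x)
  (h_int : (\int[leb]_(x in `[0%R, +oo[) (h x)%:E = 1)%E).
Implicit Types x y : R.

(** [h] is constrained only on [[0, +oo[]; its values below 0 are discarded to obtain a density on
    the whole line. *)
Definition pos_density x : R := if 0 <= x then h x else 0.

Lemma pos_density_ge0 x : 0 <= pos_density x.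
Proof. by rewrite /pos_density; case: ifPn => // /h_ge0. Qed.

Lemma pos_densityE : pos_density = h \_ `[0, +oo[.
Proof.
apply/funext => x; rewrite /patch /pos_density.
by rewrite mem_setE in_itv/= andbT.
Qed.

Lemma measurable_pos_density : measurable_fun setT pos_density.
Proof. by rewrite pos_densityE; exact: (measurable_restrictT _ (measurable_itv _)).1 h_meas. Qed.

Lemma pos_density_integral (B : set R) :
  (\int[leb]_(x in B) (pos_density x)%:E = \int[leb]_(x in B `&` `[0%R, +oo[) (h x)%:E)%E.
Proof.
rewrite integral_mkcondr; apply: eq_integral => x _.
by rewrite pos_densityE restrict_EFin.
Qed.

Lemma pos_density_measurable_EFin : measurable_fun setT (EFin \o pos_density).
Proof. by apply/measurable_EFinP; exact: measurable_pos_density. Qed.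

Lemma pos_density_EFin_ge0 x : (0 <= (EFin \o pos_density) x)%E.
Proof. by rewrite lee_fin pos_density_ge0. Qed.

Definition terminal_law : {measure set R -> \bar R} :=
  density pos_density_measurable_EFin pos_density_EFin_ge0.

Lemma terminal_lawE B : terminal_law B = (\int[leb]_(x in B `&` `[0%R, +oo[) (h x)%:E)%E.
Proof. by rewrite -pos_density_integral. Qed.

Lemma terminal_lawT : terminal_law setT = 1%E.
Proof. by rewrite terminal_lawE setTI. Qed.

Lemma terminal_law_fin B : measurable B -> (terminal_law B < +oo)%E.
Proof.
move=> mB; apply: (@le_lt_trans _ _ (terminal_law setT)); last by rewrite terminal_lawT ltry.
by apply: le_measure; rewrite ?inE.
Qed.

(** Seen as a distribution function, the primitive inherits monotonicity, bounds and its limit from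
    properties of measures. *)
Lemma primitiveE x : primitive h x = fine (terminal_law `]-oo, x]%classic).
Proof.
rewrite terminal_lawE /primitive /Rintegral; congr (fine (integral _ _ _)).
apply/seteqP; split => y /=; rewrite !in_itv/=; first by move=> /andP[-> ->].
by move=> [yx /andP[-> _]].
Qed.

Lemma primitive_EFin x : (primitive h x)%:E = terminal_law `]-oo, x]%classic.
Proof. by rewrite primitiveE fineK// ge0_fin_numE// terminal_law_fin. Qed.

Lemma le_primitive x y : x <= y -> primitive h x <= primitive h y.
Proof.
move=> xy; rewrite -lee_fin !primitive_EFin; apply: le_measure; rewrite ?inE//.
by apply: subset_itv; rewrite bnd_simp.
Qed.

Lemma primitive_ge0 x : 0 <= primitive h x.
Proof. by rewrite -lee_fin primitive_EFin. Qed.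

Lemma primitive_le1 x : primitive h x <= 1.
Proof. by rewrite -lee_fin primitive_EFin -terminal_lawT; apply: le_measure; rewrite ?inE. Qed.

Lemma measurable_primitive : measurable_fun setT (primitive h).
Proof. by apply: nondecreasing_measurable => // x y; exact: le_primitive. Qed.

Lemma cvg_primitive : primitive h n%:R @[n --> \oo] --> (1 : R).
Proof.
have -> : (fun n => primitive h n%:R) = fine \o (fun n => terminal_law `]-oo, (n%:R : R)]%classic).
  by apply/funext => n /=; rewrite primitiveE.
apply: fine_cvg; rewrite -terminal_lawT.
have <- : (\bigcup_n `]-oo, (n%:R : R)]%classic) = setT.
  apply/seteqP; split => // x _; exists (Num.truncn x).+1 => //=.
  by rewrite in_itv/= ltW// truncnS_gt.
apply: nondecreasing_cvg_mu => [n||i j ij].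
- exact: measurable_itv.
- exact: bigcupT_measurable.
- apply/subsetPset; apply: subset_itv; rewrite bnd_simp//.
  by rewrite ler_nat.
Qed.

Lemma terminal_law_itvy x : terminal_law `]x, +oo[%classic = (1 - primitive h x)%:E.
Proof.
have -> : `]x, +oo[%classic = ~` `]-oo, x] :> set R by rewrite setCitvl.
rewrite EFinB primitive_EFin -terminal_lawT -setTD -[in RHS](setTI `]-oo, x]%classic).
apply: (measureD (mu := terminal_law)) => //.
by rewrite (le_lt_trans _ (terminal_law_fin measurableT)).
Qed.

End penalization_density.

Section penalized_law.
Variable R : realType.
Variables (P : R -> probability (cpath R) R) (S : cumulative R R)
  (m nu : {measure set R -> \bar R}) (p : R -> R -> R -> R).
Hypothesis HX : linear_diffusion P S m.
Hypothesis HL : local_time_exists P m.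
Variable h : R -> R.
Local Notation leb := (@lebesgue_measure R).
Hypotheses (h_meas : measurable_fun (`[0, +oo[ : set R) h)
  (h_ge0 : forall x : R, 0 <= x -> 0 <= h x)
  (h_int : (\int[leb]_(x in `[0%R, +oo[) (h x)%:E = 1)%E).
Implicit Types (x y t u : R) (w : cpath R) (B : set R).

Let mG u : measurable_fun setT (fun w => 1 - primitive h (local_time m u w)).
Proof.
apply: measurable_funB => //; apply: measurableT_comp.
  exact: measurable_primitive h_meas h_ge0 h_int.
exact: (measurable_local_time HX).
Qed.

Let G01 u w : 0 <= 1 - primitive h (local_time m u w) <= 1.
Proof.
by rewrite subr_ge0 (primitive_le1 h_meas h_ge0 h_int) lerBlDr lerDl
  (primitive_ge0 h_meas h_ge0 h_int).
Qed.

(** Almost surely the local time passes every integer at some integer time and stays above it by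
    monotonicity; as the primitive tends to 1 at infinity, bounded convergence concludes. *)
Lemma cvg_primitive_local_time :
  inverse_local_time_levy_measure P m p nu ->
  \int[P 0]_w (1 - primitive h (local_time m n%:R w)) @[n --> \oo] --> (0 : R).
Proof.
move=> Hnu.
rewrite -[X in _ --> X](probability_Rintegral_cst (P 0) 0).
apply: (@bounded_cvg_Rintegral _ _ _ _ _ _ 1) => //.
  by move=> n w; have /andP[? ?] := G01 n%:R w; rewrite ger0_norm.
have unb : {ae P 0, forall w, forall k : nat, exists n : nat, (k%:R : R) < local_time m n%:R w}.
  apply/ae_foralln => k.
  pose A := \bigcup_n [set w | (k%:R : R) < local_time m n%:R w].
  have mA : measurable A.
    apply: bigcupT_measurable => n.
    have := measurable_local_time HX n%:R measurableT (measurable_itv `]k%:R, +oo[).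
    by rewrite setTI; congr (measurable _); apply/seteqP; split => w /=; rewrite in_itv/= andbT.
  exists (~` A); split; first exact: measurableC.
    transitivity (1 - P 0 A)%E; first exact: probability_setC.
    by rewrite (local_time_unbounded HX HL Hnu (ler0n _ k)) subee.
  by apply: subsetC => w [n _ ?]; exists n.
apply: filterS2 unb (HL (lexx 0)) => w unb [good _].
have -> : (0 : R) = 1 - 1 by rewrite subrr.
apply: cvgB; first exact: cvg_cst.
apply/cvgrPdist_le => e e0.
have /cvgrPdist_le/(_ e e0)[k _ hk] := cvg_primitive h_meas h_ge0 h_int.
have [n0 kn0] := unb k; exists n0 => // n /= n0n.
have := hk k (leqnn k).
rewrite !ger0_norm ?subr_ge0 ?(primitive_le1 h_meas h_ge0 h_int)//.
apply: le_trans; rewrite lerD2l lerN2; apply: (le_primitive h_meas h_ge0 h_int).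
apply: (le_trans (ltW kn0)); apply: le_local_time; [|exact: good|exact: good].
by rewrite ler_nat.
Qed.

Lemma path_filtration_local_time u B : 0 <= u -> measurable B ->
  path_filtration u [set w | B (local_time m u w)].
Proof.
move=> u0 mB; apply: (path_filtration_stop (t0 := u0)).
  have := measurable_local_time HX u measurableT mB; by rewrite setTI.
by move=> w /=; rewrite /local_time local_time_stop.
Qed.

Lemma penalized_law_le (Q : probability (cpath R) R) u B :
  penalized_measure P S m h Q -> 0 <= u -> measurable B ->
  (Q [set w | B (local_time m u w)] <= terminal_law h_meas h_ge0 B +
    (\int[P 0%R]_w (1 - primitive h (local_time m u w)))%:E)%E.
Proof.
move=> HQ u0 mB; rewrite (HQ _ _ u0 (path_filtration_local_time u0 mB)).
rewrite expectation.unlock.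
pose f w : \bar R := ((S (w u))%:E *
  ((\1_B (local_time m u w) * pos_density h (local_time m u w))%:E))%E.
pose g w : \bar R := (1 - primitive h (local_time m u w))%:E.
have L0 := local_time_ge0 m u.
have mL := measurable_local_time HX u.
have mpsi : measurable_fun setT (fun x => (\1_B x * pos_density h x)%:E).
  apply/measurable_EFinP; apply: measurable_funM; first exact: measurable_indic.
  exact: measurable_pos_density.
have psi0 x : (0 <= (\1_B x * pos_density h x)%:E)%E.
  by rewrite lee_fin mulr_ge0 ?pos_density_ge0.
have mf : measurable_fun setT f.
  apply: emeasurable_funM; first by apply/measurable_EFinP; exact: (measurable_scale_path HX).
  exact: (measurableT_comp mpsi mL).
have f0 w : (0 <= f w)%E by rewrite mule_ge0 ?lee_fin ?(scale_ge0 HX)//; exact: psi0.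
have g0 w : (0 <= g w)%E by rewrite lee_fin; have /andP[] := G01 u w.
have mg : measurable_fun setT g by apply/measurable_EFinP; exact: mG.
apply: (@le_trans _ _ (\int[P 0%R]_w (f w + g w))%E).
  apply: ge0_le_integral_setT => w.
    rewrite lee_fin mulr_ge0// /penalization -addrA addr_ge0//.
      by rewrite mulr_ge0 ?(scale_ge0 HX)// h_ge0.
    by have /andP[] := G01 u w.
  (* Local time is nonnegative, so [pos_density] agrees with [h] there; in the second summand the
     indicator is bounded by 1. *)
  rewrite /f /g -EFinM -EFinD lee_fin /penalization /pos_density L0 -addrA mulrDr.
  apply: lerD; first by rewrite mulrCA.
  have /andP[G0 _] := G01 u w.
  by rewrite ler_piMl// indicE lern1 leq_b1.
rewrite ge0_integralD//; apply: leeD.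
  apply: (le_trans (scale_local_time_le HX HL u0 mpsi psi0)).
  rewrite /terminal_law /density/= [leRHS]integral_mkcond.
  apply: ge0_le_integral_setT => [x|x]; first exact: psi0.
  by rewrite /patch indicE; case: ifP => _; rewrite ?mul1r ?mul0r.
rewrite /Rintegral fineK// ge0_fin_numE; last by apply: integral_ge0 => w _; exact: g0.
apply: (@le_lt_trans _ _ (\int[P 0%R]_w 1)%E); last first.
  by rewrite integral_cst// mul1e; exact: le_lt_trans (probability_le1 _ measurableT) (ltry _).
apply: ge0_le_integral_setT => // w; rewrite lee_fin.
by have /andP[] := G01 u w.
Qed.

End penalized_law.

(** Compactness of [[0, T]] gives uniformity in [x], while [y] may lie beyond [T]. The modulus has
    the form of a mesh [T / j.+1%:R] to fit the grids below. *)
Lemma within_continuous_modulus (R : realType) (f : R -> R) (T e : R) :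
  {within `[0, +oo[, continuous f} -> 0 < e ->
  exists j : nat, forall x y, 0 <= x <= T -> 0 <= y ->
    `|x - y| <= T / j.+1%:R -> `|f x - f y| <= e.
Proof.
move=> cf e0.
have e20 : 0 < e / 2 by rewrite divr_gt0.
have := (near_covering_withinP `[0, T]).2
  ((compact_near_coveringP _).1 (segment_compact (a := 0) (b := T))).
move=> /(_ nat \oo (fun j x => forall y, 0 <= y -> `|x - y| <= T / j.+1%:R -> `|f x - f y| <= e) _).
case.
  move=> x; rewrite /= in_itv/= => /andP[x0 xT].
  have T0 : 0 <= T by exact: le_trans xT.
  have x0y : `[0, +oo[%classic (x : R) by rewrite /= in_itv/= x0.
  have /subspace_continuousP/(_ x x0y)/cvgrPdist_le/(_ _ e20) := cf.
  rewrite near_withinE => /nbhs_ballP[d /= d0 hd].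
  have d20 : 0 < d / 2 by rewrite divr_gt0.
  have hd' y : 0 <= y -> `|x - y| < d -> `|f x - f y| <= e / 2.
    by move=> y0 xy; apply: hd => //; rewrite /= in_itv/= y0.
  have [k hk] : exists k : nat, T / k.+1%:R < d / 2.
    exists (Num.truncn (T / (d / 2))).
    by rewrite ltr_pdivrMr// mulrC -ltr_pdivrMr// truncnS_gt.
  exists (ball x (d / 2), [set j | (k <= j)%N]) => /=.
    by split; [exact: nbhsx_ballx|exists k].
  move=> [x' j] /= [xx' kj]; rewrite in_itv/= => /andP[x'0 x'T] y y0 x'y.
  have Tj : T / j.+1%:R <= T / k.+1%:R.
    by rewrite ler_wpM2l// lef_pV2 ?posrE// ler_nat.
  have A1 : `|x - x'| < d / 2 by exact: xx'.
  have A2 : `|x' - y| < d / 2 by exact: le_lt_trans x'y (le_lt_trans Tj hk).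
  have B1 : `|f x - f x'| <= e / 2.
    by apply: hd' => //; apply: (lt_trans A1); lra.
  have B2 : `|f x - f y| <= e / 2.
    apply: hd' => //; have -> : x - y = (x - x') + (x' - y) by ring.
    by apply: (le_lt_trans (ler_normD _ _)); lra.
  have -> : f x' - f y = (f x - f y) - (f x - f x') by ring.
  by apply: (le_trans (ler_normB _ _)); lra.
move=> j _ hj; exists j => x y xT y0; apply: (hj j (leqnn j)) => //.
Qed.

(** * Existence of the local time as an event of the filtration *)

Section good_paths.
Variable R : realType.
Variables (P : R -> probability (cpath R) R) (S : cumulative R R)
  (m : {measure set R -> \bar R}).
Hypothesis HX : linear_diffusion P S m.
Hypothesis HL : local_time_exists P m.
Implicit Types (s t x y u T : R) (w : cpath R).

Local Notation good t w := (cvg (normalized_occupation m t w d @[d --> 0^'+])).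

Let grid T (j i : nat) : R := T * (i%:R / j.+1%:R).

(* By monotonicity in t of the normalized occupation times, the limits exist for
   all t in [0, T] as soon as they do on a countable set on which they have small
   increments: this condition is an event of the filtration at time T. *)
Definition local_time_grid T w :=
  (forall j i : nat, (i <= j.+1)%N -> good (grid T j i) w) /\
  (forall k : nat, exists j : nat, forall i : nat, (i <= j)%N ->
    local_time m (grid T j i.+1) w - local_time m (grid T j i) w <= k.+1%:R^-1).

Let grid_ge0 T j i : 0 <= T -> 0 <= grid T j i.
Proof. by move=> T0; rewrite mulr_ge0. Qed.

Let grid_le T j i : 0 <= T -> (i <= j.+1)%N -> grid T j i <= T.
Proof. by move=> T0 ij; rewrite ler_piMr// ler_pdivrMr// mul1r ler_nat. Qed.

Lemma measurable_local_time_grid T : measurable [set w | local_time_grid T w].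
Proof.
have [q [q01 qE q_dec q_cvg0]] := speed_level_exists HX.
have mL := measurable_local_time HX.
rewrite [X in measurable X](_ : _ =
  (\bigcap_j \bigcap_(i in [set i | (i <= j.+1)%N]) [set w | good (grid T j i) w]) `&`
  (\bigcap_k \bigcup_j \bigcap_(i in [set i | (i <= j)%N])
    [set w | local_time m (grid T j i.+1) w - local_time m (grid T j i) w <= k.+1%:R^-1])).
  apply: measurableI.
    apply: bigcapT_measurable => j; apply: bigcap_measurableType => i _.
    exact: (measurable_occupation_cvg HX q01 qE q_dec q_cvg0).
  apply: bigcapT_measurable => k; apply: bigcupT_measurable => j.
  apply: bigcap_measurableType => i _.
  have := measurable_funB (mL (grid T j i.+1)) (mL (grid T j i)) measurableT
    (measurable_itv `]-oo, k.+1%:R^-1]).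
  by rewrite setTI; congr (measurable _); apply/seteqP; split => w /=; rewrite in_itv.
apply/seteqP; split => w /=.
  move=> [g1 g2]; split; first by move=> j _ i /= ij; exact: g1.
  by move=> k _; have [j hj] := g2 k; exists j => // i /= ij; exact: hj.
move=> [g1 g2]; split; first by move=> j i ij; exact: (g1 j).
by move=> k; have [j _ hj] := g2 k Logic.I; exists j => i ij; exact: hj.
Qed.

Lemma path_filtration_local_time_grid T : 0 <= T ->
  path_filtration T [set w | local_time_grid T w].
Proof.
move=> T0; apply: (path_filtration_stop (t0 := T0)); first exact: measurable_local_time_grid.
have sub w w' : (forall s, s <= T -> normalized_occupation m s w = normalized_occupation m s w') ->
    local_time_grid T w -> local_time_grid T w'.
  move=> ww' [g1 g2]; split.
    by move=> j i ij; rewrite -ww' ?grid_le//; exact: g1.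
  move=> k; have [j hj] := g2 k; exists j => i ij; have := hj i ij.
  rewrite /local_time -!ww' ?grid_le//; exact: leqW.
by move=> w /=; split; apply: sub => s sT; rewrite local_time_stop.
Qed.

(** Almost every path under [P 0] has a continuous local time, and uniform continuity on [[0, T]]
    provides grids with small increments. *)
Lemma local_time_grid_ae T : 0 <= T -> {ae P 0, forall w, local_time_grid T w}.
Proof.
move=> T0; apply: filterS (HL (lexx 0)) => w [g cL]; split.
  by move=> j i _; apply: g; exact: grid_ge0.
move=> k; have k0 : 0 < k.+1%:R^-1 :> R by rewrite invr_gt0.
have [j hj] := within_continuous_modulus T cL k0; exists j => i ij.
apply: (le_trans (ler_norm _)); rewrite distrC; apply: hj.
- by rewrite grid_ge0// grid_le// leqW.
- exact: grid_ge0.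
rewrite /grid -mulrBr -mulrBl -natr1 opprD addNKr mulN1r mulrN normrN.
by rewrite ger0_norm// mulr_ge0.
Qed.

(** The normalized occupation at [t] is trapped between those at the neighbouring grid points, which
    converge to values close to each other; this is a Cauchy condition. *)
Lemma local_time_grid_cvg T w t : local_time_grid T w -> 0 <= t -> t <= T -> good t w.
Proof.
move=> [g1 g2] t0; rewrite le_eqVlt => /orP[/eqP ->|tT].
  by have := g1 0 1 isT; rewrite /grid divr1 mulr1.
have T0 : 0 < T by exact: le_lt_trans tT.
apply/cauchy_cvgP/cauchy_exP => e e0.
have [k' _ hk'] : \forall k' \near \oo, k'.+1%:R^-1 < e / 2.
  by have e20 : 0 < e / 2 by [rewrite divr_gt0]; exact: (near_infty_natSinv_lt (PosNum e20)).
have {}ke : k'.+1%:R^-1 < e / 2 by exact: (hk' k' (leqnn k')).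
have [j hj] := g2 k'.
pose i := Num.truncn (t / T * j.+1%:R).
have x0 : 0 <= t / T * j.+1%:R by rewrite mulr_ge0// divr_ge0// ltW.
have /andP[i1 i2] := truncn_itv x0.
have ij : (i <= j)%N.
  rewrite -ltnS -(ltr_nat R); apply: (le_lt_trans i1).
  by rewrite gtr_pMl// ltr_pdivrMr// mul1r.
have ti : grid T j i <= t.
  by rewrite /grid mulrC -ler_pdivlMr// ler_pdivrMr.
have ti1 : t <= grid T j i.+1.
  by rewrite /grid mulrC -ler_pdivrMr// ler_pdivlMr// ltW.
exists (local_time m (grid T j i) w).
have e20 : 0 < e / 2 by rewrite divr_gt0.
have /cvgrPdist_lt/(_ _ e20) c1 := g1 j i (leqW ij).
(* The tolerance at the right grid point is reduced by the bound on the increment across one mesh,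
   so that both estimates are relative to the value at the left grid point. *)
have /cvgrPdist_lt/(_ (e / 2 - k'.+1%:R^-1)) := g1 j i.+1 ij.
rewrite subr_gt0 => /(_ ke) c2.
apply: filterS2 c1 c2 => d.
rewrite /= /ball/= !ltr_distl => /andP[_ a1] /andP[b2 _].
have := hj i ij; have := le_normalized_occupation m w d ti.
have := le_normalized_occupation m w d ti1.
move: a1 b2; rewrite -!/(local_time _ _ _).
move: (normalized_occupation _ _ _ _) (normalized_occupation _ _ _ _)
  (normalized_occupation _ _ _ _) (local_time _ _ _) (local_time _ _ _) (k'.+1%:R^-1).
by clear => *; apply/andP; split; lra.
Qed.

End good_paths.

Section terminal_local_time.
Variable R : realType.
Variables (P : R -> probability (cpath R) R) (S : cumulative R R)
  (m nu : {measure set R -> \bar R}) (p : R -> R -> R -> R).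
Hypothesis HX : linear_diffusion P S m.
Hypothesis HL : local_time_exists P m.
Hypothesis Hnu : inverse_local_time_levy_measure P m p nu.
Variable h : R -> R.
Local Notation leb := (@lebesgue_measure R).
Hypotheses (h_meas : measurable_fun (`[0, +oo[ : set R) h)
  (h_ge0 : forall x : R, 0 <= x -> 0 <= h x)
  (h_int : (\int[leb]_(x in `[0%R, +oo[) (h x)%:E = 1)%E).
Variable Q : probability (cpath R) R.
Hypothesis HQ : penalized_measure P S m h Q.
Implicit Types (x y t u l : R) (w : cpath R) (B : set R) (A : set (cpath R)).
Local Notation law := (terminal_law h_meas h_ge0).

Lemma penalized_law_cvg B : measurable B ->
  Q [set w | B (local_time m n%:R w)] @[n --> \oo] --> law B.
Proof.
move=> mB.
pose e n : R := \int[P 0]_w (1 - primitive h (local_time m n%:R w)).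
have e0 : e n @[n --> \oo] --> (0 : R).
  exact: (cvg_primitive_local_time HX HL h_meas h_ge0 h_int Hnu).
pose A n := [set w | B (local_time m n%:R w)].
have mA n : measurable (A n).
  have := measurable_local_time HX n%:R measurableT mB; by rewrite setTI.
have QA n : Q (A n) = (fine (Q (A n)))%:E by rewrite fineK// fin_num_measure.
have lawB : law B = (fine (law B))%:E.
  by rewrite fineK// ge0_fin_numE// (terminal_law_fin h_meas h_ge0 h_int).
have up n : fine (Q (A n)) <= fine (law B) + e n.
  rewrite -lee_fin EFinD -QA -lawB.
  exact: (penalized_law_le HX HL h_meas h_ge0 h_int HQ (ler0n _ n) mB).
have lo n : fine (law B) - e n <= fine (Q (A n)).
  have mCB : measurable (~` B) by exact: measurableC.
  have := penalized_law_le HX HL h_meas h_ge0 h_int HQ (ler0n _ n) mCB.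
  have -> : [set w | (~` B) (local_time m n%:R w)] = ~` A n by [].
  have -> : Q (~` A n) = (1 - Q (A n))%E by exact: probability_setC.
  have -> : law (~` B) = (1 - law B)%E.
    rewrite -(terminal_lawT h_meas h_ge0 h_int) -setTD -[in RHS](setTI B).
    by apply: (measureD (mu := law)) => //; rewrite (terminal_law_fin h_meas h_ge0 h_int).
  rewrite QA lawB -/(e n) -!EFinB -EFinD lee_fin; lra.
rewrite [X in X @ _](_ : _ = EFin \o (fun n => fine (Q (A n)))); last exact/funext.
rewrite lawB; apply: cvg_EFin; first exact: nearW.
apply: (squeeze_cvgr (f := fun n => fine (law B) - e n) (h := fun n => fine (law B) + e n)).
- by apply: nearW => n; rewrite up lo.
- by rewrite -[X in _ --> X]subr0; apply: cvgB => //; exact: cvg_cst.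
- by rewrite -[X in _ --> X]addr0; apply: cvgD => //; exact: cvg_cst.
Qed.

Lemma penalized_null u A : 0 <= u -> path_filtration u A -> P 0 A = 0%E -> Q A = 0%E.
Proof.
move=> u0 FA PA0; rewrite (HQ u0 FA) expectation.unlock.
have mA := path_filtration_measurable FA.
apply/eqP; rewrite eq_le; apply/andP; split.
  (* Comparison with [+oo * \1_A], whose integral is [+oo] times 0, that is 0, dispenses with any
     integrability or measurability of the weight. *)
  apply: (@le_trans _ _ (\int[P 0%R]_w (+oo * (\1_A w)%:E))%E).
    apply: ge0_le_integral_setT => w; rewrite indicE; have [Aw|nAw] := boolP (w \in A).
    + rewrite mul1r lee_fin /penalization -addrA addr_ge0//.
        by rewrite mulr_ge0 ?(scale_ge0 HX)// h_ge0// local_time_ge0.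
      by rewrite subr_ge0 (primitive_le1 h_meas h_ge0 h_int).
    + by rewrite mul0r.
    + by rewrite mul1r mule1 leey.
    + by rewrite mul0r mule0.
  rewrite ge0_integralZl//; last by apply/measurable_EFinP; exact: measurable_indic.
  by rewrite integral_indic// setIT [X in (_ * X)%E]PA0 mule0.
apply: integral_ge0 => w _; rewrite indicE; have [Aw|nAw] := boolP (w \in A).
  rewrite mul1r lee_fin /penalization -addrA addr_ge0//.
    by rewrite mulr_ge0 ?(scale_ge0 HX)// h_ge0// local_time_ge0.
  by rewrite subr_ge0 (primitive_le1 h_meas h_ge0 h_int).
by rewrite mul0r.
Qed.

(** A countable intersection of events, each decided at a finite time, so that absolute continuity
    on the filtration makes it a full event for [Q]. *)
Let G := \bigcap_n [set w | local_time_grid m n%:R w].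

Let mG : measurable G.
Proof. by apply: bigcapT_measurable => n; exact: (measurable_local_time_grid HX). Qed.

Let QGC : Q (~` G) = 0%E.
Proof.
apply/negligibleP; first exact: measurableC.
rewrite /G setC_bigcap; apply: negligible_bigcup => n.
have n0 : 0 <= n%:R :> R by [].
have mE := measurable_local_time_grid HX (n%:R : R).
apply/negligibleP; first exact: measurableC.
apply: (penalized_null n0).
  apply: (@measurableC _ (g_sigma_algebraType (@cylinders R [set s | 0 <= s <= n%:R]))).
  exact: (path_filtration_local_time_grid HX n0).
apply/negligibleP; first exact: measurableC.
exact: (local_time_grid_ae HL n0).
Qed.

Let QG A : measurable A -> Q (G `&` A) = Q A.
Proof.
move=> mA; apply/eqP; rewrite eq_le; apply/andP; split.
  by apply: le_measure; rewrite ?inE//; exact: measurableI.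
rewrite -[leRHS]adde0 -QGC.
apply: (@le_trans _ _ (Q ((G `&` A) `|` ~` G))).
  apply: le_measure; rewrite ?inE//.
    by apply: measurableU; [exact: measurableI|exact: measurableC].
  by move=> w Aw; have [Gw|nGw] := pselect (G w); [left|right].
by apply: measureU2; [exact: measurableI|exact: measurableC].
Qed.

Let good t w : G w -> 0 <= t -> cvg (normalized_occupation m t w d @[d --> 0^'+]).
Proof.
move=> Gw t0; apply: (local_time_grid_cvg (Gw (Num.truncn t).+1 Logic.I)) => //.
by apply: ltW; exact: truncnS_gt.
Qed.

Let leL s t w : G w -> 0 <= s -> s <= t -> local_time m s w <= local_time m t w.
Proof.
by move=> Gw s0 st; apply: le_local_time => //; apply: good => //; exact: le_trans st.
Qed.

Let above l n : set (cpath R) := [set w | l < local_time m n%:R w].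

Let m_above l n : measurable (above l n).
Proof.
have := measurable_local_time HX n%:R measurableT (measurable_itv `]l, +oo[).
by rewrite setTI; congr (measurable _); apply/seteqP; split => w /=; rewrite in_itv/= andbT.
Qed.

(** On [G] the events [above l n] increase with [n]; continuity from below identifies the
    probability of their union with the limit of the laws at integer times. *)
Let above_law l : Q (G `&` \bigcup_n above l n) = law `]l, +oo[%classic.
Proof.
rewrite setI_bigcupr.
have c1 : (Q \o (fun n => G `&` above l n)) @ \oo --> Q (\bigcup_n (G `&` above l n)).
  apply: nondecreasing_cvg_mu => [n||i j ij].
  - exact: measurableI.
  - by apply: bigcupT_measurable => n; exact: measurableI.
  apply/subsetPset => w [Gw lw]; split; first exact: Gw.
  by apply: (lt_le_trans lw); apply: (leL Gw); rewrite ?ler_nat.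
have c2 := penalized_law_cvg (measurable_itv `]l, +oo[).
apply: (cvg_unique _ c1); rewrite //.
rewrite [X in X @ _](_ : _ = (fun n => Q [set w | `]l, +oo[%classic (local_time m n%:R w)])) //.
apply/funext => n /=; rewrite QG//; congr (Q _); apply/seteqP.
by split => w /=; rewrite in_itv/= andbT.
Qed.

Let A := G `&` \bigcup_k ~` \bigcup_n above k%:R n.

Let mA : measurable A.
Proof.
apply: measurableI => //; apply: bigcupT_measurable => k; apply: measurableC.
exact: bigcupT_measurable.
Qed.

(** This is the finiteness of the terminal local time: an unbounded local time exceeds every integer
    [k], which has probability at most [1 - primitive h k%:R], and this tends to 0. *)
Let QAC : Q (~` A) = 0%E.
Proof.
pose D := \bigcap_k \bigcup_n above k%:R n.
have mD : measurable D by apply: bigcapT_measurable => k; exact: bigcupT_measurable.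
have -> : ~` A = ~` G `|` D.
  by rewrite /A setCI setC_bigcup /D; under eq_bigcapr do rewrite setCK.
apply/negligibleP; first by apply: measurableU => //; exact: measurableC.
apply: negligibleU; first by apply/negligibleP => //; exact: measurableC.
apply/negligibleP => //.
apply/eqP; rewrite eq_le measure_ge0 andbT.
have QD (k : nat) : (Q D <= (1 - primitive h k%:R)%:E)%E.
  rewrite -(terminal_law_itvy h_meas h_ge0 h_int) -above_law -QG//.
  apply: le_measure; rewrite ?inE.
  - exact: measurableI.
  - by apply: measurableI => //; exact: bigcupT_measurable.
  by move=> w [Gw Dw]; split => //; exact: Dw.
have c0 : (1 - primitive h k%:R)%:E @[k --> \oo] --> (0%R%:E : \bar R).
  apply: cvg_EFin; first exact: nearW.
  rewrite -(subrr 1); apply: cvgB; first exact: cvg_cst.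
  exact: (cvg_primitive h_meas h_ge0 h_int).
apply: (@lee_cvg_to _ _ _ _ (fun=> Q D) _ _ _ (cvg_cst _) c0).
by apply: nearW => k; exact: QD.
Qed.

(** The factor [\1_A] makes the sequence converge for every path, to 0 off [A], so that the limit is
    measurable. *)
Definition terminal_local_time w : R := limn (fun n => \1_A w * local_time m n%:R w).

Let Lcvg w : A w -> local_time m n%:R w @[n --> \oo] --> terminal_local_time w.
Proof.
move=> Aw; have [Gw [k _ kw]] := Aw.
rewrite /terminal_local_time indicE mem_set//.
under [X in limn X]eq_fun do rewrite mul1r.
apply: nondecreasing_is_cvgn; first by move=> i j ij; apply: leL => //; rewrite ler_nat.
exists k%:R => _ [n _ <-]; rewrite leNgt; apply/negP => kn.
by apply: kw; exists n.
Qed.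

Let Lnd w : A w -> nondecreasing_seq (fun n => local_time m n%:R w).
Proof. by move=> [Gw _] i j ij; apply: leL => //; rewrite ler_nat. Qed.

Let Lle n w : A w -> local_time m n%:R w <= terminal_local_time w.
Proof.
move=> Aw; have c := Lcvg Aw; rewrite -(cvg_lim _ c)//.
by apply: nondecreasing_cvgn_le; [exact: Lnd|exact: cvgP c].
Qed.

Lemma measurable_terminal_local_time : measurable_fun setT terminal_local_time.
Proof.
have mAL n : measurable_fun setT (fun w => \1_A w * local_time m n%:R w).
  by apply: measurable_funM; [exact: measurable_indic|exact: (measurable_local_time HX)].
apply: (measurable_fun_cvg mAL) => w _.
have [Aw|nAw] := pselect (A w).
  under eq_fun do rewrite indicE mem_set// mul1r.
  exact: Lcvg.
rewrite /terminal_local_time.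
under eq_fun do rewrite indicE memNset// mul0r.
by rewrite lim_cst//; exact: cvg_cst.
Qed.

(** On [A] the local time is monotone and below its limit, so convergence along integers gives
    convergence along all times. *)
Lemma terminal_local_time_cvg :
  {ae Q, forall w, local_time m t w @[t --> +oo] --> terminal_local_time w}.
Proof.
have aux (a b c e : R) : b <= c -> c <= a -> `|a - b| <= e -> `|a - c| <= e.
  move=> bc ca; rewrite !ger0_norm ?subr_ge0//; last exact: le_trans ca.
  by apply: le_trans; rewrite lerD2l lerN2.
exists (~` A); split => //; first exact: measurableC.
apply: subsetC => w Aw; have [Gw _] := Aw.
apply/cvgrPdist_le => e e0.
have /cvgrPdist_le/(_ e e0)[n _ hn] := Lcvg Aw.
near=> t.
have nt : n%:R <= t by near: t; exact: nbhs_pinfty_ge.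
have Lnt := leL Gw (ler0n _ n) nt.
have Ltl : local_time m t w <= terminal_local_time w.
  apply: le_trans (Lle (Num.truncn t).+1 Aw); apply: leL => //.
  by apply: ltW; exact: truncnS_gt.
exact: aux Lnt Ltl (hn n (leqnn n)).
Unshelve. all: by end_near. Qed.

(** Open half-lines suit increasing limits: on the full event [A] the limit exceeds [l] exactly when
    the local time at some integer does, which leads back to [above_law]. *)
Lemma terminal_local_time_itv l :
  Q (terminal_local_time @^-1` `]l, +oo[) = law `]l, +oo[%classic.
Proof.
rewrite -above_law.
have mpre : measurable (terminal_local_time @^-1` `]l, +oo[).
  by rewrite -[X in measurable X]setTI; exact: measurable_terminal_local_time.
have mU : measurable (\bigcup_n above l n) by exact: bigcupT_measurable.
have QA (X : set (cpath R)) : measurable X -> Q X = Q (A `&` X).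
  move=> mX; apply/eqP; rewrite eq_le; apply/andP; split; last first.
    by apply: le_measure; rewrite ?inE//; exact: measurableI.
  rewrite -[leRHS]adde0 -QAC.
  apply: (@le_trans _ _ (Q ((A `&` X) `|` ~` A))).
    apply: le_measure; rewrite ?inE//.
      by apply: measurableU; [exact: measurableI|exact: measurableC].
    by move=> w Xw; have [Aw|nAw] := pselect (A w); [left|right].
  by apply: measureU2; [exact: measurableI|exact: measurableC].
rewrite QG// QA// [RHS]QA//; congr (Q _).
apply/seteqP; split => w [Aw lw]; split => //.
  move: lw; rewrite /= in_itv/= andbT => lw; apply: contrapT => h'.
  move: lw; rewrite ltNge => /negP; apply.
  apply: (cvgr_to_le (Lcvg Aw)); apply: nearW => n; rewrite leNgt; apply/negP => ln.
  by apply: h'; exists n.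
have [n _ ln] := lw; rewrite /= in_itv/= andbT; apply: (lt_le_trans ln); exact: Lle.
Qed.

End terminal_local_time.

Unset Implicit Arguments.

Theorem proposition5p4 (R : realType)
  (P : R -> probability (cpath R) R) (S : cumulative R R)
  (m nu : {measure set R -> \bar R}) (p : R -> R -> R -> R)
  (HX : linear_diffusion P S m)
  (Hp : transition_density P m p)
  (HL : local_time_exists P m)
  (Hnu : inverse_local_time_levy_measure P m p nu)
  (HA : subexponential (normalized_levy_cdf nu))
  (h : R -> R)
  (h_meas : measurable_fun (`[0, +oo[ : set R) h)
  (h_ge0 : forall x : R, 0 <= x -> 0 <= h x)
  (h_int : (\int[lebesgue_measure]_(x in `[0%R, +oo[) (h x)%:E = 1)%E)
  (Q : probability (cpath R) R)
  (HQ : penalized_measure P S m h Q) :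
  exists Linf : {RV Q >-> R},
    {ae Q, forall w, local_time m t w @[t --> +oo] --> Linf w} /\
    forall B : set R, measurable B ->
      distribution Q Linf B =
      (\int[lebesgue_measure]_(x in B `&` `[0%R, +oo[) (h x)%:E)%E.
Proof.
have mL : measurable_fun setT (terminal_local_time m) by exact: (measurable_terminal_local_time HX).
pose Linf : {RV Q >-> R} := HB.pack (terminal_local_time m)
  (isMeasurableFun.Build _ _ _ _ (terminal_local_time m) mL).
exists Linf; split.
  exact: (terminal_local_time_cvg HX HL Hnu h_meas h_ge0 h_int HQ).
move=> B mB; rewrite -(terminal_lawE h_meas h_ge0).
(* The half-lines []x, +oo[] generate the Borel sets, are stable under intersection and contain a
   sequence that exhausts the line, so agreement of the two finite measures on them is enough. *)
apply: (measure_unique (@RGenOInfty.G R) (fun n => `]- n%:R, +oo[%classic)) => //.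
- exact: RGenOInfty.measurableE.
- move=> _ _ [x ->] [y ->]; exists (Num.max x y).
  by apply/seteqP; split => z /=; rewrite !in_itv/= !andbT gt_max => /andP.
- by move=> n; exists (- n%:R).
- apply/seteqP; split => // x _; exists (Num.truncn `|x|).+1 => //=.
  rewrite in_itv/= andbT ltrNl; apply: (le_lt_trans (ler_norm _)).
  by rewrite normrN truncnS_gt.
- move=> _ [x ->].
  exact: (terminal_local_time_itv HX HL Hnu h_meas h_ge0 h_int HQ x).
- by move=> n; rewrite -ge0_fin_numE// fin_num_measure.
Qed.
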